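(* Let $n\ge1$. Suppose $u\in L^2_{loc}(\mathbb C^n)$ is complex-valued and satisfies $$\bar\partial u=Vu\quad\text{on }\mathbb C^n$$ in the sense of distributions for some $(0,1)$-form $V\in L^p(\mathbb C^n)$, $p>2$. If $V$ has compact support and $$\lim_{z\to\infty}u(z)=0,$$ then $u$ vanishes identically.
   Context: A $(0,1)$-form $V=\sum_{j=1}^nV_j\,d\bar z_j$ is in $L^p$ if all its coefficients $V_j$ are. The equation $\bar\partial u=Vu$ means $\partial u/\partial\bar z_j=V_ju$ for all $j=1,\dots,n$. Functions are identified with continuous representatives where these exist, and pointwise statements (such as the limit at infinity) refer to that representative; ''vanishes identically'' means $u=0$ as an element of $L^2_{loc}$. *)

(* Defs.v *)
From HB Require Import structures.
From mathcomp Require Import all_boot all_order all_algebra.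
From mathcomp Require Import complex.
From mathcomp Require Import all_classical all_reals all_analysis.

Set Implicit Arguments.
Unset Strict Implicit.
Unset Printing Implicit Defensive.

Import Order.TTheory GRing.Theory Num.Theory.
Import numFieldNormedType.Exports.

Local Open Scope classical_set_scope.
Local Open Scope ring_scope.

(* 'rV[R]_n carries the sigma-algebra generated by the n coordinates, which is
   its Borel sigma-algebra. *)
Section measurable_rV.
Context {R : realType} (n : nat).

Let coord (i : 'I_n) (v : 'rV[R]_n) : R := v ord0 i.

Let rV_set0 : g_sigma_preimage coord set0.
Proof. exact: sigma_algebra0. Qed.

Let rV_setC A : g_sigma_preimage coord A -> g_sigma_preimage coord (~` A).
Proof. exact: sigma_algebraC. Qed.

Let rV_bigcup (F : (set 'rV[R]_n)^nat) :
  (forall i, g_sigma_preimage coord (F i)) ->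
  g_sigma_preimage coord (\bigcup_i (F i)).
Proof. exact: sigma_algebra_bigcup. Qed.

HB.instance Definition _ := @isMeasurable.Build default_measure_display
  'rV[R]_n (g_sigma_preimage coord) rV_set0 rV_setC rV_bigcup.

End measurable_rV.

Section measurable_coordinates.
Context {R : realType}.

Lemma measurable_fun_rVP d (T : measurableType d) n (f : T -> 'rV[R]_n) :
  measurable_fun [set: T] f <->
  forall i, measurable_fun [set: T] (fun x => f x ord0 i).
Proof.
pose c (i : 'I_n) (v : 'rV[R]_n) : R := v ord0 i.
apply: (@iff_trans _ (g_sigma_preimage (fun i => c i \o f) `<=` measurable)).
  rewrite g_sigma_preimage_comp; split=> [mf A [/= C preC <-]|prefS].
    exact: mf.
  by move=> _ A mA; apply: prefS; exists A.
split=> [cfS i _ A mA|mf].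
- apply: cfS; apply: sub_sigma_algebra.
  rewrite -bigcup_seq/=; exists i => /=; first by rewrite mem_index_enum.
  by exists A.
- apply: smallest_sub; first exact: sigma_algebra_measurable.
  rewrite -bigcup_seq/=; apply: bigcup_sub => i _ A [B mB <-].
  exact: mf.
Qed.

Definition cons_rV n (p : R * 'rV[R]_n) : 'rV[R]_n.+1 :=
  \row_i (if unlift ord0 i is Some j then p.2 ord0 j else p.1).

Lemma cons_rV0 n (p : R * 'rV[R]_n) : cons_rV p ord0 ord0 = p.1.
Proof. by rewrite mxE unlift_none. Qed.

Lemma cons_rVS n (p : R * 'rV[R]_n) i :
  cons_rV p ord0 (lift ord0 i) = p.2 ord0 i.
Proof. by rewrite mxE liftK. Qed.

Lemma measurable_cons_rV n : measurable_fun [set: R * 'rV[R]_n] (@cons_rV n).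
Proof.
apply/measurable_fun_rVP => i; have [j ->|->] := unliftP ord0 i.
  rewrite (_ : (fun x => _) = (fun v : 'rV[R]_n => v ord0 j) \o snd).
    apply: measurableT_comp; last exact: measurable_snd.
    exact: (proj1 (measurable_fun_rVP _) (@measurable_id _ _ _) j).
  by apply/funext => p; rewrite cons_rVS.
rewrite (_ : (fun x => _) = fst); first exact: measurable_fst.
by apply/funext => p; rewrite cons_rV0.
Qed.

Definition uncons_rV n (v : 'rV[R]_n.+1) : R * 'rV[R]_n :=
  (v ord0 ord0, \row_i v ord0 (lift ord0 i)).

Lemma cons_rVK n : cancel (@cons_rV n) (@uncons_rV n).
Proof.
case=> x v; rewrite /uncons_rV cons_rV0; congr pair.
by apply/rowP => i; rewrite mxE cons_rVS.
Qed.

Lemma uncons_rVK n : cancel (@uncons_rV n) (@cons_rV n).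
Proof.
move=> v; apply/rowP => i; have [j ->|->] := unliftP ord0 i.
  by rewrite cons_rVS mxE.
by rewrite cons_rV0.
Qed.

Lemma measurable_uncons_rV n :
  measurable_fun [set: 'rV[R]_n.+1] (@uncons_rV n).
Proof.
have mc := proj1 (measurable_fun_rVP _) (@measurable_id _ 'rV[R]_n.+1 setT).
apply/measurable_fun_pair; first exact: mc.
by apply/measurable_fun_rVP => i; under eq_fun do rewrite mxE; exact: mc.
Qed.

End measurable_coordinates.

Lemma product_sigma_finite d1 d2 (T1 : measurableType d1)
    (T2 : measurableType d2) (R : realType)
    (m1 : {sigma_finite_measure set T1 -> \bar R})
    (m2 : {sigma_finite_measure set T2 -> \bar R}) :
  sigma_finite setT (m1 \x m2)%E.
Proof.
have /sigma_finiteP[F [TF ndF Foo]] := sigma_finiteT m1.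
have /sigma_finiteP[G [TG ndG Goo]] := sigma_finiteT m2.
exists (fun n => F n `*` G n).
  rewrite -setXTT TF TG predeqE => -[x y]; split.
    move=> [/= [n _ Fnx] [k _ Gky]]; exists (maxn n k) => //; split.
    - by move: x Fnx; exact/subsetPset/ndF/leq_maxl.
    - by move: y Gky; exact/subsetPset/ndG/leq_maxr.
  by move=> [n _ []/= ? ?]; split; exists n.
move=> k; have [? ?] := Foo k; have [? ?] := Goo k.
split; first exact: measurableX.
by rewrite product_measure1E// lte_mul_pinfty// ge0_fin_numE.
Qed.

Section lebesgue_cons.
Local Open Scope ereal_scope.
Context {R : realType} {n : nat}.
Variable m : {sigma_finite_measure set 'rV[R]_n -> \bar R}.

Definition lebesgue_cons : set 'rV[R]_n.+1 -> \bar R :=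
  pushforward (@lebesgue_measure R \x m) (@cons_rV R n).

Let lebesgue_cons0 : lebesgue_cons set0 = 0.
Proof. by rewrite /lebesgue_cons /pushforward preimage_set0 measure0. Qed.

Let lebesgue_cons_ge0 A : 0 <= lebesgue_cons A.
Proof. by rewrite /lebesgue_cons /pushforward measure_ge0. Qed.

Let preimage_cons (A : set 'rV[R]_n.+1) :
  measurable A -> measurable (@cons_rV R n @^-1` A).
Proof.
by move=> mA; rewrite -[X in measurable X]setTI; exact: measurable_cons_rV.
Qed.

Let lebesgue_cons_sigma_additive : semi_sigma_additive lebesgue_cons.
Proof.
move=> F mF tF mUF; rewrite /lebesgue_cons /pushforward preimage_bigcup.
apply: measure_semi_sigma_additive.
- by move=> k; exact: preimage_cons.
- apply/trivIsetP => /= i j _ _ ij; rewrite -preimage_setI.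
  by move/trivIsetP : tF => /(_ _ _ _ _ ij) ->//; rewrite preimage_set0.
- by rewrite -preimage_bigcup; exact: preimage_cons.
Qed.

HB.instance Definition _ := isMeasure.Build _ _ _ lebesgue_cons
  lebesgue_cons0 lebesgue_cons_ge0 lebesgue_cons_sigma_additive.

Lemma lebesgue_cons_uncons (A : set (R * 'rV[R]_n)) :
  lebesgue_cons (@uncons_rV R n @^-1` A) = (@lebesgue_measure R \x m) A.
Proof.
rewrite /lebesgue_cons /pushforward -comp_preimage.
by rewrite (_ : _ \o _ = id) ?preimage_id//; apply/funext; exact: cons_rVK.
Qed.

Let lebesgue_cons_sigma_finite : sigma_finite setT lebesgue_cons.
Proof.
have [F TF Foo] := product_sigma_finite (@lebesgue_measure R) m.
exists (fun k => @uncons_rV R n @^-1` F k).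
  by rewrite -preimage_bigcup -TF preimage_setT.
move=> k; have [mF Fk] := Foo k; split; last by rewrite lebesgue_cons_uncons.
by rewrite -[X in measurable X]setTI; exact: measurable_uncons_rV.
Qed.

HB.instance Definition _ := Measure_isSigmaFinite.Build _ _ _ lebesgue_cons
  lebesgue_cons_sigma_finite.

End lebesgue_cons.

(* n-dimensional Lebesgue measure as the iterated product of the
   one-dimensional one, transported along R * R^k -> R^(k+1); lebesgue_rV_box
   is the characterization by boxes. *)
Fixpoint lebesgue_rV {R : realType} (n : nat) :
    {sigma_finite_measure set 'rV[R]_n -> \bar R} :=
  match n with
  | 0 => \d_ (0 : 'rV[R]_0)
  | k.+1 => lebesgue_cons (lebesgue_rV k)
  end.

Lemma lebesgue_rV_box {R : realType} n (A : 'I_n -> set R) :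
  (forall i, measurable (A i)) ->
  lebesgue_rV n [set v : 'rV[R]_n | forall i, A i (v ord0 i)] =
  (\prod_(i < n) lebesgue_measure (A i))%E.
Proof.
elim: n A => [A _|n IHn A mA] /=.
  by rewrite big_ord0 diracE mem_set// => -[].
set B := [set v : 'rV[R]_n | forall i, A (lift ord0 i) (v ord0 i)].
have mB : measurable B.
  rewrite (_ : B = \bigcap_(i in [set: 'I_n])
     ((fun v : 'rV[R]_n => v ord0 i) @^-1` A (lift ord0 i))).
    apply: fin_bigcap_measurable => // i _; rewrite -[X in measurable X]setTI.
    exact: (proj1 (measurable_fun_rVP _) (@measurable_id _ _ _) i).
  by apply/seteqP; split => v /= Bv i => [_|]; apply: Bv.
rewrite (_ : [set _ | _] = @uncons_rV R n @^-1` (A ord0 `*` B)).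
  rewrite lebesgue_cons_uncons product_measure1E//; last exact: mA.
  by rewrite big_ord_recl; congr (_ * _)%E; exact: IHn.
apply/seteqP; split=> v /= => [Av|[A0 AS] i].
  by split=> [|i]; rewrite ?mxE; apply: Av.
have [j ->|->//] := unliftP ord0 i.
by have := AS j; rewrite mxE.
Qed.

(* C^n is identified with R^n x R^n through z = x + i y; a point is (x, y).
   The norm is the maximum of the |x_j| and |y_j|. *)
Notation Cn R n := ('rV[R]_n * 'rV[R]_n)%type.

Definition lebesgue_Cn (R : realType) (n : nat) :
    {measure set (Cn R n) -> \bar R} :=
  (lebesgue_rV n \x lebesgue_rV n)%E.

Section complex_functions.
Context {R : realType} {n : nat}.
Local Notation mu := (lebesgue_Cn R n).
Implicit Types (f u w : Cn R n -> R[i]) (V : 'I_n -> Cn R n -> R[i]).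

Definition Cmeasurable f :=
  measurable_fun [set: Cn R n] (fun z => complex.Re (f z)) /\
  measurable_fun [set: Cn R n] (fun z => complex.Im (f z)).

Definition cmod f : Cn R n -> R := fun z => Normc.normc (f z).

Definition Cintegral f : R[i] :=
  ((\int[mu]_z complex.Re (f z)) +i* (\int[mu]_z complex.Im (f z)))%C.

Definition in_Lp (p : \bar R) f := Cmeasurable f /\ finite_norm mu p (cmod f).

Definition in_L2loc f := Cmeasurable f /\
  forall K : set (Cn R n), compact K ->
    (\int[mu]_(z in K) ((cmod f z) ^+ 2)%:E < +oo)%E.

(* A (0,1)-form is the family of its coefficients V_j; its support is the
   complement of the largest open set on which V = 0 almost everywhere. *)
Definition form_in_Lp (p : \bar R) V := forall j, in_Lp p (V j).

Definition form_support V : set (Cn R n) :=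
  ~` [set z : Cn R n | exists2 U : set (Cn R n), nbhs z U &
        {ae mu, forall x : Cn R n, U x -> forall j, V j x = 0}].

(* inl j is the direction of x_j, inr j the direction of y_j. *)
Definition direction (a : 'I_n + 'I_n) : Cn R n :=
  match a with
  | inl j => (delta_mx ord0 j, 0)
  | inr j => (0, delta_mx ord0 j)
  end.

Definition partial (a : 'I_n + 'I_n) (g : Cn R n -> R) : Cn R n -> R :=
  fun z => 'D_(direction a) g z.

Definition smooth (g : Cn R n -> R) := forall s : seq ('I_n + 'I_n),
  continuous (foldr partial g s) /\
  forall a z, derivable (foldr partial g s) z (direction a).

Definition test_function f :=
  [/\ smooth (fun z => complex.Re (f z)),
      smooth (fun z => complex.Im (f z)) &
      compact (closure [set z | f z != 0])].

Definition Cpartial (a : 'I_n + 'I_n) f : Cn R n -> R[i] := fun z =>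
  (partial a (fun x => complex.Re (f x)) z +i*
   partial a (fun x => complex.Im (f x)) z)%C.

(* The Wirtinger derivative d/d(bar z_j) = (d/dx_j + i d/dy_j) / 2. *)
Definition dbar (j : 'I_n) f : Cn R n -> R[i] := fun z =>
  (Cpartial (inl j) f z + 'i%C * Cpartial (inr j) f z) / 2%:R.

(* du/d(bar z_j) = g_j in the sense of distributions. *)
Definition weak_dbar (j : 'I_n) u (g : Cn R n -> R[i]) :=
  forall phi, test_function phi ->
    Cintegral (fun z => u z * dbar j phi z) =
    - Cintegral (fun z => g z * phi z).

Definition dbar_equation u V :=
  forall j, weak_dbar j u (fun z => V j z * u z).

Definition Cn_infty : set_system (Cn R n) :=
  filter_from [set: R] (fun M => [set z | M < `|z|]).

(* An element u of L^2_loc is a class of functions, so its limit at infinity is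
   that of its continuous representative near infinity. *)
Definition vanishes_at_infinity u := exists w : Cn R n -> (R[i] : numFieldType),
  [/\ u = w %[ae mu],
      exists2 K, compact K & forall z, ~ K z -> {for z, continuous w} &
      w z @[z --> Cn_infty] --> (0 : (R[i] : numFieldType))].

End complex_functions.
Arguments lebesgue_Cn : clear implicits.

(* Main.v *)
(** Only the equation in the first variable is used. Write z = (z1, z') and
    test it against chi(z1/r) k(a - z1) beta(z'), where k is a smooth
    regularization of 1/w whose dbar is a mollifier. Since u tends to 0 at
    infinity, the error caused by the cut-off chi disappears as r grows, so the
    mollification of u in z1 is the regularized Cauchy transform of V_1 u.
    Integrating over boxes and removing the regularization yields c u = C[V_1 u]
    almost everywhere, C being the Cauchy transform on the slices z' = const.

    On almost every slice one is left with v = C[W v], where p > 2 and the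
    integrability of W make M = sup_z int |W(a)| / |z - a| finite. Put F = C[W]
    and G = 1 - F/N. The product formula C[f] C[g] = C[f C[g] + g C[f]] gives
    v G^N = - C[W v G^(N-1) F] / N. As |G| >= 1/2 for N large, h = v G^N
    satisfies int |W h| <= (const M^2 / N) int |W h|, whence W v = 0 and
    v = C[0] = 0. *)

From HB Require Import structures.
Require Import Defs.
From mathcomp Require Import all_boot all_order all_algebra.
From mathcomp Require Import complex.
From mathcomp Require Import all_classical all_reals all_analysis.
From mathcomp Require Import measurable_realfun ess_sup_inf.
From mathcomp Require Import ring lra.

Set Implicit Arguments.
Unset Strict Implicit.
Unset Printing Implicit Defensive.

Import Order.TTheory GRing.Theory Num.Theory.
Import numFieldNormedType.Exports.
Import Normc.

Local Open Scope classical_set_scope.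
Local Open Scope ring_scope.

(** * Complex-valued integrals *)

(** For [v = C[W v]] the classical proof multiplies by the integrating factor [exp(- C[W])], obtains
    a holomorphic function and ends with Liouville's theorem. Here [G^N = (1 - F/N)^N] stands in for
    the exponential: it needs only finitely many products of Cauchy transforms, and its failure to
    be an exact integrating factor is a remainder of order 1/N that can be absorbed. Liouville's
    theorem is replaced by the representation [c u = C[V_1 u]], in which the decay at infinity is
    already spent. The condition p > 2 places the kernel 1/|w| in the conjugate Lebesgue space near
    its pole. For the cut-off, the gradient is O(1/r) and the kernel has mass O(r) on a square of
    radius r, so the error is bounded but not small by size alone; the decay of [u] makes it small.
    Since [u] is only a class in L^2_loc, an identity for each pole and each scale would bring its
    own null set. Everything is therefore kept as an equality of integrals over boxes until all
    limits are taken; boxes then determine the function up to a single null set. *)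

Section complex_modulus.
Context {R : rcfType}.
Implicit Types (z w : R[i]) (a : R).

Lemma normc_ge0 z : 0 <= normc z.
Proof. by case: z => a b; exact: sqrtr_ge0. Qed.

Lemma normc_real a : normc a%:C%C = `|a|.
Proof. by rewrite /= expr0n addr0 sqrtr_sqr. Qed.

Lemma le_normRe z : `|complex.Re z| <= normc z.
Proof.
case: z => a b /=; rewrite -sqrtr_sqr; apply: ler_wsqrtr.
by rewrite lerDl sqr_ge0.
Qed.

Lemma le_normIm z : `|complex.Im z| <= normc z.
Proof.
case: z => a b /=; rewrite -sqrtr_sqr; apply: ler_wsqrtr.
by rewrite lerDr sqr_ge0.
Qed.

Lemma normc_le_ReIm z : normc z <= `|complex.Re z| + `|complex.Im z|.
Proof.
case: z => a b /=; rewrite -[leRHS]ger0_norm ?addr_ge0// -[leRHS]sqrtr_sqr.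
apply: ler_wsqrtr; rewrite sqrrD !real_normK ?num_real// lerD2r lerDl.
by rewrite mulrn_wge0// mulr_ge0.
Qed.

Lemma normc0_eq0 z : (normc z == 0) = (z == 0).
Proof. by apply/eqP/eqP => [/eq0_normc//|->]; rewrite normc0. Qed.

Lemma normcB z w : normc (z - w) = normc (w - z).
Proof. by rewrite -normcN opprB. Qed.

Lemma normcX z n : normc (z ^+ n) = normc z ^+ n.
Proof. by elim: n => [|n IH]; rewrite ?expr0 ?normc1// !exprS normcM IH. Qed.

Lemma cReM z w : complex.Re (z * w) =
  complex.Re z * complex.Re w - complex.Im z * complex.Im w.
Proof. by case: z; case: w. Qed.

Lemma cImM z w : complex.Im (z * w) =
  complex.Re z * complex.Im w + complex.Im z * complex.Re w.
Proof. by case: z; case: w. Qed.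

Lemma cReD z w : complex.Re (z + w) = complex.Re z + complex.Re w.
Proof. by case: z; case: w. Qed.

Lemma cImD z w : complex.Im (z + w) = complex.Im z + complex.Im w.
Proof. by case: z; case: w. Qed.

Lemma cReN z : complex.Re (- z) = - complex.Re z.
Proof. by case: z. Qed.

Lemma cImN z : complex.Im (- z) = - complex.Im z.
Proof. by case: z. Qed.

End complex_modulus.

Section complex_measurable.
Context d (T : measurableType d) (R : realType).
Implicit Types f g : T -> R[i].

(** [Cmeasurable] over an arbitrary measurable space, since planes, slices and their products occur
    besides [Cn]. *)
Definition cmeas f := measurable_fun [set: T] (fun x => complex.Re (f x)) /\
  measurable_fun [set: T] (fun x => complex.Im (f x)).

Lemma cmeasD f g : cmeas f -> cmeas g -> cmeas (fun x => f x + g x).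
Proof.
move=> [fr fi] [gr gi]; split; under eq_fun do rewrite ?cReD ?cImD;
  exact: measurable_funD.
Qed.

Lemma cmeasN f : cmeas f -> cmeas (fun x => - f x).
Proof.
move=> [fr fi]; split; under eq_fun do rewrite ?cReN ?cImN;
  exact: measurable_funN.
Qed.

Lemma cmeasB f g : cmeas f -> cmeas g -> cmeas (fun x => f x - g x).
Proof. by move=> mf mg; apply: cmeasD => //; exact: cmeasN. Qed.

Lemma cmeasM f g : cmeas f -> cmeas g -> cmeas (fun x => f x * g x).
Proof.
move=> [fr fi] [gr gi]; split; under eq_fun do rewrite ?cReM ?cImM.
  by apply: measurable_funB; exact: measurable_funM.
by apply: measurable_funD; exact: measurable_funM.
Qed.

Lemma cmeas_cst (c : R[i]) : cmeas (fun=> c).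
Proof. by split; exact: measurable_cst. Qed.

Lemma cmeas_real (f : T -> R) : measurable_fun setT f ->
  cmeas (fun x => (f x)%:C%C).
Proof. by move=> mf; split => //=; exact: measurable_cst. Qed.

Lemma cmeasX f n : cmeas f -> cmeas (fun x => f x ^+ n).
Proof.
move=> mf; elim: n => [|n IH]; first exact: cmeas_cst.
by under eq_fun do rewrite exprS; exact: cmeasM.
Qed.

Lemma measurable_sqrt : measurable_fun [set: R] (@Num.sqrt R).
Proof.
apply: continuous_measurable_fun; exact: sqrt_continuous.
Qed.

Lemma measurable_normc f : cmeas f -> measurable_fun setT (fun x => normc (f x)).
Proof.
move=> [fr fi].
have -> : (fun x => normc (f x)) =
   (@Num.sqrt R) \o (fun x => complex.Re (f x) ^+ 2 + complex.Im (f x) ^+ 2).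
  by apply/funext => x /=; case: (f x).
by apply: (measurableT_comp measurable_sqrt);
  apply: measurable_funD; exact: measurable_funX.
Qed.

Lemma cmeasV f : cmeas f -> cmeas (fun x => (f x)^-1).
Proof.
move=> [fr fi].
have mN : measurable_fun setT
    (fun x => (complex.Re (f x) ^+ 2 + complex.Im (f x) ^+ 2)^-1).
  have -> : (fun x => (complex.Re (f x) ^+ 2 + complex.Im (f x) ^+ 2)^-1) =
      (@powR R ^~ (-1)) \o
      (fun x => complex.Re (f x) ^+ 2 + complex.Im (f x) ^+ 2).
    by apply/funext => x /=; rewrite powR_inv1// addr_ge0// sqr_ge0.
  apply: (measurableT_comp (measurable_powR _)).
  by apply: measurable_funD; exact: measurable_funX.
split.
  have -> : (fun x => complex.Re (f x)^-1) = (fun x => complex.Re (f x) *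
      (complex.Re (f x) ^+ 2 + complex.Im (f x) ^+ 2)^-1).
    by apply/funext => x; case: (f x).
  exact: measurable_funM.
have -> : (fun x => complex.Im (f x)^-1) = (fun x => - complex.Im (f x) *
    (complex.Re (f x) ^+ 2 + complex.Im (f x) ^+ 2)^-1).
  by apply/funext => x; case: (f x) => a b /=; rewrite mulNr.
by apply: measurable_funM => //; exact: measurable_funN.
Qed.

End complex_measurable.

Lemma cmeas_comp d d2 (T : measurableType d) (T2 : measurableType d2)
    (R : realType) (h : T2 -> T) (f : T -> R[i]) :
  measurable_fun setT h -> cmeas f -> cmeas (fun x => f (h x)).
Proof. by move=> mh [fr fi]; split; [exact: (measurableT_comp fr mh)|
  exact: (measurableT_comp fi mh)]. Qed.

Section complex_integral.
Context d (T : measurableType d) (R : realType).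
Variable mu : {measure set T -> \bar R}.
Implicit Types f g : T -> R[i].

Definition cintble f :=
  cmeas f /\ (\int[mu]_x (normc (f x))%:E < +oo)%E.

(** On [Cn] this is convertible with [Cintegral], so [weak_dbar] can be used directly as a statement
    about [cint]. *)
Definition cint f : R[i] :=
  ((\int[mu]_x complex.Re (f x)) +i* (\int[mu]_x complex.Im (f x)))%C.

Lemma cintble_norm f : cintble f ->
  mu.-integrable setT (fun x => (normc (f x))%:E).
Proof.
move=> [mf fy]; apply/integrableP; split.
  by apply/measurable_EFinP; exact: measurable_normc.
by under eq_integral do rewrite gee0_abs ?lee_fin ?normc_ge0//.
Qed.

Lemma cintbleP f : cmeas f -> mu.-integrable setT (fun x => (normc (f x))%:E) ->
  cintble f.
Proof.
move=> mf /integrableP[_]; split => //.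
by under eq_integral do rewrite -[X in X%:E]ger0_norm ?normc_ge0//.
Qed.

Lemma cintble_ae_le f (g : T -> R) : cmeas f ->
  mu.-integrable setT (EFin \o g) -> {ae mu, forall x, normc (f x) <= g x} ->
  cintble f.
Proof.
move=> mf ig fg; split => //.
have mn : measurable_fun setT (fun x => (normc (f x))%:E).
  by apply/measurable_EFinP; exact: measurable_normc.
move/integrableP : (ig) => [mg]; apply: le_lt_trans.
apply: ae_ge0_le_integral => //.
- by move=> x _; rewrite lee_fin normc_ge0.
- exact: measurableT_comp.
- by apply: filterS fg => x fgx _ /=; rewrite lee_fin (le_trans fgx)// ler_norm.
Qed.

Lemma cintble_le f (g : T -> R) : cmeas f ->
  mu.-integrable setT (EFin \o g) -> (forall x, normc (f x) <= g x) ->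
  cintble f.
Proof. by move=> mf ig fg; apply: (cintble_ae_le mf ig); exact: aeW. Qed.

Lemma cintble_Re f : cintble f ->
  mu.-integrable setT (fun x => (complex.Re (f x))%:E).
Proof.
move=> fi; apply: le_integrable (cintble_norm fi) => //.
  by apply/measurable_EFinP; exact: fi.1.1.
by move=> x _ /=; rewrite lee_fin (le_trans (le_normRe _))// ler_norm.
Qed.

Lemma cintble_Im f : cintble f ->
  mu.-integrable setT (fun x => (complex.Im (f x))%:E).
Proof.
move=> fi; apply: le_integrable (cintble_norm fi) => //.
  by apply/measurable_EFinP; exact: fi.1.2.
by move=> x _ /=; rewrite lee_fin (le_trans (le_normIm _))// ler_norm.
Qed.

Lemma integrable_scale (c : R) (h : T -> R) :
  mu.-integrable setT (EFin \o h) ->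
  mu.-integrable setT (EFin \o (fun x => c * h x)).
Proof. by move=> ih; exact: (integrableZl measurableT c ih). Qed.

Lemma cintbleD f g : cintble f -> cintble g -> cintble (fun x => f x + g x).
Proof.
move=> fi gi; apply: (@cintble_le _ (fun x => normc (f x) + normc (g x))).
- exact: cmeasD fi.1 gi.1.
- exact: integrableD (cintble_norm fi) (cintble_norm gi).
- by move=> x; exact: le_normcD.
Qed.

Lemma cintbleMl (h : T -> R[i]) (M : R) f : cmeas h ->
  (forall x, normc (h x) <= M) -> cintble f -> cintble (fun x => h x * f x).
Proof.
move=> mh hM fi; apply: (@cintble_le _ (fun x => M * normc (f x))).
- by apply: cmeasM => //; exact: fi.1.
- exact: integrableZl (cintble_norm fi).
- by move=> x; rewrite normcM ler_wpM2r// normc_ge0.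
Qed.

Lemma cintbleZ c f : cintble f -> cintble (fun x => c * f x).
Proof. by apply: (@cintbleMl (cst c) (normc c)) => //; exact: cmeas_cst. Qed.

Lemma cintbleB f g : cintble f -> cintble g -> cintble (fun x => f x - g x).
Proof.
move=> fi gi; under eq_fun do rewrite -mulN1r.
by apply: cintbleD => //; exact: cintbleZ.
Qed.

Lemma cint_add f g : cintble f -> cintble g ->
  cint (fun x => f x + g x) = cint f + cint g.
Proof.
move=> fi gi; rewrite /cint.
under [in X in (X +i* _)%C]eq_Rintegral do rewrite cReD.
under [in X in (_ +i* X)%C]eq_Rintegral do rewrite cImD.
rewrite RintegralD//; [|exact: cintble_Re..].
by rewrite RintegralD//; exact: cintble_Im.
Qed.

Lemma cint_scale c f : cintble f -> cint (fun x => c * f x) = c * cint f.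
Proof.
case: c => a b fi; have ir := cintble_Re fi; have ii := cintble_Im fi.
rewrite /cint.
under [in X in (X +i* _)%C]eq_Rintegral do rewrite cReM/=.
under [in X in (_ +i* X)%C]eq_Rintegral do rewrite cImM/=.
rewrite RintegralB//; [|exact: integrable_scale..].
rewrite RintegralD//; [|exact: integrable_scale..].
by rewrite !RintegralZl.
Qed.

Lemma cint_sub f g : cintble f -> cintble g ->
  cint (fun x => f x - g x) = cint f - cint g.
Proof.
move=> fi gi; have -> : (fun x => f x - g x) = (fun x => f x + (-1) * g x).
  by apply/funext => x; rewrite mulN1r.
rewrite cint_add//; last exact: cintbleZ.
by rewrite cint_scale// mulN1r.
Qed.

Lemma ae_eq_cint f g : cmeas f -> cmeas g -> {ae mu, forall x, f x = g x} ->
  cint f = cint g.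
Proof.
move=> mf mg fg; congr (_ +i* _)%C; congr fine; apply: ae_eq_integral => //.
- by apply/measurable_EFinP; exact: mf.1.
- by apply/measurable_EFinP; exact: mg.1.
- by apply: filterS fg => x -> _.
- by apply/measurable_EFinP; exact: mf.2.
- by apply/measurable_EFinP; exact: mg.2.
- by apply: filterS fg => x -> _.
Qed.

Lemma ae_eq_cintble f g : cmeas f -> cintble g ->
  {ae mu, forall x, f x = g x} -> cintble f.
Proof.
move=> mf gi fg; apply: (@cintble_ae_le _ (fun x => normc (g x))) => //.
  exact: cintble_norm.
by apply: filterS fg => x ->.
Qed.

(** The factor 2 comes from estimating real and imaginary parts separately. It is the source of the
    bound [2 * M] on potentials. *)
Lemma normc_cint_le f : cintble f ->
  ((normc (cint f))%:E <= 2%:E * \int[mu]_x (normc (f x))%:E)%E.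
Proof.
move=> fi; have ir := cintble_Re fi; have ii := cintble_Im fi.
have inn := cintble_norm fi.
have Re_le : (`|\int[mu]_x complex.Re (f x)|%:E <=
    \int[mu]_x (normc (f x))%:E)%E.
  rewrite EFin_normr_Rintegral//; apply: le_trans (le_abse_integral _ _ _) _ => //.
    exact: measurable_int ir.
  apply: ge0_le_integral => //.
  - by apply: measurableT_comp => //; exact: measurable_int ir.
  - exact: measurable_int inn.
  - by move=> x _; rewrite lee_fin; exact: le_normRe.
have Im_le : (`|\int[mu]_x complex.Im (f x)|%:E <=
    \int[mu]_x (normc (f x))%:E)%E.
  rewrite EFin_normr_Rintegral//; apply: le_trans (le_abse_integral _ _ _) _ => //.
    exact: measurable_int ii.
  apply: ge0_le_integral => //.
  - by apply: measurableT_comp => //; exact: measurable_int ii.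
  - exact: measurable_int inn.
  - by move=> x _; rewrite lee_fin; exact: le_normIm.
rewrite mule_natl mule2n; apply: le_trans (leeD Re_le Im_le).
by rewrite -EFinD lee_fin; exact: normc_le_ReIm.
Qed.

(** Dominated convergence applied to the real functions [normc (f_ n x - f x)], which are at most
    [2 * g]. Convergence in [R[i]] is expressed through the modulus. *)
Lemma cint_dominated (f_ : nat -> T -> R[i]) f (g : T -> R) :
  (forall n, cmeas (f_ n)) -> cmeas f ->
  {ae mu, forall x, (fun n => normc (f_ n x - f x)) @ \oo --> (0 : R)} ->
  mu.-integrable setT (EFin \o g) ->
  {ae mu, forall x n, normc (f_ n x) <= g x} ->
  cintble f /\ (fun n => normc (cint (f_ n) - cint f)) @ \oo --> (0 : R).
Proof.
move=> mf_ mf f_f ig f_g.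
have fg : {ae mu, forall x, normc (f x) <= g x}.
  apply: filterS2 f_f f_g => x f_fx f_gx.
  apply/ler_addgt0Pr => e e0.
  have /cvgrPdist_lt /(_ _ e0)[n _ /(_ n (leqnn n))/=] := f_fx.
  rewrite sub0r normrN ger0_norm ?normc_ge0// normcB => fe.
  rewrite -[f x](subrK (f_ n x)); apply: le_trans (le_normcD _ _) _.
  by rewrite addrC lerD// ltW.
have fi : cintble f := cintble_ae_le mf ig fg.
have f_i n : cintble (f_ n).
  by apply: (cintble_ae_le (mf_ n) ig); apply: filterS f_g => x; exact.
split=> //.
have mB n : cmeas (fun x => f_ n x - f x) by exact: cmeasB.
have [] := @dominated_convergence _ T R mu setT measurableT
  (fun n x => (normc (f_ n x - f x))%:E) (cst 0%E) (fun x => (2 * g x)%:E).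
- by move=> n; apply/measurable_EFinP; exact: measurable_normc.
- exact: measurable_cst.
- apply: filterS f_f => x f_fx _.
  by apply: cvg_EFin => //; exact: nearW.
- exact: integrable_scale.
- apply: filterS2 fg f_g => x fgx f_gx n _.
  rewrite gee0_abs ?lee_fin ?normc_ge0// mulr2n mulrDl !mul1r.
  by apply: le_trans (le_normcD _ _) _; rewrite normcN lerD.
move=> _ _; rewrite integral0 => cvg0'.
have cvg0 : (fun n => (2%:E * \int[mu]_x (normc (f_ n x - f x))%:E)%E) @ \oo
    --> (0 : \bar R)%E.
  by rewrite -(mule0 2%:E); apply: cvgeZl.
have bnd n : ((normc (cint (f_ n) - cint f))%:E <=
    2%:E * \int[mu]_x (normc (f_ n x - f x))%:E)%E.
  by rewrite -cint_sub//; apply: normc_cint_le; exact: cintbleB.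
have /fine_cvg : (fun n => (normc (cint (f_ n) - cint f))%:E) @ \oo --> 0%:E.
  apply: (squeeze_cvge _ (cvg_cst _) cvg0).
  by apply: nearW => n; rewrite lee_fin normc_ge0 bnd.
exact.
Qed.

End complex_integral.

Section product_sigma_finite_instance.
Context d1 d2 (T1 : measurableType d1) (T2 : measurableType d2) (R : realType).
Variable m1 : {sigma_finite_measure set T1 -> \bar R}.
Variable m2 : {sigma_finite_measure set T2 -> \bar R}.

(* [m1 \x m2] already carries canonical structures keyed on probability
   measures, hence this alias. *)
Definition sfprod : set (T1 * T2) -> \bar R := (m1 \x m2)%E.

HB.instance Definition _ := Measure.copy sfprod (m1 \x m2)%E.
HB.instance Definition _ := Measure_isSigmaFinite.Build _ _ _ sfprod
  (product_sigma_finite m1 m2).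

End product_sigma_finite_instance.

(** * Fubini's theorem for complex-valued functions *)

Section complex_fubini.
Context d1 d2 (T1 : measurableType d1) (T2 : measurableType d2) (R : realType).
Variable m1 : {sigma_finite_measure set T1 -> \bar R}.
Variable m2 : {sigma_finite_measure set T2 -> \bar R}.
Implicit Types f : T1 * T2 -> R[i].

Lemma cmeas_pair1 f x : cmeas f -> cmeas (fun y => f (x, y)).
Proof. by apply: cmeas_comp; exact: pair1_measurable. Qed.

Lemma cmeas_pair2 f y : cmeas f -> cmeas (fun x => f (x, y)).
Proof. by apply: cmeas_comp; exact: pair2_measurable. Qed.

Lemma measurable_Rintegral1 (h : T1 * T2 -> R) : measurable_fun setT h ->
  measurable_fun setT (fun x => \int[m2]_y h (x, y)).
Proof.
move=> mh; apply: measurableT_comp => //.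
have mh' : measurable_fun setT (EFin \o h) by exact/measurable_EFinP.
rewrite (_ : (fun x => _) = (fun x => \int[m2]_y (EFin \o h)^\+ (x, y)
    - \int[m2]_y (EFin \o h)^\- (x, y))%E).
  by apply: emeasurable_funB; apply: measurable_fun_fubini_tonelli_F => //;
    [exact: measurable_funepos|exact: measurable_funeneg].
apply/funext => x; rewrite [LHS]integralE; congr (_ - _)%E;
  by apply: eq_integral => z _; rewrite ?funeposE ?funenegE.
Qed.

Lemma measurable_Rintegral2 (h : T1 * T2 -> R) : measurable_fun setT h ->
  measurable_fun setT (fun y => \int[m1]_x h (x, y)).
Proof.
move=> mh; apply: measurableT_comp => //.
have mh' : measurable_fun setT (EFin \o h) by exact/measurable_EFinP.
rewrite (_ : (fun y => _) = (fun y => \int[m1]_x (EFin \o h)^\+ (x, y)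
    - \int[m1]_x (EFin \o h)^\- (x, y))%E).
  by apply: emeasurable_funB; apply: measurable_fun_fubini_tonelli_G => //;
    [exact: measurable_funepos|exact: measurable_funeneg].
apply/funext => x; rewrite [LHS]integralE; congr (_ - _)%E;
  by apply: eq_integral => z _; rewrite ?funeposE ?funenegE.
Qed.

Lemma measurable_integral_normc1 f : cmeas f ->
  measurable_fun setT (fun x => \int[m2]_y (normc (f (x, y)))%:E)%E.
Proof.
move=> mf.
have := @measurable_fun_fubini_tonelli_F _ _ _ _ _ m2 (fun z => (normc (f z))%:E).
by apply => [|z]; [apply/measurable_EFinP; exact: measurable_normc|
  rewrite lee_fin normc_ge0].
Qed.

Lemma cmeas_cint1 f : cmeas f -> cmeas (fun x => cint m2 (fun y => f (x, y))).
Proof. by move=> [fr fi]; split;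
  [exact: (measurable_Rintegral1 fr)|exact: (measurable_Rintegral1 fi)]. Qed.

Lemma cmeas_cint2 f : cmeas f -> cmeas (fun y => cint m1 (fun x => f (x, y))).
Proof. by move=> [fr fi]; split;
  [exact: (measurable_Rintegral2 fr)|exact: (measurable_Rintegral2 fi)]. Qed.

(** Fubini's theorem has extended real inner integrals; [fine] leaves them unchanged on integrable
    sections, hence almost everywhere. *)
Lemma Rintegral_fubini1 (h : T1 * T2 -> R) :
  (m1 \x m2)%E.-integrable setT (EFin \o h) ->
  \int[(m1 \x m2)%E]_z h z = \int[m1]_x \int[m2]_y h (x, y).
Proof.
move=> ih; rewrite /Rintegral -(integral12_prod_meas1 ih); congr fine.
have mh : measurable_fun setT h by apply/measurable_EFinP; exact: measurable_int ih.
apply: ae_eq_integral => //.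
- exact: (measurable_fubini_F ih).
- by apply/measurable_EFinP; exact: measurable_Rintegral1.
- apply: filterS (ae_integrable1 ih) => x ihx _.
  by rewrite fineK//; exact: integrable_fin_num ihx.
Qed.

Lemma Rintegral_fubini2 (h : T1 * T2 -> R) :
  (m1 \x m2)%E.-integrable setT (EFin \o h) ->
  \int[(m1 \x m2)%E]_z h z = \int[m2]_y \int[m1]_x h (x, y).
Proof.
move=> ih; rewrite /Rintegral -(integral21_prod_meas1 ih); congr fine.
have mh : measurable_fun setT h by apply/measurable_EFinP; exact: measurable_int ih.
apply: ae_eq_integral => //.
- exact: (measurable_fubini_G ih).
- by apply/measurable_EFinP; exact: measurable_Rintegral2.
- apply: filterS (ae_integrable2 ih) => x ihx _.
  by rewrite fineK//; exact: integrable_fin_num ihx.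
Qed.

Lemma cint_fubini1 f : cintble (m1 \x m2)%E f ->
  cint (m1 \x m2)%E f = cint m1 (fun x => cint m2 (fun y => f (x, y))).
Proof.
move=> fi; congr (_ +i* _)%C;
  [exact: (Rintegral_fubini1 (cintble_Re fi))|
   exact: (Rintegral_fubini1 (cintble_Im fi))].
Qed.

Lemma cint_fubini2 f : cintble (m1 \x m2)%E f ->
  cint (m1 \x m2)%E f = cint m2 (fun y => cint m1 (fun x => f (x, y))).
Proof.
move=> fi; congr (_ +i* _)%C;
  [exact: (Rintegral_fubini2 (cintble_Re fi))|
   exact: (Rintegral_fubini2 (cintble_Im fi))].
Qed.

Lemma ae_cintble1 f : cintble (m1 \x m2)%E f ->
  {ae m1, forall x, cintble m2 (fun y => f (x, y))}.
Proof.
move=> fi; apply: filterS (ae_integrable1 (cintble_norm fi)) => x ix.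
by apply: cintbleP => //; apply: cmeas_pair1; exact: fi.1.
Qed.

Lemma ae_cintble2 f : cintble (m1 \x m2)%E f ->
  {ae m2, forall y, cintble m1 (fun x => f (x, y))}.
Proof.
move=> fi; apply: filterS (ae_integrable2 (cintble_norm fi)) => x ix.
by apply: cintbleP => //; apply: cmeas_pair2; exact: fi.1.
Qed.

Lemma cintble_prod1 f : cmeas f ->
  (\int[m1]_x \int[m2]_y (normc (f (x, y)))%:E < +oo)%E ->
  cintble (m1 \x m2)%E f.
Proof.
move=> mf; rewrite -(fubini_tonelli1 (fun z => (normc (f z))%:E)) //.
- by apply/measurable_EFinP; exact: measurable_normc.
- by move=> z; rewrite lee_fin normc_ge0.
Qed.

Lemma cintble_prod2 f : cmeas f ->
  (\int[m2]_y \int[m1]_x (normc (f (x, y)))%:E < +oo)%E ->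
  cintble (m1 \x m2)%E f.
Proof.
move=> mf; rewrite -(fubini_tonelli2 (fun z => (normc (f z))%:E)) //.
- by apply/measurable_EFinP; exact: measurable_normc.
- by move=> z; rewrite lee_fin normc_ge0.
Qed.

Lemma integral_normc_cint1_le f : cintble (m1 \x m2)%E f ->
  (\int[m1]_x (normc (cint m2 (fun y => f (x, y))))%:E <=
   2%:E * \int[m1]_x \int[m2]_y (normc (f (x, y)))%:E)%E.
Proof.
move=> fi; have mF := cmeas_cint1 fi.1.
have n0 x : (0 <= \int[m2]_y (normc (f (x, y)))%:E)%E.
  by apply: integral_ge0 => y _; rewrite lee_fin normc_ge0.
have mn := measurable_integral_normc1 fi.1.
rewrite -ge0_integralZl//; apply: ae_ge0_le_integral => //.
- by move=> x _; rewrite lee_fin normc_ge0.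
- by apply/measurable_EFinP; exact: measurable_normc.
- by move=> x _; rewrite mule_ge0.
- exact: measurable_funeM.
- by apply: filterS (ae_cintble1 fi) => x fx _; exact: normc_cint_le.
Qed.

Lemma cintble_cint1 f : cintble (m1 \x m2)%E f ->
  cintble m1 (fun x => cint m2 (fun y => f (x, y))).
Proof.
move=> fi; split; first exact: cmeas_cint1 fi.1.
apply: le_lt_trans (integral_normc_cint1_le fi) _.
rewrite -(fubini_tonelli1 (fun z => (normc (f z))%:E))//; last 2 first.
  by apply/measurable_EFinP; exact: (measurable_normc fi.1).
  by move=> z; rewrite lee_fin normc_ge0.
by rewrite lte_mul_pinfty//; exact: fi.2.
Qed.

End complex_fubini.

(** * Cauchy transforms *)

Section schur.
Context d1 d2 (T1 : measurableType d1) (T2 : measurableType d2) (R : realType).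
Variable m1 : {sigma_finite_measure set T1 -> \bar R}.
Variable m2 : {sigma_finite_measure set T2 -> \bar R}.

(** One half of Schur's test, by Tonelli: a kernel whose mass in [x] is bounded uniformly in [y]
    maps L^1 to L^1. All double integrals below, with the Cauchy kernel, the mollifier or the
    regularized kernel, converge absolutely for this reason. *)
Lemma schur_le (g : T1 * T2 -> R[i]) (h : T2 -> R[i]) (C : R) : 0 <= C ->
  cmeas g -> cmeas h ->
  (forall y, (\int[m1]_x (normc (g (x, y)))%:E <= C%:E)%E) ->
  (\int[m2]_y \int[m1]_x (normc (g (x, y) * h y))%:E <=
   C%:E * \int[m2]_y (normc (h y))%:E)%E.
Proof.
move=> C0 mg mh gC.
have n0 y : (0 <= (normc (h y))%:E)%E by rewrite lee_fin normc_ge0.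
have mnh : measurable_fun setT (fun y => (normc (h y))%:E).
  by apply/measurable_EFinP; exact: measurable_normc.
rewrite -ge0_integralZl//; apply: ge0_le_integral => //.
- by move=> y _; apply: integral_ge0 => x _; rewrite lee_fin normc_ge0.
- have := @measurable_fun_fubini_tonelli_G _ _ _ _ _ m1
    (fun z => (normc (g z * h z.2))%:E).
  apply => [|z]; last by rewrite lee_fin normc_ge0.
  apply/measurable_EFinP/measurable_normc/cmeasM => //.
  by apply: (cmeas_comp _ mh); exact: measurable_snd.
- exact: measurable_funeM.
- move=> y _; rewrite -[leLHS]/(integral m1 setT _).
  under eq_integral do rewrite normcM mulrC EFinM.
  rewrite ge0_integralZl//; last 2 first.
  + by apply/measurable_EFinP/measurable_normc; exact: cmeas_pair2.
  + by move=> x _; rewrite lee_fin normc_ge0.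
  by rewrite muleC lee_wpmul2r// ?lee_fin ?normc_ge0.
Qed.

Lemma cintble_schur (g : T1 * T2 -> R[i]) (h : T2 -> R[i]) (C : R) : 0 <= C ->
  cmeas g -> cintble m2 h ->
  (forall y, (\int[m1]_x (normc (g (x, y)))%:E <= C%:E)%E) ->
  cintble (m1 \x m2)%E (fun z => g z * h z.2).
Proof.
move=> C0 mg hi gC; apply: cintble_prod2.
  by apply: cmeasM => //; apply: (cmeas_comp _ hi.1); exact: measurable_snd.
apply: le_lt_trans (schur_le C0 mg hi.1 gC) _.
by rewrite lte_mul_pinfty//; exact: hi.2.
Qed.

End schur.

(* [Z] plays the role of the complex coordinate of a plane [X]; the transform
   [C f z = \int f(a) / (Z z - Z a)] is the Cauchy transform up to a constant.
   At [Z z = Z a] the kernel is [0] by convention, which [diag0] makes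
   harmless. *)
Section cauchy_transform.
Context d (X : measurableType d) (R : realType).
Variable mu : {sigma_finite_measure set X -> \bar R}.
Variable Z : X -> R[i].
Hypothesis mZ : cmeas Z.
Hypothesis diag0 : forall z, {ae mu, forall a, Z a != Z z}.
(** The sets [S j] act as bounded sets: on each of them the kernel has finite mass, uniformly in its
    pole. *)
Variable S : nat -> set X.
Hypothesis mS : forall j, measurable (S j).
Hypothesis Scover : forall z, exists j, S j z.
Variable C : nat -> R.
Hypothesis C0 : forall j, 0 <= C j.
Hypothesis SC : forall j a,
  (\int[mu]_z (normc ((\1_(S j) z)%:C%C / (Z z - Z a)))%:E <= (C j)%:E)%E.
Implicit Types f g H W v : X -> R[i].

Definition cauchy f : X -> R[i] := fun z => cint mu (fun a => f a / (Z z - Z a)).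

Lemma cmeas_kernel : cmeas (fun z : X * X => (Z z.1 - Z z.2)^-1).
Proof.
apply: cmeasV; apply: cmeasB; apply: cmeas_comp => //.
Qed.

Lemma cmeas_cauchy_integrand f : cmeas f ->
  cmeas (fun z : X * X => f z.2 / (Z z.1 - Z z.2)).
Proof.
move=> mf; apply: cmeasM; last exact: cmeas_kernel.
by apply: cmeas_comp => //; exact: measurable_snd.
Qed.

Lemma cmeas_cauchy f : cmeas f -> cmeas (cauchy f).
Proof. by move=> mf; exact: (cmeas_cint1 _ (cmeas_cauchy_integrand mf)). Qed.

Lemma cmeas_indic (A : set X) : measurable A ->
  cmeas (fun z => ((\1_A z : R))%:C%C).
Proof. by move=> mA; apply: cmeas_real; exact: measurable_indic. Qed.

(* The kernel is locally integrable in [z], uniformly in its pole. *)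
Lemma ae_cintble_kernel d2 (Y : measurableType d2)
    (nu : {sigma_finite_measure set Y -> \bar R}) (pi : Y -> X) (H : Y -> R[i]) :
  measurable_fun setT pi -> cintble nu H ->
  {ae mu, forall z, cintble nu (fun y => H y / (Z z - Z (pi y)))}.
Proof.
move=> mpi Hi.
have mg j : cmeas (fun z : X * Y => (\1_(S j) z.1)%:C%C / (Z z.1 - Z (pi z.2))).
  apply: cmeasM.
    by apply: (cmeas_comp _ (cmeas_indic (mS j))); exact: measurable_fst.
  apply: cmeasV; apply: cmeasB; apply: (cmeas_comp _ mZ) => //.
  exact: (measurableT_comp mpi).
(* The indicator of [S j] makes the mass of the kernel in [z] finite, so Schur's test applies. A
   countable cover then yields the claim for almost every [z]. *)
have K j := cintble_schur (C0 j) (mg j) Hi (fun y => SC j (pi y)).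
have {}K : {ae mu, forall z j, cintble nu (fun y =>
    (\1_(S j) z)%:C%C / (Z z - Z (pi y)) * H y)}.
  by apply: ae_foralln => j; apply: (ae_cintble1 (K j)).
apply: filterS K => z K; have [j Sz] := Scover z.
have := K j; rewrite indicE mem_set//.
by under eq_fun do rewrite mul1r mulrC.
Qed.

Lemma ae_cintble_cauchy H : cintble mu H ->
  {ae mu, forall z, cintble mu (fun a => H a / (Z z - Z a))}.
Proof. exact: ae_cintble_kernel. Qed.

Section with_potential.
Variable W : X -> R[i].
Hypothesis mW : cmeas W.
Variable M : R.
Hypothesis M0 : 0 <= M.
Hypothesis WM : forall z, (\int[mu]_a (normc (W a / (Z z - Z a)))%:E <= M%:E)%E.

Lemma cintble_potential z : cintble mu (fun a => W a / (Z z - Z a)).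
Proof.
split; last exact: le_lt_trans (WM z) (ltry _).
exact: (@cmeas_pair1 _ _ _ _ _ (fun z : X * X => W z.2 / (Z z.1 - Z z.2)) z
  (cmeas_cauchy_integrand mW)).
Qed.

Lemma normc_cauchy_potential z : normc (cauchy W z) <= 2 * M.
Proof.
rewrite -lee_fin EFinM.
apply: le_trans (normc_cint_le (cintble_potential z)) _.
by rewrite lee_wpmul2l ?lee_fin.
Qed.

Let WM' y : (\int[mu]_x (normc (W x / (Z x - Z y)))%:E <= M%:E)%E.
Proof.
rewrite (eq_integral (fun a => (normc (W a / (Z y - Z a)))%:E)); first exact: WM.
by move=> x _; rewrite !normcM !normcV normcB.
Qed.

Let mWk : cmeas (fun z : X * X => W z.1 / (Z z.1 - Z z.2)).
Proof.
apply: cmeasM; last exact: cmeas_kernel.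
by apply: cmeas_comp => //; exact: measurable_fst.
Qed.

(** Integrating [b] gives [W a * cauchy H a]. The bound [M] on the mass in [a] makes the double
    integral converge absolutely for any integrable [H], even though [cauchy H] need not be
    bounded. *)
Let K0 H (a : X * X) := W a.1 / (Z a.1 - Z a.2) * H a.2.

Let K0i H : cintble mu H -> cintble (mu \x mu)%E (K0 H).
Proof. by move=> Hi; apply: (cintble_schur M0 mWk Hi); exact: WM'. Qed.

Let K0E H : cintble mu H -> {ae mu, forall a,
  cint mu (fun b => K0 H (a, b)) = W a * cauchy H a}.
Proof.
move=> Hi; apply: filterS (ae_cintble_cauchy Hi) => a Ha.
rewrite /cauchy -cint_scale//; congr cint; apply/funext => b.
by rewrite /K0/= mulrCA [_ * H b]mulrC mulrA mulrAC mulrC mulrA.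
Qed.

Lemma cintble_mul_cauchy H : cintble mu H -> cintble mu (fun a => W a * cauchy H a).
Proof.
move=> Hi; apply: (ae_eq_cintble _ (cintble_cint1 (K0i Hi))).
  by apply: cmeasM => //; exact: cmeas_cauchy Hi.1.
by apply: filterS (K0E Hi) => a ->.
Qed.

Lemma cintble_cauchy_mul H : cintble mu H -> cintble mu (fun a => cauchy W a * H a).
Proof.
move=> Hi; apply: (@cintbleMl _ _ _ _ _ (2 * M)) => //; first exact: cmeas_cauchy.
exact: normc_cauchy_potential.
Qed.

(* Partial fractions: 1/((z-a)(z-b)) = (1/(a-b)) (1/(z-a) - 1/(z-b)). *)
Lemma cauchy_mul H : cintble mu H -> {ae mu, forall z,
  cauchy W z * cauchy H z =
  cauchy (fun a => W a * cauchy H a + cauchy W a * H a) z}.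
Proof.
move=> Hi.
(* This is the use of a general [pi]: the integrand lives on pairs, and the pole is their first
   component. *)
have k1 := @ae_cintble_kernel _ (X * X)%type (sfprod mu mu) fst (K0 H)
  measurable_fst (K0i Hi).
have k2 := ae_cintble_cauchy Hi.
have k3 := ae_cintble_cauchy (cintble_mul_cauchy Hi).
have k4 := ae_cintble_cauchy (cintble_cauchy_mul Hi).
apply: filterS (filterI k1 (filterI k2 (filterI k3 k4))).
move=> z [K1i [Hz [WHz HWz]]].
(* [P] is the product of the two integrands and [K1 - K2] its partial fraction expansion, valid when
   [Z z], [Z a] and [Z b] are distinct. *)
pose P (ab : X * X) := W ab.1 / (Z z - Z ab.1) * (H ab.2 / (Z z - Z ab.2)).
pose K1 (ab : X * X) := K0 H ab / (Z z - Z ab.1).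
pose K2 (ab : X * X) := K0 H ab / (Z z - Z ab.2).
have {K1i}K1i : cintble (mu \x mu)%E K1 := K1i.
have K2i : cintble (mu \x mu)%E K2.
  have -> : K2 = fun ab => W ab.1 / (Z ab.1 - Z ab.2) * (H ab.2 / (Z z - Z ab.2)).
    by apply/funext => ab; rewrite /K2 /K0 mulrA.
  exact: (cintble_schur M0 mWk Hz WM').
have Pi : cintble (mu \x mu)%E P.
  have mWz : cmeas (fun ab : X * X => W ab.1 / (Z z - Z ab.1)).
    exact: (cmeas_comp (@measurable_fst _ _ X X) (cintble_potential z).1).
  exact: (cintble_schur M0 mWz Hz (fun=> WM z)).
have PE : cint (mu \x mu)%E P = cauchy W z * cauchy H z.
  rewrite cint_fubini1// mulrC /cauchy -cint_scale; last exact: cintble_potential.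
  congr cint; apply/funext => a; rewrite /P/= cint_scale// mulrC; congr (_ * _).
have K1E : cint (mu \x mu)%E K1 = cauchy (fun a => W a * cauchy H a) z.
  rewrite cint_fubini1//; apply: ae_eq_cint.
  - exact: (cmeas_cint1 _ K1i.1).
  - exact: WHz.1.
  - apply: filterS2 (K0E Hi) (ae_cintble1 (K0i Hi)) => a <- K0a.
    rewrite mulrC -cint_scale//; congr cint; apply/funext => b.
    by rewrite /K1 mulrC.
(* Here [a] is integrated before [b]; the inner integral of [W a / (Z a - Z b)] is minus the
   potential at [b]. *)
have K2E : cint (mu \x mu)%E K2 = - cauchy (fun a => cauchy W a * H a) z.
  rewrite cint_fubini2// -mulN1r /cauchy -cint_scale//; congr cint.
  apply/funext => b; transitivity
      (cint mu (fun a => - (H b / (Z z - Z b)) * (W a / (Z b - Z a)))).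
    congr cint; apply/funext => a; rewrite /K2 /K0/=.
    by rewrite -[Z b - Z a]opprB invrN; ring.
  rewrite cint_scale; last exact: cintble_potential.
  by ring.
rewrite -PE; transitivity (cint (mu \x mu)%E (fun ab => K1 ab - K2 ab)).
  have K12i := cintbleB K1i K2i.
  rewrite (cint_fubini1 Pi) (cint_fubini1 K12i); apply: ae_eq_cint.
  - exact: (cmeas_cint1 _ Pi.1).
  - exact: (cmeas_cint1 _ K12i.1).
  - apply: filterS (diag0 z) => a az; apply: ae_eq_cint.
    + exact: (cmeas_pair1 _ Pi.1).
    + exact: (cmeas_pair1 _ K12i.1).
    + apply: filterS2 (diag0 z) (diag0 a) => b bz ba.
      rewrite /P /K1 /K2 /K0/=; field.
      by rewrite !subr_eq0 ![_ == Z b]eq_sym bz ba eq_sym az.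
rewrite cint_sub// K1E K2E opprK /cauchy -cint_add//; congr cint.
by apply/funext => a; rewrite mulrDl.
Qed.

Section uniqueness.
Variable v : X -> R[i].
Hypothesis Wvi : cintble mu (fun a => W a * v a).
Hypothesis vE : {ae mu, forall z, v z = cauchy (fun a => W a * v a) z}.
Variable N : nat.

Let F := cauchy W.
Let e : R[i] := N.+1%:R^-1.
Let G z := 1 - e * F z.
Let H k a := W a * v a * (G a ^+ k - k%:R * e * G a ^+ k.-1).

Let mF : cmeas F. Proof. exact: cmeas_cauchy. Qed.

Let mG : cmeas G.
Proof.
by apply: cmeasB; [exact: cmeas_cst|apply: cmeasM => //; exact: cmeas_cst].
Qed.

Let normcG z : normc (G z) <= 1 + normc e * (2 * M).
Proof.
apply: le_trans (le_normcD _ _) _; rewrite normc1 normcN normcM lerD2l.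
by rewrite ler_wpM2l ?normc_ge0// normc_cauchy_potential.
Qed.

Let WvGi k : cintble mu (fun a => W a * v a * G a ^+ k).
Proof.
under eq_fun do rewrite mulrC.
apply: (@cintbleMl _ _ _ _ _ ((1 + normc e * (2 * M)) ^+ k)) => //.
  exact: cmeasX.
by move=> z; rewrite normcX lerXn2r// ?nnegrE ?normc_ge0// (le_trans _ (normcG z))// normc_ge0.
Qed.

Let Hi k : cintble mu (H k).
Proof.
have -> : H k = fun a => W a * v a * G a ^+ k -
    k%:R * e * (W a * v a * G a ^+ k.-1).
  by apply/funext => a; rewrite /H; ring.
by apply: cintbleB => //; exact: cintbleZ.
Qed.

(* Weakly, dbar (v G^k) = W v G^k - k e G^(k-1) W v. *)
Lemma cauchy_power k :
  {ae mu, forall z, v z * G z ^+ k = cauchy (H k) z}.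
Proof.
(* At [j = 0] the exponent [j.-1] is a default value, but the factor [j] kills the term. *)
have pred_pow a j : j%:R * e * G a ^+ j.-1 * G a = j%:R * e * G a ^+ j.
  by case: j => [|j]; rewrite ?mul0r// -mulrA -exprSr.
elim: k => [|k IH].
  apply: filterS vE => z ->; rewrite expr0 mulr1; congr cint.
  by apply/funext => a; rewrite /H expr0 !mul0r subr0 mulr1.
apply: filterS (filterI IH (filterI (cauchy_mul (Hi k)) (filterI
  (ae_cintble_cauchy (Hi k)) (filterI (ae_cintble_cauchy (cintble_mul_cauchy (Hi k)))
  (ae_cintble_cauchy (cintble_cauchy_mul (Hi k)))))))
  => z [IHz [prodz [Hz [WHz HWz]]]].
(* By induction [v G^(k+1) = cauchy (H k) - e * cauchy W * cauchy (H k)], and [cauchy_mul] makes the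
   last product a single transform. *)
rewrite exprSr mulrA IHz {1}/G mulrBr mulr1 mulrCA mulrA -/F mulrAC.
rewrite -mulrA [F z * _]prodz.
have sumi : cintble mu
    (fun a => (W a * cauchy (H k) a + F a * H k a) / (Z z - Z a)).
  under eq_fun do rewrite mulrDl.
  exact: cintbleD.
have esumi := cintbleZ e sumi.
transitivity (cint mu (fun a => H k a / (Z z - Z a) -
    e * ((W a * cauchy (H k) a + F a * H k a) / (Z z - Z a)))).
  by rewrite cint_sub// cint_scale.
apply: ae_eq_cint.
- exact: (cintbleB Hz esumi).1.
- exact: (@cmeas_pair1 _ _ _ _ _ (fun z : X * X => H k.+1 z.2 / (Z z.1 - Z z.2))
    z (cmeas_cauchy_integrand (Hi k.+1).1)).
(* The induction hypothesis is used again under the integral sign, to replace [cauchy (H k) a] by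
   [v a * G a ^+ k]. *)
- apply: filterS IH => a IHa; rewrite -IHa.
  transitivity ((H k a * G a - e * (W a * (v a * G a ^+ k))) / (Z z - Z a)).
    move: (G a ^+ k) (H k a) => g h.
    by have -> : G a = 1 - e * F a by []; ring.
  congr (_ / _); rewrite /H /= -mulrA mulrBl pred_pow exprSr -natr1.
  by ring.
Qed.

Hypothesis N_large1 : 4 * M <= N.+1%:R.
Hypothesis N_large2 : 8 * M ^+ 2 < N.+1%:R.

Let normce : normc e = N.+1%:R^-1.
Proof.
have -> : e = (N.+1%:R^-1 : R)%:C%C by rewrite /e fmorphV rmorph_nat.
by rewrite normc_real ger0_norm// invr_ge0.
Qed.

Let normcG_ge z : 2^-1 <= normc (G z).
Proof.
have : normc (1 : R[i]) <= normc (G z) + normc (e * F z).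
  by rewrite -{1}[1](subrK (e * F z)); exact: le_normcD.
rewrite normc1 normcM normce => h.
have h2 : N.+1%:R^-1 * normc (F z) <= 2^-1.
  rewrite ler_pdivrMl// (le_trans (normc_cauchy_potential z))//.
  by rewrite ler_pdivlMr// (le_trans _ N_large1)//; lra.
have := le_trans h (lerD (lexx _) h2).
by move: (normc (G z)) => g; lra.
Qed.

Let J : \bar R := (\int[mu]_a (normc (W a * v a * G a ^+ N.+1))%:E)%E.

(** The missing power of [G] is paid for by [1 <= 2 |G|], which together with [|F| <= 2 M] gives
    [|F| <= 4 M |G|]. *)
Let normc_top a : normc (H N.+1 a) <=
  N.+1%:R^-1 * (4 * M) * normc (W a * v a * G a ^+ N.+1).
Proof.
(* At the exponent [N.+1] the factor [k * e] equals 1, so [G^(N+1) - G^N = - e F G^N]: the terms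
   without the small factor [e] cancel. *)
have -> : H N.+1 a = W a * v a * G a ^+ N * (- (e * F a)).
  rewrite /H /= exprSr; have -> : N.+1%:R * e = 1 :> R[i] by rewrite mulfV ?pnatr_eq0.
  move: (G a ^+ N) => g.
  by have -> : G a = 1 - e * F a by []; ring.
rewrite exprSr (mulrA (W a * v a)) (normcM _ (- _))
  (normcM _ (G a)) normcN (normcM e) normce.
have hF := normc_cauchy_potential a; have hG := normcG_ge a.
have x0 := normc_ge0 (W a * v a * G a ^+ N).
move: (normc _) (normc (F a)) (normc (G a)) x0 hF hG => x f g x0 hF hG.
have -> : x * (N.+1%:R^-1 * f) = N.+1%:R^-1 * (x * f) by ring.
have -> : N.+1%:R^-1 * (4 * M) * (x * g) = N.+1%:R^-1 * (x * (4 * M * g)) by ring.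
rewrite ler_wpM2l ?invr_ge0// ler_wpM2l// (le_trans hF)//.
by have := ler_wpM2l (mulr_ge0 (ler0n R 4) M0) hG; lra.
Qed.

(** Two bounds close a loop. By [normc_top] the mass of [H N.+1] is at most [4 M J / (N+1)].
    Conversely [W v G^(N+1) = W * cauchy (H N.+1)], so Schur's test bounds [J] by [2 M] times that
    mass. As [J] is finite and [8 M^2 < N+1], it vanishes. *)
Let J0 : J = 0%E.
Proof.
have Jfin : J \is a fin_num.
  rewrite ge0_fin_numE; first exact: (WvGi N.+1).2.
  by apply: integral_ge0 => a _; rewrite lee_fin normc_ge0.
have Jge0 : (0 <= J)%E by apply: integral_ge0 => a _; rewrite lee_fin normc_ge0.
have HJ : (\int[mu]_a (normc (H N.+1 a))%:E <= (N.+1%:R^-1 * (4 * M))%:E * J)%E.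
  have c0 : 0 <= N.+1%:R^-1 * (4 * M) by rewrite mulr_ge0 ?invr_ge0// mulr_ge0.
  have mJ : measurable_fun setT (fun a => (normc (W a * v a * G a ^+ N.+1))%:E).
    by apply/measurable_EFinP; exact: (measurable_normc (WvGi N.+1).1).
  rewrite -ge0_integralZl//; last by move=> a _; rewrite lee_fin normc_ge0.
  apply: ge0_le_integral => //.
  - by move=> a _; rewrite lee_fin normc_ge0.
  - by apply/measurable_EFinP; exact: (measurable_normc (Hi N.+1).1).
  - exact: measurable_funeM.
  - by move=> a _; rewrite -EFinM lee_fin normc_top.
have JH : (J <= 2%:E * (M%:E * \int[mu]_a (normc (H N.+1 a))%:E))%E.
  have -> : J = (\int[mu]_a (normc (cint mu (fun b => K0 (H N.+1) (a, b))))%:E)%E.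
    apply: ae_eq_integral => //.
    - by apply/measurable_EFinP; exact: (measurable_normc (WvGi N.+1).1).
    - apply/measurable_EFinP/measurable_normc.
      exact: (cmeas_cint1 _ (K0i (Hi N.+1)).1).
    - apply: filterS2 (cauchy_power N.+1) (K0E (Hi N.+1)) => a aE -> _.
      by rewrite -aE mulrA.
  apply: le_trans (integral_normc_cint1_le (K0i (Hi N.+1))) _.
  rewrite lee_wpmul2l ?lee_fin//.
  have -> : (\int[mu]_x \int[mu]_y (normc (K0 (H N.+1) (x, y)))%:E =
      \int[mu]_y \int[mu]_x (normc (K0 (H N.+1) (x, y)))%:E)%E.
    apply: (fubini_tonelli (fun z => (normc (K0 (H N.+1) z))%:E)).
    - by apply/measurable_EFinP; exact: (measurable_normc (K0i (Hi N.+1)).1).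
    - by move=> z; rewrite lee_fin normc_ge0.
  exact: (@schur_le _ _ _ _ _ mu mu _ _ _ M0 mWk (Hi N.+1).1 WM').
have : (J <= (2 * (M * (N.+1%:R^-1 * (4 * M))))%:E * J)%E.
  apply: le_trans JH _; rewrite (EFinM 2) (EFinM M) -!muleA.
  by rewrite !lee_wpmul2l ?lee_fin.
move: Jfin Jge0 => /fineK <-; rewrite -EFinM !lee_fin => j0 jle.
congr EFin; apply/eqP; rewrite eq_le j0 andbT leNgt; apply/negP => jpos.
move: jle; apply/negP; rewrite -ltNge gtr_pMl//.
have -> : 2 * (M * (N.+1%:R^-1 * (4 * M))) = N.+1%:R^-1 * (8 * M ^+ 2) by ring.
by rewrite ltr_pdivrMl// mulr1.
Qed.

Lemma cauchy_fixpoint_large : {ae mu, forall z, v z = 0}.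
Proof.
have Wv0 : {ae mu, forall a, W a * v a = 0}.
  have mJ : measurable_fun setT (fun a => (normc (W a * v a * G a ^+ N.+1))%:E).
    by apply/measurable_EFinP; exact: (measurable_normc (WvGi N.+1).1).
  have [+ _] := ae_eq_integral_abs mu measurableT mJ.
  have -> : (\int[mu]_x `|(normc (W x * v x * G x ^+ N.+1))%:E| = J)%E.
    by apply: eq_integral => a _; rewrite gee0_abs// lee_fin normc_ge0.
  move=> /(_ J0); apply: filterS => a /(_ I) /= [] /eqP.
  rewrite normc0_eq0 mulf_eq0 expf_eq0 /= => /orP[/eqP//|/eqP Ga0].
  by have := normcG_ge a; rewrite Ga0 normc0 leNgt invr_gt0 ltr0n.
apply: filterS vE => z ->.
have -> : cauchy (fun a => W a * v a) z = cint mu (fun=> 0).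
  apply: ae_eq_cint; last by apply: filterS Wv0 => a ->; rewrite mul0r.
  - exact: (@cmeas_pair1 _ _ _ _ _ (fun z : X * X => W z.2 * v z.2 / (Z z.1 - Z z.2))
      z (cmeas_cauchy_integrand Wvi.1)).
  - exact: cmeas_cst.
by rewrite /cint /Rintegral /= integral0.
Qed.

End uniqueness.

Lemma cauchy_fixpoint v : cintble mu (fun a => W a * v a) ->
  {ae mu, forall z, v z = cauchy (fun a => W a * v a) z} ->
  {ae mu, forall z, v z = 0}.
Proof.
move=> Wvi vE.
pose N := Num.truncn (4 * M + 8 * M ^+ 2).
have hN : 4 * M + 8 * M ^+ 2 < N.+1%:R by exact: truncnS_gt.
have N1 : 4 * M <= N.+1%:R.
  by apply: le_trans (ltW hN); rewrite lerDl mulr_ge0// sqr_ge0.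
have N2 : 8 * M ^+ 2 < N.+1%:R.
  by apply: le_lt_trans hN; rewrite lerDr mulr_ge0.
exact: (cauchy_fixpoint_large Wvi vE N1 N2).
Qed.

End with_potential.
End cauchy_transform.

(** * Smooth terms *)

Section flat.
Context {R : realType}.
Implicit Types (P : {poly R}) (x t : R).

(* [flat 1] is the classical flat function exp(-1/x) on x > 0; the family is
   closed under differentiation. *)
Definition flat P x : R := if 0 < x then P.[x^-1] * expR (- x^-1) else 0.

(** The chain rule in [t = 1/x]: the derivative in [x] of [P(t) exp(-t)] is
    [(P - P')(t) t^2 exp(-t)]. *)
Definition flat_deriv P : {poly R} := (P - P^`()) * 'X^2.

Lemma flat_gt0 P x : 0 < x -> flat P x = P.[x^-1] * expR (- x^-1).
Proof. by rewrite /flat => ->. Qed.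

Lemma flat_le0 P x : x <= 0 -> flat P x = 0.
Proof. by rewrite /flat ltNge => ->. Qed.

(** Raise [s <= exp s] at [s = t / (k+1)] to the power [k]. Dividing by [k+1] rather than [k] covers
    [k = 0]. *)
Lemma exprn_expRN_bounded k : exists C : R, forall t, 0 <= t ->
  t ^+ k * expR (- t) <= C.
Proof.
exists (k.+1%:R ^+ k) => t t0.
rewrite expRN ler_pdivrMr ?expR_gt0//.
have -> : t ^+ k = k.+1%:R ^+ k * (t / k.+1%:R) ^+ k.
  by rewrite -exprMn mulrCA divff ?mulr1// pnatr_eq0.
rewrite ler_wpM2l ?exprn_ge0//.
have tk0 : 0 <= t / k.+1%:R by rewrite divr_ge0.
have le1 : t / k.+1%:R <= expR (t / k.+1%:R).
  by apply: le_trans (expR_ge1Dx _); rewrite lerDr.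
apply: (@le_trans _ _ (expR (t / k.+1%:R) ^+ k)).
  by rewrite lerXn2r// nnegrE ?expR_ge0.
rewrite -expRM_natl ler_expR mulrCA ler_piMr// ler_pdivrMr//.
by rewrite mul1r ler_nat.
Qed.

Lemma horner_expRN_bounded P : exists2 C : R, 0 <= C & forall t, 0 <= t ->
  `|P.[t] * expR (- t)| <= C.
Proof.
have [B BP] := @choice _ _ (fun k C => forall t : R, 0 <= t ->
  t ^+ k * expR (- t) <= C) exprn_expRN_bounded.
exists (\sum_(i < size P) `|P`_i| * B i).
  apply: sumr_ge0 => i _; rewrite mulr_ge0//.
  by apply: le_trans (BP i 0 (lexx _)); rewrite mulr_ge0 ?expR_ge0// exprn_ge0.
move=> t t0; rewrite horner_coef mulr_suml; apply: le_trans (ler_norm_sum _ _ _) _.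
apply: ler_sum => i _; rewrite -mulrA normrM ler_wpM2l//.
by rewrite ger0_norm ?BP// mulr_ge0 ?expR_ge0// exprn_ge0.
Qed.

Lemma flat_bounded P : exists2 C : R, 0 <= C & forall x, `|flat P x| <= C.
Proof.
have [C C0 HC] := horner_expRN_bounded P; exists C => // x.
have [x0|x0] := ltP 0 x; last by rewrite flat_le0// normr0.
by rewrite flat_gt0// HC// invr_ge0 ltW.
Qed.

(** Trades a factor [x] for a degree of the polynomial. Used twice it gives
    [flat P x = x^2 * flat (P * X^2) x], hence flatness at 0. *)
Lemma flatMX P x : flat (P * 'X) x * x = flat P x.
Proof.
have [x0|x0] := ltP 0 x; last by rewrite !flat_le0// mul0r.
by rewrite !flat_gt0// hornerMX mulrAC -(mulrA _ x^-1) mulVf ?mulr1// gt_eqF.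
Qed.

Lemma is_derive_flat P x : is_derive x 1 (flat P) (flat (flat_deriv P) x).
Proof.
have [x0|x0|->] := ltgtP x 0.
- rewrite flat_le0; last exact: ltW.
  have := is_derive_cst (0 : R) x (1 : R); apply: near_eq_is_derive.
  near=> y; rewrite flat_le0//; apply: ltW; near: y; exact: lt_nbhsl.
- rewrite flat_gt0//.
  have dV : is_derive x (1 : R) (fun y : R => y^-1) (- x ^- 2).
    have := @is_deriveV _ id x (1 : R) (1 : R) (lt0r_neq0 x0) (is_derive_id _ _).
    by rewrite /GRing.scale /= mulr1.
  have dP := @is_derive1_comp _ (horner P) _ x _ _ (is_derive_poly P _) dV.
  have dE := @is_derive1_comp _ expR _ x _ _ (is_derive_expR _) (is_deriveN dV).
  have dPE : is_derive x (1 : R) (fun y => P.[y^-1] * expR (- y^-1))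
      ((flat_deriv P).[x^-1] * expR (- x^-1)).
    apply: (is_derive_eq (is_deriveM dP dE)).
    rewrite -[LHS]/(P.[x^-1] * (expR (- x^-1) * - - x ^- 2) +
      expR (- x^-1) * (P^`().[x^-1] * - x ^- 2)).
    rewrite /flat_deriv hornerM hornerD hornerN hornerXn -!exprVn.
    by move: (x^-1 ^+ 2) (expR _) P.[_] P^`().[_] => a b c d; ring.
  move: dPE; apply: near_eq_is_derive.
  near=> y; rewrite flat_gt0//; near: y; exact: lt_nbhsr.
- rewrite flat_le0//.
  (* The difference quotient at 0 is [h * flat (P * X^2) h], hence at most [C |h|]. *)
  have [C C0 HC] := flat_bounded (P * 'X * 'X).
  have C1 : 0 < C + 1 by rewrite ltr_wpDl.
  have c0 : h^-1 *: ((flat P \o shift 0) (h *: (1 : R)) - flat P 0) @[h --> 0^']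
      --> (0 : R).
    rewrite flat_le0//; apply/cvgr0Pnorm_lt => e e0.
    near=> h; have h0 : h != 0 by near: h; exact: nbhs_dnbhs_neq.
    rewrite /= addr0 subr0 /GRing.scale /= mulr1 -flatMX mulrCA mulVf// mulr1.
    rewrite -flatMX normrM; apply: (@le_lt_trans _ _ (C * `|h|)).
      by rewrite ler_wpM2r.
    apply: (@le_lt_trans _ _ ((C + 1) * `|h|)); first by rewrite ler_wpM2r// lerDl.
    rewrite -ltr_pdivlMl//; near: h; apply: dnbhs0_lt.
    by rewrite mulr_gt0// invr_gt0.
  split; first by apply/cvg_ex; exists 0.
  exact: cvg_lim c0.
Unshelve. all: by end_near. Qed.

Lemma continuous_flat P : continuous (flat P).
Proof.
move=> x; apply: differentiable_continuous; apply/derivable1_diffP.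
by have [] := is_derive_flat P x.
Qed.

End flat.

Section smooth_expressions.
Context {R : realType} {n : nat}.
Implicit Types (z : Cn R n) (a b : 'I_n + 'I_n).

Definition coordinate a z : R :=
  match a with inl j => z.1 ord0 j | inr j => z.2 ord0 j end.

(* Terms for the smooth functions used as building blocks of test functions,
   with a formal derivative that stays within the syntax. *)
Inductive expr :=
| Cst of R
| Coord of 'I_n + 'I_n
| Add of expr & expr
| Mul of expr & expr
| Inv of expr
| Flat of {poly R} & expr.

Fixpoint ev (e : expr) z : R :=
  match e with
  | Cst c => c
  | Coord a => coordinate a z
  | Add e1 e2 => ev e1 z + ev e2 z
  | Mul e1 e2 => ev e1 z * ev e2 z
  | Inv e => (ev e z)^-1
  | Flat P e => flat P (ev e z)
  end.

Fixpoint wf (e : expr) : Prop :=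
  match e with
  | Cst _ | Coord _ => True
  | Add e1 e2 | Mul e1 e2 => wf e1 /\ wf e2
  | Inv e => wf e /\ forall z, ev e z != 0
  | Flat _ e => wf e
  end.

Fixpoint der a (e : expr) : expr :=
  match e with
  | Cst _ => Cst 0
  | Coord b => Cst (a == b)%:R
  | Add e1 e2 => Add (der a e1) (der a e2)
  | Mul e1 e2 => Add (Mul e1 (der a e2)) (Mul e2 (der a e1))
  | Inv e => Mul (Cst (-1)) (Mul (Mul (Inv e) (Inv e)) (der a e))
  | Flat P e => Mul (Flat (flat_deriv P) e) (der a e)
  end.

Lemma wf_der a e : wf e -> wf (der a e).
Proof. elim: e => //= [e1 H1 e2 H2|e1 H1 e2 H2|e H|P e H].
- by case; auto.
- by case; auto.
- by case=> w ne; do !split => //; exact: H.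
- by move=> w; split => //; exact: H. Qed.

(** Restricting to the line through [z] brings coordinates, inverses and compositions with [flat]
    under the one-variable rules of differentiation. *)
Lemma is_derive_line (f : Cn R n -> R) z v (l : R) :
  is_derive (0 : R) (1 : R) (fun t => f (t *: v + z)) l -> is_derive z v f l.
Proof.
have E : (fun h : R => h^-1 *: (((fun t => f (t *: v + z)) \o shift 0) (h *: (1 : R))
      - f (0 *: v + z))) =
    (fun h : R => h^-1 *: ((f \o shift z) (h *: v) - f z)).
  apply/funext => h /=; congr (_ *: (f _ - f _)).
  - by rewrite addr0 /GRing.scale /= mulr1.
  - by rewrite scale0r add0r.
by move=> [d1 d2]; split; [move: d1|move: d2];
  rewrite /derivable /derive E.
Qed.

Lemma is_derive_lineV (f : Cn R n -> R) z v (l : R) :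
  is_derive z v f l -> is_derive (0 : R) (1 : R) (fun t => f (t *: v + z)) l.
Proof.
have E : (fun h : R => h^-1 *: (((fun t => f (t *: v + z)) \o shift 0) (h *: (1 : R))
      - f (0 *: v + z))) =
    (fun h : R => h^-1 *: ((f \o shift z) (h *: v) - f z)).
  apply/funext => h /=; congr (_ *: (f _ - f _)).
  - by rewrite addr0 /GRing.scale /= mulr1.
  - by rewrite scale0r add0r.
by move=> [d1 d2]; split; [move: d1|move: d2];
  rewrite /derivable /derive E.
Qed.

Lemma coordinate_line a b t z :
  coordinate b (t *: direction a + z) = coordinate b z + t * (a == b)%:R.
Proof.
case: a b => [i|i] [j|j] /=; rewrite !mxE /= ?mulr0 ?add0r ?addr0//.
- by rewrite addrC eq_sym.
- by rewrite addrC eq_sym.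
Qed.

Lemma is_derive_ev a e z : wf e ->
  is_derive z (direction a : Cn R n) (ev e) (ev (der a e) z).
Proof.
elim: e => [c|b|e1 H1 e2 H2|e1 H1 e2 H2|e H|P e H] /=.
- by move=> _; exact: is_derive_cst.
- move=> _; apply: is_derive_line; under eq_fun do rewrite coordinate_line.
  have h1 := is_deriveM (is_derive_id (0 : R) (1 : R))
    (is_derive_cst ((a == b)%:R : R) (0 : R) (1 : R)).
  have := is_deriveD (is_derive_cst (coordinate b z) (0 : R) (1 : R)) h1.
  move=> h; apply: (is_derive_eq h).
  by rewrite /GRing.scale /= mul0r !add0r mulr1.
- by move=> [w1 w2]; apply: is_deriveD; auto.
- by move=> [w1 w2]; apply: is_deriveM; auto.
- move=> [w ne]; apply: is_derive_line.
  have h := is_derive_lineV (H w).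
  have ne0 : (fun t : R => ev e (t *: direction a + z)) 0 != 0 by exact: ne.
  apply: (is_derive_eq (is_deriveV ne0 h)).
  by rewrite scale0r add0r -exprVn expr2 mulN1r; exact: mulNr.
- move=> w; apply: is_derive_line.
  have h := is_derive_lineV (H w).
  have := @is_derive1_comp _ (flat P) _ _ _ _ (is_derive_flat P _) h.
  by rewrite scale0r add0r.
Qed.

Lemma continuous_coordinate a : continuous (coordinate a).
Proof.
case: a => i z /=.
  apply: (@continuous_comp _ _ _ fst (fun x : 'rV[R]_n => x ord0 i)).
    exact: cvg_fst.
  exact: coord_continuous.
apply: (@continuous_comp _ _ _ snd (fun x : 'rV[R]_n => x ord0 i)).
  exact: cvg_snd.
exact: coord_continuous.
Qed.

Lemma continuous_ev e : wf e -> continuous (ev e).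
Proof.
elim: e => [c|b|e1 H1 e2 H2|e1 H1 e2 H2|e H|P e H] /= w z.
- exact: cvg_cst.
- exact: continuous_coordinate.
- by apply: cvgD; [apply: H1; case: w|apply: H2; case: w].
- by apply: cvgM; [apply: H1; case: w|apply: H2; case: w].
- by apply: cvgV; [case: w|apply: H; case: w].
- by apply: continuous_comp; [exact: H|exact: continuous_flat].
Qed.

Lemma partial_ev a e : wf e -> partial a (ev e) = ev (der a e).
Proof.
by move=> w; apply/funext => z; rewrite /partial; have [] := is_derive_ev a z w.
Qed.

(** Iterated partial derivatives of a well-formed term are again evaluations of well-formed terms,
    so all orders reduce to order zero and one. *)
Lemma smooth_ev e : wf e -> smooth (ev e).
Proof.
move=> we s; have [we' ->] : wf (foldr der e s) /\
    foldr partial (ev e) s = ev (foldr der e s).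
  elim: s => //= a s [ws ->]; split; first exact: wf_der.
  exact: partial_ev.
split; first exact: continuous_ev.
by move=> a z; have [] := is_derive_ev a z we'.
Qed.

End smooth_expressions.

(** * Boxes and slices *)

Section density_measure.
Context d (T : measurableType d) (R : realType) (mu : {measure set T -> \bar R}).
Variable f : T -> \bar R.
Hypothesis mf : measurable_fun setT f.
Hypothesis f0 : forall x, (0 <= f x)%E.

(** The proofs are arguments so that the measure structure attached to [density] can recover
    them. *)
Definition density (_ : measurable_fun setT f) (_ : forall x, (0 <= f x)%E)
  (A : set T) : \bar R := (\int[mu]_(x in A) f x)%E.

Let density0 : density mf f0 set0 = 0%E.
Proof. exact: integral_set0. Qed.

Let density_ge0 A : (0 <= density mf f0 A)%E.
Proof. exact: integral_ge0. Qed.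

Let density_sigma_additive : semi_sigma_additive (density mf f0).
Proof. exact: semi_sigma_additive_nng_induced. Qed.

HB.instance Definition _ := isMeasure.Build _ _ _ (density mf f0)
  density0 density_ge0 density_sigma_additive.

End density_measure.

Section boxes.
Context {R : realType} {n : nat}.
Implicit Types (a b : 'I_n + 'I_n -> R).

Definition box a b : set (Cn R n) :=
  [set z | forall i, a i < coordinate i z < b i].

Definition cube (k : R) : set (Cn R n) := box (fun=> - k) (fun=> k).

Definition boxes : set (set (Cn R n)) := [set B | exists a b, B = box a b].

Lemma box_setI a b a' b' : box a b `&` box a' b' =
  box (fun i => Num.max (a i) (a' i)) (fun i => Num.min (b i) (b' i)).
Proof.
apply/seteqP; split => z /=.
  by move=> [h h'] i; move: (h i) (h' i); rewrite gt_max lt_min => /andP[-> ->] /andP[-> ->].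
move=> h; split=> i; move: (h i); rewrite gt_max lt_min.
  by move=> /andP[/andP[-> _] /andP[-> _]].
by move=> /andP[/andP[_ ->] /andP[_ ->]].
Qed.

Lemma setI_closed_boxes : setI_closed boxes.
Proof. by move=> _ _ [a [b ->]] [a' [b' ->]]; rewrite box_setI; do 2 eexists. Qed.

Lemma box_setX a b : box a b =
  [set v : 'rV[R]_n | forall i, v ord0 i \in `]a (inl i), b (inl i)[] `*`
  [set v : 'rV[R]_n | forall i, v ord0 i \in `]a (inr i), b (inr i)[].
Proof.
apply/seteqP; split => z /=.
  by move=> h; split => i; rewrite in_itv /=; [exact: h (inl i)|exact: h (inr i)].
by move=> [h1 h2] [i|i] /=; [move: (h1 i)|move: (h2 i)]; rewrite in_itv.
Qed.

Lemma measurable_coordinate i : measurable_fun setT (@coordinate R n i).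
Proof.
have mr := proj1 (measurable_fun_rVP _) (@measurable_id _ 'rV[R]_n setT).
by case: i => i /=; [exact: (measurableT_comp (mr i) measurable_fst)|
  exact: (measurableT_comp (mr i) measurable_snd)].
Qed.

Lemma measurable_box a b : measurable (box a b).
Proof.
have -> : box a b = \bigcap_(i in [set: 'I_n + 'I_n])
    (coordinate i @^-1` `]a i, b i[%classic).
  apply/seteqP; split => z /= h i; first by move=> _; rewrite /= in_itv; exact: h.
  by have := h i I; rewrite /= in_itv.
apply: fin_bigcap_measurable => // i _; rewrite -[X in measurable X]setTI.
exact: measurable_coordinate.
Qed.

Lemma in_cube (z : Cn R n) : exists k : nat, cube k%:R z.
Proof.
pose s : R := \sum_i `|coordinate i z|.
exists (Num.truncn s).+1 => i; rewrite -ltr_norml.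
apply: le_lt_trans (truncnS_gt s).
by rewrite /s (bigD1 i)//= lerDl sumr_ge0.
Qed.

Lemma bigcup_cube : \bigcup_(k : nat) cube k%:R = setT.
Proof. by apply/seteqP; split => // z _; have [k] := in_cube z; exists k. Qed.

(** The substantial inclusion says that the identity is measurable out of the sigma-algebra
    generated by boxes. This is checked on coordinates, where a half-space is a countable union of
    boxes. *)
Lemma measurable_boxes : @measurable _ (Cn R n) = <<s boxes >>.
Proof.
apply/seteqP; split; last first.
  apply: smallest_sub; first exact: sigma_algebra_measurable.
  by move=> _ [a [b ->]]; exact: measurable_box.
pose Y := g_sigma_algebraType boxes.
have mc i : measurable_fun [set: Y] (fun z : Y => coordinate i (z : Cn R n)).
  apply: (measurability _ (RGenOInfty.measurableE R)) => _ [_ [x ->] <-].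
  rewrite setTI; have -> : (fun z : Y => coordinate i (z : Cn R n)) @^-1` `]x, +oo[ =
      \bigcup_(k : nat) box (fun j => if j == i then x else - k%:R) (fun=> k%:R).
    apply/seteqP; split => z /=.
      rewrite in_itv andbT => xz; have [k kz] := in_cube z; exists k => // j.
      case: eqP => [->|_]; last exact: kz.
      by apply/andP; split; [exact: xz|case/andP: (kz i)].
    by move=> [k _ /(_ i)]; rewrite eqxx in_itv andbT => /andP[].
  apply: bigcup_measurable => k _; apply: sub_sigma_algebra.
  by do 2 eexists.
have mid : measurable_fun [set: Y] (fun z : Y => ((z : Cn R n).1, (z : Cn R n).2)).
  apply: measurable_fun_pair; apply/measurable_fun_rVP => i.
    exact: (mc (inl i)).
  exact: (mc (inr i)).
move=> A mA; have := mid measurableT A mA; rewrite setTI.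
by congr (<<s boxes >> _); apply/seteqP; split => -[x y].
Qed.

Lemma box_measure_unique (m1 m2 : {measure set (Cn R n) -> \bar R}) :
  (forall a b, m1 (box a b) = m2 (box a b)) ->
  (forall k : nat, (m1 (cube k%:R) < +oo)%E) ->
  forall A, measurable A -> m1 A = m2 A.
Proof.
move=> m12 m1oo A mA.
apply: (measure_unique boxes (fun k : nat => cube k%:R)) => //.
- exact: measurable_boxes.
- exact: setI_closed_boxes.
- by move=> k; do 2 eexists.
- exact: bigcup_cube.
- by move=> _ [a [b ->]].
Qed.

Lemma lebesgue_box a b : lebesgue_Cn R n (box a b) =
  ((\prod_(i < n) lebesgue_measure `]a (inl i), b (inl i)[%classic) *
   (\prod_(i < n) lebesgue_measure `]a (inr i), b (inr i)[%classic))%E.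
Proof.
have mI (c d : 'I_n -> R) : measurable
    [set v : 'rV[R]_n | forall i, v ord0 i \in `]c i, d i[].
  have -> : [set v : 'rV[R]_n | forall i, v ord0 i \in `]c i, d i[] =
      \bigcap_(i in [set: 'I_n]) ((fun v : 'rV[R]_n => v ord0 i) @^-1` `]c i, d i[%classic).
    by apply/seteqP; split => z /= h i => [_|]; apply: h.
  apply: fin_bigcap_measurable => // i _; rewrite -[X in measurable X]setTI.
  exact: (proj1 (measurable_fun_rVP _) (@measurable_id _ _ _) i).
rewrite box_setX -[LHS]/((lebesgue_rV n \x lebesgue_rV n)%E _).
rewrite product_measure1E//.
congr (_ * _)%E.
- by rewrite -(@lebesgue_rV_box _ _ (fun i => `]a (inl i), b (inl i)[%classic)).
- by rewrite -(@lebesgue_rV_box _ _ (fun i => `]a (inr i), b (inr i)[%classic)).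
Qed.

Lemma lebesgue_box_lty a b : (lebesgue_Cn R n (box a b) < +oo)%E.
Proof.
have h (c d : 'I_n -> R) :
    (\prod_(i < n) lebesgue_measure `]c i, d i[%classic)%E \is a fin_num.
  apply: (big_ind (fun x : \bar R => x \is a fin_num)) => //.
    by move=> *; exact: fin_numM.
  move=> i _; rewrite lebesgue_measure_itv/=.
  by case: ifP => // _; rewrite fin_numB.
rewrite lebesgue_box; have := fin_numM (h (a \o inl) (b \o inl)) (h (a \o inr) (b \o inr)).
by move=> /fin_numPlt /andP[].
Qed.

(** The positive and negative parts of [g] are densities of two measures that are finite and agree
    on boxes. Boxes are stable under intersection and generate, so the measures coincide and [g]
    integrates to 0 over every measurable set. *)
Lemma ae_eq0_of_boxes (g : Cn R n -> R) :
  (lebesgue_Cn R n).-integrable setT (EFin \o g) ->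
  (forall a b, (\int[lebesgue_Cn R n]_(z in box a b) (g z)%:E = 0)%E) ->
  {ae lebesgue_Cn R n, forall z, g z = 0}.
Proof.
set mu := lebesgue_Cn R n => ig g0.
have mg : measurable_fun setT (EFin \o g) by exact: measurable_int ig.
have ip := integrable_funepos measurableT ig.
have iN := integrable_funeneg measurableT ig.
have mp := measurable_funepos mg; have mn := measurable_funeneg mg.
pose m1 : {measure set _ -> \bar R} := density mu mp (funepos_ge0 _).
pose m2 : {measure set _ -> \bar R} := density mu mn (funeneg_ge0 _).
have finp A : measurable A -> (\int[mu]_(x in A) (EFin \o g)^\+ x)%E \is a fin_num.
  by move=> mA; apply: integrable_fin_num => //; exact: integrableS ip.
have finn A : measurable A -> (\int[mu]_(x in A) (EFin \o g)^\- x)%E \is a fin_num.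
  by move=> mA; apply: integrable_fin_num => //; exact: integrableS iN.
have m12 a b : m1 (box a b) = m2 (box a b).
  have := g0 a b; rewrite integralE.
  rewrite -(fineK (finp _ (measurable_box a b))) -(fineK (finn _ (measurable_box a b))).
  move=> -[] /eqP; rewrite subr_eq0 => /eqP fE.
  rewrite -[LHS]/(\int[mu]_(x in box a b) (EFin \o g)^\+ x)%E.
  rewrite -[RHS]/(\int[mu]_(x in box a b) (EFin \o g)^\- x)%E.
  rewrite -(fineK (finp _ (measurable_box a b))) fE.
  by rewrite (fineK (finn _ (measurable_box a b))).
have uniq A : measurable A -> m1 A = m2 A.
  apply: box_measure_unique => // k.
  by have := finp _ (measurable_box (fun=> - k%:R) (fun=> k%:R)) => /fin_numPlt /andP[].
have : ae_eq mu setT (EFin \o g) (cst 0%E).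
  apply: integral_ae_eq => // E _ mE; rewrite integral0 integralE.
  rewrite -[X in (X - _)%E]/(m1 E) uniq// subee//.
  exact: finn.
by apply: filterS => z /(_ I) /= [].
Qed.

(** [D] is only integrable on bounded sets, so the real case is applied to its real and imaginary
    parts cut off by each cube; a box cut by a cube is again a box. *)
Lemma ae_ceq0_of_boxes (D : Cn R n -> R[i]) : cmeas D ->
  (forall a b, cintble (lebesgue_Cn R n) (fun z => (\1_(box a b) z)%:C%C * D z)) ->
  (forall a b, cint (lebesgue_Cn R n) (fun z => (\1_(box a b) z)%:C%C * D z) = 0) ->
  {ae lebesgue_Cn R n, forall z, D z = 0}.
Proof.
set mu := lebesgue_Cn R n => mD Di D0.
have key (P : R[i] -> R) : (P = @complex.Re R \/ P = @complex.Im R) ->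
    {ae mu, forall z (k : nat), (\1_(cube k%:R) z : R) * P (D z) = 0}.
  move=> PE; apply: ae_foralln => k; apply: ae_eq0_of_boxes.
    have := Di (fun=> - k%:R) (fun=> k%:R) => Dk.
    case: PE => ->; [have := cintble_Re Dk|have := cintble_Im Dk];
    rewrite -/(cube k%:R); congr (integrable _ _ _); apply/funext => z;
    by rewrite ?cReM ?cImM /= mul0r ?subr0 ?addr0.
  move=> a b; rewrite integral_mkcond.
  have E : (fun z => (\1_(cube k%:R) z * P (D z))%:E) \_ (box a b) =
     (fun z => (P ((\1_(box a b `&` cube k%:R) z)%:C%C * D z))%:E).
    apply/funext => z; rewrite patchE indicI.
    have -> : P ((\1_(box a b) z * \1_(cube k%:R) z)%:C%C * D z) =
        (\1_(box a b) z * \1_(cube k%:R) z) * P (D z).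
      by case: PE => ->; rewrite ?cReM ?cImM /= mul0r ?subr0 ?addr0.
    by rewrite /= (indicE _ (box a b)); case: ifP => _; rewrite ?mul1r// !mul0r.
  rewrite E box_setI; move: (Di (fun i => Num.max (a i) (- k%:R))
    (fun i => Num.min (b i) k%:R)) (D0 (fun i => Num.max (a i) (- k%:R))
    (fun i => Num.min (b i) k%:R)); set f := (fun z => _ * D z) => fi.
  rewrite /cint /Rintegral => -[f1 f2].
  have h1 := integrable_fin_num measurableT (cintble_Re fi).
  have h2 := integrable_fin_num measurableT (cintble_Im fi).
  by case: PE => ->; [rewrite -(fineK h1) f1|rewrite -(fineK h2) f2].
apply: filterS2 (key _ (or_introl erefl)) (key _ (or_intror erefl)).
move=> z hr hi; have [k kz] := in_cube z.
move: (hr k) (hi k); rewrite indicE mem_set// !mul1r.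
by case: (D z) => x y /= -> ->.
Qed.

End boxes.

(* [lebesgue_measure] lives on [measurableTypeR R], whose measurable structure
   differs from that of [R] in its display only. *)
Notation plane R := (measurableTypeR R * measurableTypeR R)%type.

Section slices.
Context {R : realType}.

Definition plane_measure : {sigma_finite_measure set (plane R) -> \bar R} :=
  sfprod (@lebesgue_measure R) (@lebesgue_measure R).

Definition Cn_measure (m : nat) : {sigma_finite_measure set (Cn R m) -> \bar R} :=
  sfprod (lebesgue_rV m) (lebesgue_rV m).

Definition slice_measure (m : nat) :
    {sigma_finite_measure set (plane R * Cn R m)%type -> \bar R} :=
  sfprod plane_measure (Cn_measure m).

Definition slice m (p : plane R * Cn R m) : Cn R m.+1 :=
  (cons_rV (p.1.1, p.2.1), cons_rV (p.1.2, p.2.2)).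

Definition unslice m (z : Cn R m.+1) : plane R * Cn R m :=
  (((uncons_rV z.1).1, (uncons_rV z.2).1), ((uncons_rV z.1).2, (uncons_rV z.2).2)).

Lemma sliceK m : cancel (@slice m) (@unslice m).
Proof. case=> [[x y] [x' y']]; have E1 := @cons_rVK R m (x : R, x').
have E2 := @cons_rVK R m (y : R, y').
exact: (f_equal2 (fun p q => ((p.1, q.1), (p.2, q.2))) E1 E2). Qed.

Lemma unsliceK m : cancel (@unslice m) (@slice m).
Proof.
case=> x y; rewrite /unslice /slice /=; congr pair;
by rewrite -[RHS]uncons_rVK; congr cons_rV; case: (uncons_rV _).
Qed.

Lemma measurable_slice m : measurable_fun setT (@slice m).
Proof.
apply: measurable_fun_pair; apply: (measurableT_comp (@measurable_cons_rV _ _));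
  apply: measurable_fun_pair.
- exact: (measurableT_comp measurable_fst measurable_fst).
- exact: (measurableT_comp measurable_fst measurable_snd).
- exact: (measurableT_comp measurable_snd measurable_fst).
- exact: (measurableT_comp measurable_snd measurable_snd).
Qed.

Lemma measurable_unslice m : measurable_fun setT (@unslice m).
Proof.
have m1 := measurableT_comp (@measurable_uncons_rV R m) (@measurable_fst _ _ 'rV[R]_m.+1 'rV[R]_m.+1).
have m2 := measurableT_comp (@measurable_uncons_rV R m) (@measurable_snd _ _ 'rV[R]_m.+1 'rV[R]_m.+1).
apply: measurable_fun_pair; apply: measurable_fun_pair.
- exact: (measurableT_comp measurable_fst m1).
- exact: (measurableT_comp measurable_fst m2).
- exact: (measurableT_comp measurable_snd m1).
- exact: (measurableT_comp measurable_snd m2).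
Qed.

HB.instance Definition _ m := isMeasurableFun.Build _ _ _ _ (@slice m)
  (@measurable_slice m).

Definition lift_index m (i : 'I_m + 'I_m) : 'I_m.+1 + 'I_m.+1 :=
  match i with inl j => inl (lift ord0 j) | inr j => inr (lift ord0 j) end.

Lemma coordinate_slice0l m (p : plane R * Cn R m) :
  coordinate (inl ord0) (slice p) = p.1.1.
Proof. by rewrite /= cons_rV0. Qed.

Lemma coordinate_slice0r m (p : plane R * Cn R m) :
  coordinate (inr ord0) (slice p) = p.1.2.
Proof. by rewrite /= cons_rV0. Qed.

Lemma coordinate_sliceS m (p : plane R * Cn R m) i :
  coordinate (lift_index i) (slice p) = coordinate i p.2.
Proof. by case: i => i /=; rewrite cons_rVS. Qed.

Lemma preimage_slice_box m a b : @slice m @^-1` (box a b) =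
  (`]a (inl ord0), b (inl ord0)[ `*` `]a (inr ord0), b (inr ord0)[) `*`
  box (a \o @lift_index m) (b \o @lift_index m).
Proof.
apply/seteqP; split => p /=.
  move=> h; split; first split; rewrite ?in_itv /=.
  - by have := h (inl ord0); rewrite coordinate_slice0l.
  - by have := h (inr ord0); rewrite coordinate_slice0r.
  - by move=> i; have := h (lift_index i); rewrite coordinate_sliceS.
move=> [[]]; rewrite !in_itv /= => h1 h2 h [i|i].
  have [j ->|->] := unliftP ord0 i; last by rewrite coordinate_slice0l.
  by have := h (inl j); rewrite -(coordinate_sliceS _ (inl j)).
have [j ->|->] := unliftP ord0 i; last by rewrite coordinate_slice0r.
by have := h (inr j); rewrite -(coordinate_sliceS _ (inr j)).
Qed.

(** On a box both sides are the product of the side lengths, taken in different orders, and boxes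
    determine the measure. *)
Lemma lebesgue_slice m (A : set (Cn R m.+1)) : measurable A ->
  lebesgue_Cn R m.+1 A = pushforward (slice_measure m) (@slice m) A.
Proof.
apply: box_measure_unique => [a b|k]; last exact: lebesgue_box_lty.
rewrite lebesgue_box -[RHS]/(slice_measure m (@slice m @^-1` box a b)).
rewrite preimage_slice_box.
rewrite -[RHS]/((plane_measure \x Cn_measure m)%E _) product_measure1E; last 2 first.
- by apply: measurableX; exact: measurable_itv.
- exact: measurable_box.
rewrite -[X in (_ = X * _)%E]/((lebesgue_measure \x lebesgue_measure)%E _).
rewrite product_measure1E; [|exact: measurable_itv..].
rewrite -[X in (_ = _ * X)%E]/(lebesgue_Cn R m _) lebesgue_box !big_ord_recl /=.
by rewrite muleACA.
Qed.

Lemma ae_slice m (P : Cn R m.+1 -> Prop) :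
  {ae slice_measure m, forall p, P (slice p)} <-> {ae lebesgue_Cn R m.+1, forall z, P z}.
Proof.
split=> -[N [mN N0 PN]].
- exists (@unslice m @^-1` N); split.
  + by rewrite -[X in measurable X]setTI; exact: measurable_unslice.
  + rewrite [LHS]lebesgue_slice; last first.
      by rewrite -[X in measurable X]setTI; exact: measurable_unslice.
    rewrite /pushforward -comp_preimage (_ : _ \o _ = id) ?preimage_id//.
    by apply/funext; exact: sliceK.
  + by move=> z /= nP; apply: PN => /=; rewrite unsliceK.
- exists (@slice m @^-1` N); split.
  + by rewrite -[X in measurable X]setTI; exact: measurable_slice.
  + by rewrite -N0 [RHS]lebesgue_slice.
  + by move=> p /= nP; exact: PN.
Qed.

Lemma ge0_integral_slice m (f : Cn R m.+1 -> \bar R) : measurable_fun setT f ->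
  (forall z, 0 <= f z)%E ->
  (\int[lebesgue_Cn R m.+1]_z f z = \int[slice_measure m]_p f (slice p))%E.
Proof.
move=> mf f0.
rewrite (eq_measure_integral (pushforward (slice_measure m) (@slice m))); last first.
  by move=> A mA _; exact: lebesgue_slice.
by rewrite ge0_integral_pushforward//= preimage_setT.
Qed.

Lemma cmeas_slice m (f : Cn R m.+1 -> R[i]) : cmeas f <-> cmeas (f \o @slice m).
Proof.
split=> mf; first by apply: cmeas_comp => //; exact: measurable_slice.
have -> : f = (fun z => (f \o @slice m) (unslice z)).
  by apply/funext => z /=; rewrite unsliceK.
by apply: (cmeas_comp _ mf); exact: measurable_unslice.
Qed.

Lemma cintble_slice m (f : Cn R m.+1 -> R[i]) :
  cintble (lebesgue_Cn R m.+1) f <-> cintble (slice_measure m) (f \o @slice m).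
Proof.
have E : cmeas f -> (\int[lebesgue_Cn R m.+1]_z (normc (f z))%:E =
    \int[slice_measure m]_p (normc (f (slice p)))%:E)%E.
  move=> mf; apply: (@ge0_integral_slice _ (fun z => (normc (f z))%:E)).
    by apply/measurable_EFinP; exact: measurable_normc.
  by move=> z; rewrite lee_fin normc_ge0.
split=> -[mf fi].
  by split; [exact/cmeas_slice|rewrite /= -E].
by have mf' := (cmeas_slice f).2 mf; split => //; rewrite E.
Qed.

Lemma cint_slice m (f : Cn R m.+1 -> R[i]) : cintble (lebesgue_Cn R m.+1) f ->
  cint (lebesgue_Cn R m.+1) f = cint (slice_measure m) (f \o @slice m).
Proof.
move=> fi.
have E (h : Cn R m.+1 -> R) : (lebesgue_Cn R m.+1).-integrable setT (EFin \o h) ->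
    \int[lebesgue_Cn R m.+1]_z h z = \int[slice_measure m]_p h (slice p).
  move=> ih; have mh := measurable_int _ ih.
  rewrite /Rintegral; congr fine; rewrite integralE [RHS]integralE; congr (_ - _)%E.
    rewrite (ge0_integral_slice (measurable_funepos mh)) => [|z]; last exact: funepos_ge0.
    by apply: eq_integral => p _; rewrite !funeposE.
  rewrite (ge0_integral_slice (measurable_funeneg mh)) => [|z]; last exact: funeneg_ge0.
  by apply: eq_integral => p _; rewrite !funenegE.
by congr (_ +i* _)%C; [exact: (E _ (cintble_Re fi))|exact: (E _ (cintble_Im fi))].
Qed.

End slices.

(** * The Cauchy kernel on the plane *)

Section affine_change_of_variables.
Context {R : realType}.
Notation mu := (@lebesgue_measure R).

Definition affine (s c : R) (x : measurableTypeR R) : measurableTypeR R := c + s * x.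

Lemma measurable_affine s c : measurable_fun setT (affine s c).
Proof.
have : measurable_fun [set: R] (fun x : R => c + s * x).
  by apply: measurable_funD => //; exact: measurable_funM.
exact.
Qed.

Lemma lebesgue_affine (s c : R) (A : set (measurableTypeR R)) : 0 < s -> measurable A ->
  mu A = (s%:E * mu (affine s c @^-1` A))%E.
Proof.
move=> s0 mA.
pose m : {measure set _ -> \bar R} := mscale (NngNum (ltW s0)) (pushforward mu (affine s c)).
apply: (@lebesgue_measure_unique _ (m (measurable_affine s c))) => // _ [[a b] _ <-].
rewrite -[RHS]/(s%:E * mu (affine s c @^-1` `]a, b]%classic))%E.
have -> : affine s c @^-1` `]a, b]%classic = `]((a - c) / s), ((b - c) / s)]%classic.
  apply/seteqP; split => x /=; rewrite !in_itv /= /affine ltr_pdivrMr// ler_pdivlMr//;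
  by rewrite ltrBlDl lerBrDl mulrC.
rewrite !lebesgue_measure_itv /= !lte_fin ltr_pM2r ?invr_gt0// ltrD2r.
case: ifP => _; last by rewrite mule0.
by rewrite -!EFinB -EFinM; congr EFin; field; rewrite gt_eqF.
Qed.

Lemma ge0_integral_affine (s c : R) (f : measurableTypeR R -> \bar R) : 0 < s ->
  measurable_fun setT f -> (forall x, 0 <= f x)%E ->
  (\int[mu]_x f x = s%:E * \int[mu]_x f (c + s * x)%R)%E.
Proof.
move=> s0 mf f0.
rewrite (eq_measure_integral (mscale (NngNum (ltW s0)) (pushforward mu (affine s c)))).
- exact: measurable_affine.
- by move=> maff; rewrite ge0_integral_mscale//= ge0_integral_pushforward//=.
- by move=> maff A mA _; exact: lebesgue_affine.
Qed.

Lemma ge0_integral_opp (f : measurableTypeR R -> \bar R) :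
  measurable_fun setT f -> (forall x, 0 <= f x)%E ->
  (\int[mu]_x f x = \int[mu]_x f (- x)%R)%E.
Proof.
move=> mf f0.
rewrite (eq_measure_integral (pushforward mu (-%R : _ -> measurableTypeR R))).
  by rewrite ge0_integral_pushforward//= preimage_setT.
by move=> A mA _; apply/esym; exact: lebesgue_measureN.
Qed.

End affine_change_of_variables.

Section power_integrals.
Context {R : realType}.
Notation mu := (@lebesgue_measure R).
Variable s : R.
Hypothesis s0 : 0 < s.
Hypothesis s1 : s < 1.

Lemma integral_powRN_itv (a r : R) : 0 < a -> a < r ->
  (\int[mu]_(x in `[a, r]) (x `^ (- s))%:E <= (r `^ (1 - s) / (1 - s))%:E)%E.
Proof.
move=> a0 ar.
have s1' : 0 < 1 - s by rewrite subr_gt0.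
pose F (x : R) := (1 - s)^-1 * x `^ (1 - s).
have dF (x : R) : 0 < x -> is_derive x (1 : R) F (x `^ (- s)).
  move=> x0; have d := is_derive1_powR (1 - s) x0.
  apply: (is_derive_eq (is_deriveZ (1 - s)^-1 d)).
  rewrite /GRing.scale /= mulrA mulVf ?gt_eqF// mul1r.
  by congr (_ `^ _); rewrite addrAC subrr add0r.
have cF (x : R) : 0 < x -> {for x, continuous F}.
  move=> x0; apply: differentiable_continuous; apply/derivable1_diffP.
  by have [] := dF _ x0.
have dps (x : R) : 0 < x -> is_derive x (1 : R) (fun x => x `^ (- s)) (- s * x `^ (- s - 1)).
  by move=> x0; exact: is_derive1_powR.
rewrite (@continuous_FTC2 _ _ F)//.
- rewrite -EFinB lee_fin /F mulrC lerBlDr lerDl mulr_ge0 ?powR_ge0//.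
  by rewrite invr_ge0 ltW.
- apply: continuous_in_subspaceT => x; rewrite inE /= in_itv /= => /andP[ax _].
  apply: differentiable_continuous; apply/derivable1_diffP.
  by have [] := dps x (lt_le_trans a0 ax).
- split.
  + move=> x; rewrite in_itv /= => /andP[ax _].
    by have [] := dF x (lt_trans a0 ax).
  + by apply: cvg_at_right_filter; exact: cF.
  + by apply: cvg_at_left_filter; apply: cF; exact: lt_trans ar.
- move=> x; rewrite in_itv /= => /andP[ax _].
  by rewrite derive1E; have [_] := dF x (lt_trans a0 ax).
Qed.

Lemma integral_powRN_oc (r : R) : 0 < r ->
  (\int[mu]_(x in `]0%R, r]) (x `^ (- s))%:E <= (r `^ (1 - s) / (1 - s))%:E)%E.
Proof.
move=> r0.
have mp : measurable_fun [set: R] (fun x : R => (x `^ (- s))%:E).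
  by apply/measurable_EFinP; exact: measurable_powR.
(* The index [k.+2] keeps the left end strictly between 0 and [r], as the fundamental theorem of
   calculus requires. *)
pose D (k : nat) : set (measurableTypeR R) := `[r / k.+2%:R, r]%classic.
have DU : `]0, r]%classic = \bigcup_k D k.
  apply/seteqP; split => x /=; rewrite /D.
    rewrite in_itv /= => /andP[x0 xr].
    exists (Num.truncn (r / x)) => //=; rewrite in_itv /= xr andbT.
    rewrite ler_pdivrMr// mulrC -ler_pdivrMr//.
    by rewrite (le_trans (ltW (truncnS_gt _)))// ler_nat.
  by move=> [k _] /=; rewrite !in_itv /= => /andP[+ ->]; rewrite andbT;
    apply: lt_le_trans; rewrite divr_gt0.
have ndD : nondecreasing_seq D.
  move=> i j ij; apply/subsetPset => x; rewrite /D /= !in_itv /= => /andP[+ ->].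
  rewrite andbT; apply: le_trans; rewrite ler_pM2l// lef_pV2 ?posrE//.
  by rewrite ler_nat.
have cv := @ge0_nondecreasing_set_cvg_integral _ _ _ D
  (fun x => (x `^ (- s))%:E) mu ndD.
have {}cv : (\int[mu]_(x in D k) (x `^ (- s))%:E)%E @[k --> \oo] -->
    (\int[mu]_(x in `]0%R, r]) (x `^ (- s))%:E)%E.
  rewrite DU; apply: cv => //.
  - by move=> k; exact: measurable_itv.
  - by move=> k; exact: measurable_funTS.
  - by move=> k x _; rewrite lee_fin powR_ge0.
rewrite -(cvg_lim _ cv)//; apply: lime_le; first by apply/cvg_ex; eexists; exact: cv.
apply: nearW => k; apply: integral_powRN_itv; first by rewrite divr_gt0.
by rewrite ltr_pdivrMr// ltr_pMr// ltr1n.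
Qed.

(* [`|x| `^ (- s)] takes the junk value [0] at [x = 0]. *)
Definition pole (r x : R) : R := \1_(`[- r, r]%classic) x * `|x| `^ (- s).

(** The value of the integral of [|x|^(-s)] over [[-r, r]]. *)
Definition pole_mass (r : R) : R := 2 * (r `^ (1 - s) / (1 - s)).

Lemma pole_ge0 r x : 0 <= pole r x.
Proof. by rewrite mulr_ge0 ?powR_ge0. Qed.

Lemma measurable_pole r : measurable_fun setT (pole r : measurableTypeR R -> R).
Proof.
have : measurable_fun [set: R] (pole r).
  apply: measurable_funM; first by apply: measurable_indic; exact: measurable_itv.
  by apply: (measurableT_comp (measurable_powR _)).
exact.
Qed.

Lemma integral_pole r : 0 < r -> (\int[mu]_x (pole r x)%:E <= (pole_mass r)%:E)%E.
Proof.
move=> r0.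
pose g (x : measurableTypeR R) : R := \1_(`]0, r]%classic) x * x `^ (- s).
have g0 x : 0 <= g x by rewrite mulr_ge0 ?powR_ge0.
have mg : measurable_fun setT g.
  have : measurable_fun [set: R] (g : R -> R).
    apply: measurable_funM; first by apply: measurable_indic; exact: measurable_itv.
    exact: measurable_powR.
  exact.
have mgE : measurable_fun setT (EFin \o g) by exact/measurable_EFinP.
have mN : measurable_fun setT (fun x : measurableTypeR R => (g (- x))%:E).
  apply: (measurableT_comp mgE).
  have : measurable_fun [set: R] (fun x : R => - x) by exact: measurable_funN.
  exact.
have gI : (\int[mu]_x (g x)%:E <= (r `^ (1 - s) / (1 - s))%:E)%E.
  apply: le_trans (integral_powRN_oc r0); rewrite [leRHS]integral_mkcond.
  rewrite le_eqVlt; apply/orP; left; apply/eqP; apply: eq_integral => x _.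
  rewrite patchE /g indicE; case: ifP => _ /=; by rewrite ?mul1r ?mul0r.
apply: (@le_trans _ _ (\int[mu]_x ((g x)%:E + (g (- x))%:E))%E).
  apply: ge0_le_integral => //.
  - by move=> x _; rewrite lee_fin pole_ge0.
  - by apply/measurable_EFinP; exact: measurable_pole.
  - exact: emeasurable_funD.
  - move=> x _; rewrite -EFinD lee_fin.
    have [x0|x0|x0] := ltgtP x (0 : R).
    + apply: le_trans (_ : g (- x) <= _); last by rewrite lerDr.
      rewrite /pole /g !indicE !mem_setE !in_itv /= ltr0_norm// oppr_gt0 x0 /=.
      rewrite lerNl ler_wpM2r ?powR_ge0// ler_nat.
      by case: (- x <= r); rewrite ?leq_b1.
    + apply: le_trans (_ : g x <= _); last by rewrite lerDl.
      rewrite /pole /g !indicE !mem_setE !in_itv /= gtr0_norm// x0 /=.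
      by rewrite (le_trans _ (ltW x0)) ?oppr_le0 ?(ltW r0).
    + rewrite /pole x0 normr0 powR0 ?oppr_eq0 ?gt_eqF// mulr0.
      by rewrite addr_ge0.
rewrite ge0_integralD//; last 2 first.
- by move=> x _; rewrite lee_fin.
- by move=> x _; rewrite lee_fin.
rewrite -(ge0_integral_opp mgE); last by move=> x; rewrite lee_fin.
rewrite /pole_mass mulr2n mulrDl mul1r EFinD.
exact: leeD.
Qed.

Lemma integral_pole_center r c : 0 < r ->
  (\int[mu]_x (pole r ((x : R) - c))%:E <= (pole_mass r)%:E)%E.
Proof.
move=> r0; apply: le_trans (integral_pole r0).
have m1 : measurable_fun [set: R] (fun x : R => pole r (x - c)).
  apply: (measurableT_comp (measurable_pole r)).
  exact: measurable_funB.
have mE : measurable_fun [set: measurableTypeR R] (fun x : measurableTypeR R => (pole r ((x : R) - c))%:E).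
  by apply/measurable_EFinP; exact: m1.
rewrite (ge0_integral_affine c ltr01 mE); last by move=> x; rewrite lee_fin pole_ge0.
by rewrite mul1e; under eq_integral do rewrite mul1r addrAC subrr add0r.
Qed.

(** From [|x| |y| <= x^2 + y^2]. The planar singularity [|w|^(-2s)] is split into two
    one-dimensional ones, locally integrable under the same condition [s < 1], and Tonelli replaces
    polar coordinates. *)
Lemma kernel_le_pole (x y : R) : x != 0 -> y != 0 ->
  normc (x +i* y)%C^-1 `^ (2 * s) <= `|x| `^ (- s) * `|y| `^ (- s).
Proof.
move=> x0 y0.
have xy0 : 0 < `|x| * `|y| by rewrite mulr_gt0// normr_gt0.
have h : `|x| * `|y| <= x ^+ 2 + y ^+ 2.
  rewrite -(real_normK (num_real x)) -(real_normK (num_real y)).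
  have : 0 <= (`|x| - `|y|) ^+ 2 by exact: sqr_ge0.
  by move: (normr_ge0 x) (normr_ge0 y); nra.
have xy1 := lt_le_trans xy0 h.
rewrite -powRM ?normr_ge0// normcV.
have -> : normc (x +i* y)%C = (x ^+ 2 + y ^+ 2) `^ 2^-1.
  by rewrite powR12_sqrt// ltW.
rewrite -powRN -powRrM.
have -> : - 2^-1 * (2 * s) = - s by field.
rewrite !powRN lef_pV2 ?posrE ?powR_gt0//.
by apply: ge0_ler_powR; rewrite ?nnegrE ?(ltW xy0) ?(ltW xy1) ?(ltW s0).
Qed.

End power_integrals.

Section plane_kernel.
Context {R : realType}.
Notation mu := (@plane_measure R).
Notation leb := (@lebesgue_measure R).
Implicit Types z c : plane R.

Definition complex_of (z : plane R) : R[i] := ((z.1 : R) +i* (z.2 : R))%C.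

Lemma cmeas_complex_of : cmeas complex_of.
Proof. by split; [exact: measurable_fst|exact: measurable_snd]. Qed.

Definition square c (r : R) : set (plane R) :=
  `[(c.1 : R) - r, (c.1 : R) + r]%classic `*` `[(c.2 : R) - r, (c.2 : R) + r]%classic.

Lemma measurable_square c r : measurable (square c r).
Proof. by apply: measurableX; exact: measurable_itv. Qed.

(** Discards at once the default value of [pole] at 0, the diagonal of the kernel and the edges of
    rectangles. *)
Lemma plane_measure_lines c :
  {ae mu, forall z, (z.1 : R) != c.1 /\ (z.2 : R) != c.2}.
Proof.
have m1 : measurable ([set c.1] : set (measurableTypeR R)) by exact: measurable_set1.
have m2 : measurable ([set c.2] : set (measurableTypeR R)) by exact: measurable_set1.
exists (([set c.1] `*` setT) `|` (setT `*` [set c.2])); split.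
- by apply: measurableU; apply: measurableX.
- apply: null_set_setU; try exact: measurableX.
  + have l1 : leb [set c.1] = 0%E by exact: lebesgue_measure_set1.
    transitivity (leb [set c.1] * leb setT)%E; last by rewrite l1 mul0e.
    exact: product_measure1E.
  + have l2 : leb [set c.2] = 0%E by exact: lebesgue_measure_set1.
    transitivity (leb setT * leb [set c.2])%E; last by rewrite l2 mule0.
    exact: product_measure1E.
- move=> z /= /not_andP[] /negP; rewrite negbK => /eqP ->; [by left|by right].
Qed.

Lemma complex_of_diag0 c : {ae mu, forall z, complex_of z != complex_of c}.
Proof.
apply: filterS (plane_measure_lines c) => z [z1 _].
by rewrite /complex_of eq_complex negb_and /= z1.
Qed.

Lemma complex_ofB z c : complex_of z - complex_of c =
  (((z.1 : R) - (c.1 : R))%R +i* ((z.2 : R) - (c.2 : R))%R)%C.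
Proof. by []. Qed.

Lemma integral_kernel_square (s : R) c r : 0 < s -> s < 1 -> 0 < r ->
  (\int[mu]_z (\1_(square c r) z *
     normc (complex_of z - complex_of c)^-1 `^ (2 * s))%:E <=
   (pole_mass s r ^+ 2)%:E)%E.
Proof.
move=> s0 s1 r0.
pose p1 (x : measurableTypeR R) := (pole s r ((x : R) - (c.1 : R)))%:E.
pose p2 (x : measurableTypeR R) := (pole s r ((x : R) - (c.2 : R)))%:E.
have mp (a : R) : measurable_fun setT (fun x : measurableTypeR R => (pole s r ((x : R) - a))%:E).
  apply/measurable_EFinP.
  have : measurable_fun [set: R] (fun x : R => pole s r (x - a)).
    by apply: (measurableT_comp (measurable_pole s r)); exact: measurable_funB.
  exact.
have m12 : measurable_fun setT (fun z : plane R => (p1 z.1 * p2 z.2)%E).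
  apply: emeasurable_funM.
    exact: (measurableT_comp (mp c.1) measurable_fst).
  exact: (measurableT_comp (mp c.2) measurable_snd).
have p10 x : (0 <= p1 x)%E by rewrite lee_fin pole_ge0.
have p20 x : (0 <= p2 x)%E by rewrite lee_fin pole_ge0.
apply: (@le_trans _ _ (\int[mu]_z (p1 z.1 * p2 z.2))%E).
  apply: ae_ge0_le_integral => //.
  - by move=> z _; rewrite lee_fin mulr_ge0 ?powR_ge0.
  - apply/measurable_EFinP; apply: measurable_funM.
      by apply: measurable_indic; exact: measurable_square.
    apply: (measurableT_comp (measurable_powR _)); apply: measurable_normc.
    apply: cmeasV; apply: cmeasB; [exact: cmeas_complex_of|exact: cmeas_cst].
  - by move=> z _; exact: mule_ge0.
  - apply: filterS (plane_measure_lines c) => z [z1 z2] _.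
    rewrite /p1 /p2 -EFinM lee_fin complex_ofB /pole.
    have -> : \1_(square c r) z = \1_(`[- r, r]%classic) ((z.1 : R) - (c.1 : R)) *
        \1_(`[- r, r]%classic) ((z.2 : R) - (c.2 : R)) :> R.
      rewrite /square !indicE !mem_setE /= in_setX !mem_setE !in_itv /=.
      by rewrite -natrM mulnb !lerBrDl !lerBlDl.
    rewrite mulrACA ler_wpM2l ?mulr_ge0// kernel_le_pole// subr_eq0//.
rewrite [leLHS](fubini_tonelli1 (fun z : plane R => (p1 z.1 * p2 z.2)%E))//; last first.
  by move=> z; exact: mule_ge0.
rewrite /fubini_F /=.
have E x : (\int[leb]_y (p1 x * p2 y) = p1 x * \int[leb]_y p2 y)%E.
  by apply: ge0_integralZl => //; exact: mp.
under eq_integral do rewrite E.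
rewrite ge0_integralZr//; last 2 first.
- exact: mp.
- by apply: integral_ge0.
rewrite expr2 EFinM; apply: lee_pmul; try exact: integral_ge0.
- exact: integral_pole_center.
- exact: integral_pole_center.
Qed.

End plane_kernel.

Section plane_uniqueness.
Context {R : realType}.
Notation mu := (@plane_measure R).
Notation Z := (@complex_of R).
Implicit Types (z a : plane R) (W v : plane R -> R[i]).

Lemma notin_square_kernel z a : ~ square z 1 a -> normc (Z a - Z z)^-1 <= 1.
Proof.
move=> nsq; rewrite normcV invf_le1; last first.
  rewrite lt_neqAle normc_ge0 andbT eq_sym normc0_eq0 subr_eq0.
  apply/eqP => -[e1 e2]; apply: nsq; rewrite /square /= !in_itv /= e1 e2.
  by rewrite !lerDl !gerDl oppr_le0 ler01.
rewrite leNgt; apply/negP => lt1; apply: nsq.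
have h1 := le_lt_trans (le_normRe (Z a - Z z)) lt1.
have h2 := le_lt_trans (le_normIm (Z a - Z z)) lt1.
move: h1 h2; rewrite complex_ofB /= => h1 h2.
rewrite /square /= !in_itv /=; split.
  by move: (ltW h1); rewrite ler_distl => /andP[-> ->].
by move: (ltW h2); rewrite ler_distl => /andP[-> ->].
Qed.

Lemma square_fin_num z (r : R) : mu (square z r) \is a fin_num.
Proof.
have hI (a b : R) : (@lebesgue_measure R `[a, b]%classic) \is a fin_num.
  by rewrite lebesgue_measure_itv /=; case: ifP => // _; rewrite -EFinB.
rewrite -[X in X \is a _]/((lebesgue_measure \x lebesgue_measure)%E _).
rewrite product_measure1E; [|exact: measurable_itv..].
exact: fin_numM (hI _ _) (hI _ _).
Qed.

Definition kernel_mass (s : R) : R := pole_mass s 1 ^+ 2.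

Lemma kernel_mass_ge0 s : 0 <= kernel_mass s.
Proof. exact: sqr_ge0. Qed.

Lemma cmeas_kernel_at a : cmeas (fun z => (Z z - Z a)^-1).
Proof.
by apply: cmeasV; apply: cmeasB; [exact: cmeas_complex_of|exact: cmeas_cst].
Qed.

Lemma measurable_kernel_near (s : R) a : measurable_fun setT
  (fun z => (\1_(square a 1) z * normc (Z z - Z a)^-1 `^ (2 * s))%:E).
Proof.
apply/measurable_EFinP; apply: measurable_funM.
  by apply: measurable_indic; exact: measurable_square.
apply: (measurableT_comp (measurable_powR _)); apply: measurable_normc.
exact: cmeas_kernel_at.
Qed.

(** On the unit square about the pole the kernel is controlled by the case [s = 1/2] of the power
    bound; off that square it is at most 1. *)
Lemma integral_kernel_le (A : set (plane R)) a : measurable A ->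
  (\int[mu]_z (normc ((\1_A z)%:C%C / (Z z - Z a)))%:E <=
   (kernel_mass 2^-1)%:E + mu A)%E.
Proof.
move=> mA.
pose f z := (\1_(square a 1) z * normc (Z z - Z a)^-1 `^ (2 * 2^-1))%:E.
have f0 z : (0 <= f z)%E by rewrite lee_fin mulr_ge0 ?powR_ge0.
have mf : measurable_fun setT f := measurable_kernel_near 2^-1 a.
have mi : measurable_fun setT (fun z => (\1_A z : R)%:E).
  by apply/measurable_EFinP; exact: measurable_indic.
apply: (@le_trans _ _ (\int[mu]_z (f z + (\1_A z : R)%:E))%E).
  apply: ge0_le_integral => //.
  - by move=> z _; rewrite lee_fin normc_ge0.
  - apply/measurable_EFinP; apply: measurable_normc; apply: cmeasM.
      by apply: cmeas_real; exact: measurable_indic.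
    exact: cmeas_kernel_at.
  - exact: emeasurable_funD.
  - move=> z _; rewrite /f -EFinD lee_fin normcM normc_real ger0_norm//.
    rewrite divff ?pnatr_eq0// powRr1 ?normc_ge0//.
    have [zs|zs] := pselect (square a 1 z).
      rewrite [X in _ <= X * _ + _]indicE mem_set// mul1r.
      have : \1_A z <= 1 :> R by rewrite indicE lern1 leq_b1.
      have : 0 <= \1_A z :> R by [].
      by move: (normc_ge0 (Z z - Z a)^-1); nra.
    rewrite [X in _ <= X * _ + _]indicE memNset// mul0r add0r.
    by rewrite ler_piMr// notin_square_kernel.
rewrite ge0_integralD//.
apply: leeD; last by rewrite integral_indic// setIT.
by apply: integral_kernel_square => //; lra.
Qed.

(** Near the pole this is Young's inequality with the exponents [r] and [r / (r - 1) = 2 s]; the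
    kernel to the power [2 s] is integrable there because [s < 1], which amounts to [2 < r]. Away
    from the pole the kernel is at most 1 and the mass of [W] remains. *)
Lemma integral_potential_le (r : R) W z : 2 < r -> cmeas W ->
  (\int[mu]_a (normc (W a / (Z z - Z a)))%:E <=
   \int[mu]_a (normc (W a) `^ r)%:E + (kernel_mass (r / (2 * (r - 1))))%:E +
   \int[mu]_a (normc (W a))%:E)%E.
Proof.
move=> r2 mW; set s := r / _.
have r1 : 0 < r - 1 by lra.
have s0 : 0 < s by rewrite divr_gt0//; lra.
have s1 : s < 1 by rewrite ltr_pdivrMr; lra.
have conj : r^-1 + (2 * s)^-1 = 1.
  by rewrite /s; field; apply/andP; split; rewrite gt_eqF//; lra.
pose f1 a := (normc (W a) `^ r)%:E.
pose f2 a := (\1_(square z 1) a * normc (Z a - Z z)^-1 `^ (2 * s))%:E.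
pose f3 a := (normc (W a))%:E.
have mN := measurable_normc mW.
have m1 : measurable_fun setT f1.
  by apply/measurable_EFinP; apply: (measurableT_comp (measurable_powR _)).
have m2 : measurable_fun setT f2 := measurable_kernel_near s z.
have m3 : measurable_fun setT f3 by exact/measurable_EFinP.
have f10 a : (0 <= f1 a)%E by rewrite lee_fin powR_ge0.
have f20 a : (0 <= f2 a)%E by rewrite lee_fin mulr_ge0 ?powR_ge0.
have f30 a : (0 <= f3 a)%E by rewrite lee_fin normc_ge0.
have m12 : measurable_fun setT (fun a => f1 a + f2 a)%E by exact: emeasurable_funD.
have f120 a : (0 <= f1 a + f2 a)%E by exact: adde_ge0.
apply: (@le_trans _ _ (\int[mu]_a (f1 a + f2 a + f3 a))%E).
  apply: ge0_le_integral => //.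
  - by move=> a _; rewrite lee_fin normc_ge0.
  - apply/measurable_EFinP; apply: measurable_normc; apply: cmeasM => //.
    apply: cmeasV; apply: cmeasB; [exact: cmeas_cst|exact: cmeas_complex_of].
  - exact: emeasurable_funD.
  - move=> a _; rewrite /f1 /f2 /f3 -!EFinD lee_fin normcM normcV normcB -normcV.
    set k := normc (Z a - Z z)^-1; set w := normc (W a).
    have k0 : 0 <= k := normc_ge0 _.
    have w0 : 0 <= w := normc_ge0 _.
    have [zs|zs] := pselect (square z 1 a).
      rewrite indicE mem_set// mul1r.
      apply: le_trans (conjugate_powR w0 k0 _ _ conj) _; [lra|lra|].
      rewrite -[leLHS]addr0 lerD// lerD// ler_piMr ?powR_ge0// invf_le1; try lra.
      by rewrite /s; rewrite mulrA ler_pdivlMr; lra.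
    rewrite indicE memNset// mul0r addr0; apply: (@le_trans _ _ w).
      by rewrite ler_piMr// notin_square_kernel.
    by rewrite lerDr powR_ge0.
rewrite ge0_integralD// ge0_integralD//.
by apply: leeD => //; apply: leeD => //; exact: integral_kernel_square.
Qed.

Lemma plane_uniqueness (r : R) (c : R[i]) W v : 2 < r -> c != 0 -> cmeas W ->
  (\int[mu]_a (normc (W a) `^ r)%:E < +oo)%E -> cintble mu W ->
  cintble mu (fun a => W a * v a) ->
  {ae mu, forall z, c * v z = cauchy mu Z (fun a => W a * v a) z} ->
  {ae mu, forall z, v z = 0}.
Proof.
move=> r2 c0 mW Wr Wi Wvi vE.
(* The constant moves into the potential: [v = C[(W / c) v]]. *)
have mW' : cmeas (fun a => c^-1 * W a) by apply: cmeasM => //; exact: cmeas_cst.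
have I1 : (\int[mu]_a (normc (W a) `^ r)%:E)%E \is a fin_num.
  by rewrite ge0_fin_numE//; apply: integral_ge0 => a _; rewrite lee_fin powR_ge0.
have I2 : (\int[mu]_a (normc (W a))%:E)%E \is a fin_num.
  by rewrite ge0_fin_numE; [exact: Wi.2|apply: integral_ge0 => a _; rewrite lee_fin normc_ge0].
pose M0 := fine (\int[mu]_a (normc (W a) `^ r)%:E)%E + kernel_mass (r / (2 * (r - 1))) +
   fine (\int[mu]_a (normc (W a))%:E)%E.
have M00 : 0 <= M0.
  rewrite addr_ge0 ?addr_ge0 ?kernel_mass_ge0// fine_ge0//; apply: integral_ge0 => a _;
  by rewrite lee_fin ?powR_ge0 ?normc_ge0.
pose Cj (j : nat) := kernel_mass 2^-1 + fine (mu (square (0, 0) j%:R)).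
have fsq (j : nat) : mu (square (0, 0) j%:R) \is a fin_num by exact: square_fin_num.
have ms j : measurable (square (0 : R, 0 : R) j%:R) := measurable_square _ _.
have cover z : exists j : nat, square (0, 0) j%:R z.
  exists (Num.truncn (`|z.1 : R| + `|z.2 : R|)).+1; split; rewrite /= in_itv /= !sub0r !add0r -ler_norml;
  by rewrite (le_trans _ (ltW (truncnS_gt _)))// ?lerDl ?lerDr.
have Cj0 j : 0 <= Cj j.
  by rewrite addr_ge0 ?kernel_mass_ge0// fine_ge0// measure_ge0.
have SC j a : (\int[mu]_z (normc ((\1_(square (0%R, 0%R) j%:R) z)%:C%C / (Z z - Z a)))%:E <=
    (Cj j)%:E)%E.
  by apply: le_trans (integral_kernel_le _ (ms j)) _; rewrite EFinD fineK.
have WM z : (\int[mu]_a (normc (c^-1 * W a / (Z z - Z a)))%:E <= (normc c^-1 * M0)%:E)%E.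
  under eq_integral do rewrite -mulrA normcM EFinM.
  rewrite ge0_integralZl//; last 3 first.
  - apply/measurable_EFinP; apply: measurable_normc; apply: cmeasM => //.
    apply: cmeasV; apply: cmeasB; [exact: cmeas_cst|exact: cmeas_complex_of].
  - by move=> a _; rewrite lee_fin normc_ge0.
  - by rewrite lee_fin normc_ge0.
  rewrite EFinM lee_wpmul2l ?lee_fin ?normc_ge0//.
  by apply: le_trans (integral_potential_le z r2 mW) _; rewrite !EFinD !fineK.
apply: (@cauchy_fixpoint _ _ _ mu Z cmeas_complex_of complex_of_diag0 _ ms cover
  Cj Cj0 SC _ mW' _ (mulr_ge0 (normc_ge0 _) M00) WM).
  by under eq_fun do rewrite -mulrA; exact: cintbleZ.
have Wk := ae_cintble_cauchy cmeas_complex_of ms cover Cj0 SC Wvi.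
apply: filterS2 vE Wk => z vz Wz.
rewrite -[LHS](mulKf c0) vz /cauchy -cint_scale//; congr cint.
by apply/funext => a; rewrite !mulrA.
Qed.

End plane_uniqueness.

(** * Profiles and test functions *)

Section scalar_profiles.
Context {R : realType}.
Implicit Types t x y a b k : R.

Lemma flatB (P Q : {poly R}) t : flat (P - Q) t = flat P t - flat Q t.
Proof.
have [t0|t0] := ltP 0 t; last by rewrite !flat_le0// subr0.
by rewrite !flat_gt0// hornerD hornerN mulrBl.
Qed.

Lemma flat1_ge0 t : 0 <= flat 1 t.
Proof.
have [t0|t0] := ltP 0 t; last by rewrite flat_le0.
by rewrite flat_gt0// hornerC mul1r expR_ge0.
Qed.

Lemma flat1_gt0 t : 0 < t -> 0 < flat 1 t.
Proof. by move=> t0; rewrite flat_gt0// hornerC mul1r expR_gt0. Qed.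

Lemma flatX2_ge0 t : 0 <= flat 'X^2 t.
Proof.
have [t0|t0] := ltP 0 t; last by rewrite flat_le0.
by rewrite flat_gt0// hornerXn mulr_ge0 ?expR_ge0// exprn_ge0// invr_ge0 ltW.
Qed.

Lemma flatX2_gt0 t : 0 < t -> 0 < flat 'X^2 t.
Proof.
by move=> t0; rewrite flat_gt0// hornerXn mulr_gt0 ?expR_gt0// exprn_gt0// invr_gt0.
Qed.

Lemma flat_deriv1 : flat_deriv 1 = 'X^2 :> {poly R}.
Proof. by rewrite /flat_deriv derivC subr0 mul1r. Qed.

Lemma flat_derivX t : flat (flat_deriv 'X) t * t = flat 'X^2 t - flat 'X t.
Proof.
have -> : flat_deriv 'X = ('X^2 - 'X) * 'X :> {poly R}.
  by rewrite /flat_deriv derivX mulrBl mul1r mulrBl -!expr2 -exprS -exprSr.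
by rewrite flatMX flatB.
Qed.

(* [t * pq t] is a smooth step, equal to 0 for t <= 0 and to 1 for t >= 1, and
   [mq] is its derivative. *)
Definition den t : R := flat 1 t + flat 1 (1 - t).
Definition pq t : R := flat 'X t / den t.
Definition dpq t : R := flat (flat_deriv 'X) t / den t -
  flat 'X t * (den t)^-1 ^+ 2 * (flat 'X^2 t - flat 'X^2 (1 - t)).
Definition mq t : R :=
  (flat 'X^2 t * flat 1 (1 - t) + flat 1 t * flat 'X^2 (1 - t)) / den t ^+ 2.

Lemma den_gt0 t : 0 < den t.
Proof.
have [t0|t0] := ltP 0 t; first by rewrite ltr_wpDr ?flat1_ge0 ?flat1_gt0.
by rewrite ltr_wpDl ?flat1_ge0 ?flat1_gt0// subr_gt0 (le_lt_trans t0).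
Qed.

Lemma pq_mul t : pq t * t = flat 1 t / den t.
Proof. by rewrite /pq mulrAC -[in LHS](mul1r 'X) flatMX. Qed.

(** The derivative of the step computed in two ways: the left side is the product rule for
    [t * pq t], the right side the quotient rule for [flat 1 t / den t]. *)
Lemma mqE t : pq t + dpq t * t = mq t.
Proof.
have d0 : den t != 0 by rewrite gt_eqF ?den_gt0.
rewrite /dpq mulrBl mulrAC flat_derivX /pq /mq.
have -> : flat 'X t * (den t)^-1 ^+ 2 * (flat 'X^2 t - flat 'X^2 (1 - t)) * t =
    flat 1 t * (den t)^-1 ^+ 2 * (flat 'X^2 t - flat 'X^2 (1 - t)).
  by rewrite -[flat 1 t]flatMX mul1r; ring.
have dE : den t = flat 1 t + flat 1 (1 - t) by [].
move: d0 dE.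
move: (den t) (flat 'X t) (flat 1 t) (flat 1 (1 - t)) (flat 'X^2 (1 - t)) (flat 'X^2 t).
move=> d a h h1 c1 c d0 dE; have -> : h1 = d - h by rewrite dE; ring.
by field.
Qed.

Lemma mq_ge0 t : 0 <= mq t.
Proof.
by rewrite divr_ge0 ?sqr_ge0// addr_ge0// mulr_ge0 ?flatX2_ge0 ?flat1_ge0.
Qed.

Lemma mq_gt0 t : 0 < t -> t < 1 -> 0 < mq t.
Proof.
move=> t0 t1; rewrite divr_gt0 ?exprn_gt0 ?den_gt0// ltr_wpDr//.
  by rewrite mulr_ge0 ?flatX2_ge0 ?flat1_ge0.
by rewrite mulr_gt0 ?flatX2_gt0 ?flat1_gt0// subr_gt0.
Qed.

Lemma mq_ge1 t : 1 <= t -> mq t = 0.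
Proof.
move=> t1; rewrite /mq [flat 1 (1 - t)]flat_le0 ?subr_le0//.
by rewrite [flat 'X^2 (1 - t)]flat_le0 ?subr_le0// !mulr0 addr0 mul0r.
Qed.

Lemma pq_ge1 t : 1 <= t -> pq t = t^-1.
Proof.
move=> t1; have t0 : 0 < t := lt_le_trans ltr01 t1.
apply: (mulIf (lt0r_neq0 t0)); rewrite pq_mul mulVf ?gt_eqF//.
by rewrite /den [flat 1 (1 - t)]flat_le0 ?subr_le0// addr0 divff// gt_eqF ?flat1_gt0.
Qed.

Lemma pq_mul_le1 t : 0 <= pq t * t <= 1.
Proof.
rewrite pq_mul divr_ge0 ?flat1_ge0 ?(ltW (den_gt0 _))//=.
by rewrite ler_pdivrMr ?den_gt0// mul1r /den lerDl flat1_ge0.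
Qed.

Lemma continuous_den : continuous den.
Proof.
move=> t; apply: cvgD; first exact: continuous_flat.
apply: (@continuous_comp _ _ _ (fun t => 1 - t) (flat 1)).
  by apply: cvgB; [exact: cvg_cst|exact: cvg_id].
exact: continuous_flat.
Qed.

Lemma continuous_mq : continuous mq.
Proof.
move=> t; have c1 : {for t, continuous (fun t : R => 1 - t)}.
  by apply: cvgB; [exact: cvg_cst|exact: cvg_id].
apply: cvgM.
  apply: cvgD; apply: cvgM; try exact: continuous_flat.
  - by apply: (@continuous_comp _ _ _ (fun t => 1 - t) (flat 1)) => //; exact: continuous_flat.
  - by apply: (@continuous_comp _ _ _ (fun t => 1 - t) (flat 'X^2)) => //; exact: continuous_flat.
apply: cvgV; first by rewrite expf_neq0// gt_eqF ?den_gt0.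
by apply: (@continuous_comp _ _ _ den (fun x => x ^+ 2)); [exact: continuous_den|exact: exprn_continuous].
Qed.

Lemma continuous_pq : continuous pq.
Proof.
move=> t; apply: cvgM; first exact: continuous_flat.
by apply: cvgV; [rewrite gt_eqF ?den_gt0|exact: continuous_den].
Qed.

Definition theta t : R := flat 1 (1 - t * t).
Definition dtheta t : R := - (2 * t * flat 'X^2 (1 - t * t)).

Lemma theta_ge0 t : 0 <= theta t. Proof. exact: flat1_ge0. Qed.

Lemma theta0_gt0 : 0 < theta 0.
Proof. by apply: flat1_gt0; rewrite mulr0 subr0. Qed.

Lemma theta_supp t : 1 <= `|t| -> theta t = 0.
Proof.
move=> t1; rewrite /theta flat_le0// subr_le0 -expr2 -real_normK ?num_real//.
by rewrite exprn_ege1.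
Qed.

Lemma dtheta_supp t : 1 <= `|t| -> dtheta t = 0.
Proof.
move=> t1; rewrite /dtheta flat_le0 ?mulr0 ?oppr0// subr_le0 -expr2 -real_normK ?num_real//.
by rewrite exprn_ege1.
Qed.

Lemma theta_bounded : exists2 C : R, 0 <= C & forall t, `|theta t| <= C.
Proof. by have [C C0 HC] := @flat_bounded R 1; exists C => // t; exact: HC. Qed.

Lemma dtheta_bounded : exists2 C : R, 0 <= C & forall t, `|dtheta t| <= C.
Proof.
have [C C0 HC] := @flat_bounded R 'X^2; exists (2 * C); first by rewrite mulr_ge0.
move=> t; have [t1|t1] := leP 1 `|t|; first by rewrite dtheta_supp// normr0 mulr_ge0.
rewrite normrN !normrM ger0_norm// -[leRHS]mulr1 -!mulrA ler_wpM2l//.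
by rewrite mulrC ler_pM// ?normr_ge0// ltW.
Qed.

Lemma continuous_theta : continuous theta.
Proof.
move=> t; apply: (@continuous_comp _ _ _ (fun t => 1 - t * t) (flat 1)).
  by apply: cvgB; [exact: cvg_cst|apply: cvgM; exact: cvg_id].
exact: continuous_flat.
Qed.

(* As k tends to infinity, [bump k a b] increases to the indicator of ]a, b[. *)
Definition bump k a b t : R :=
  let h := flat 1 (t - a) * flat 1 (b - t) in k * h / (1 + k * h).

Lemma bump_den_gt0 k a b t : 0 <= k -> 0 < 1 + k * (flat 1 (t - a) * flat 1 (b - t)).
Proof. by move=> k0; rewrite ltr_wpDr// mulr_ge0// mulr_ge0 ?flat1_ge0. Qed.

Lemma bump_ge0 k a b t : 0 <= k -> 0 <= bump k a b t.
Proof.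
move=> k0; rewrite /bump /= divr_ge0 ?(ltW (bump_den_gt0 _ _ _ k0))//.
by rewrite mulr_ge0// mulr_ge0 ?flat1_ge0.
Qed.

Lemma bump_le1 k a b t : 0 <= k -> bump k a b t <= 1.
Proof.
by move=> k0; rewrite /bump /= ler_pdivrMr ?bump_den_gt0// mul1r lerDr.
Qed.

Lemma bump_supp k a b t : ~~ (a < t < b) -> bump k a b t = 0.
Proof.
rewrite negb_and -!leNgt /bump /= => /orP[h|h].
  by rewrite [flat 1 (t - a)]flat_le0 ?subr_le0// mul0r mulr0 mul0r.
by rewrite [flat 1 (b - t)]flat_le0 ?subr_le0// !mulr0 mul0r.
Qed.

Lemma bump_cvg a b t :
  (fun k : nat => bump k%:R a b t) @ \oo --> ((a < t < b)%R%:R : R).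
Proof.
have [/andP[at_ tb]|h] := boolP (a < t < b); last first.
  have -> : (fun k : nat => bump k%:R a b t) = cst 0.
    by apply/funext => k; rewrite bump_supp.
  exact: cvg_cst.
have h0 : 0 < flat 1 (t - a) * flat 1 (b - t).
  by rewrite mulr_gt0 ?flat1_gt0 ?subr_gt0.
apply/cvgrPdist_lt => e e0.
near=> k; rewrite /bump /=; set h := flat 1 _ * _ in h0 *.
have kh : 0 < 1 + k%:R * h by rewrite ltr_wpDr// mulr_ge0// ltW.
have -> : 1 - k%:R * h / (1 + k%:R * h) = (1 + k%:R * h)^-1.
  by field; rewrite gt_eqF.
rewrite gtr0_norm ?invr_gt0// invf_plt ?posrE//.
have : (e * h)^-1 <= k%:R by near: k; exact: nbhs_infty_ger.
rewrite -div1r ler_pdivrMr; last exact: mulr_gt0 e0 h0.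
move=> hk; rewrite -div1r ltr_pdivrMr// mulrDl mul1r.
by rewrite (le_lt_trans hk)// mulrA mulrAC ltrDr.
Unshelve. all: by end_near. Qed.

End scalar_profiles.

Section planar_functions.
Context {R : realType}.
Implicit Types (x y : R).

(* Smooth regularization of 1/w, and the planar mollifier that is its dbar. *)
Definition kker (k x y : R) : R[i] :=
  let t := (k * x) * (k * x) + (k * y) * (k * y) in
  ((k * (k * x * pq t))%R +i* (- (k * (k * y * pq t)))%R)%C.

Definition mker (k x y : R) : R :=
  k ^+ 2 * mq ((k * x) * (k * x) + (k * y) * (k * y)).

(** The normalization makes [chi] tend to 1 pointwise as [r] grows. *)
Definition chi (r x y : R) : R :=
  (theta 0 ^+ 2)^-1 * (theta (r^-1 * x) * theta (r^-1 * y)).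

(** The Wirtinger derivative of [chi r] in the variable [bar w], for [w = x + i y]. *)
Definition dchi (r x y : R) : R[i] :=
  (((theta 0 ^+ 2)^-1 * (r^-1 * dtheta (r^-1 * x) * theta (r^-1 * y)) / 2)%R +i*
   ((theta 0 ^+ 2)^-1 * (theta (r^-1 * x) * (r^-1 * dtheta (r^-1 * y))) / 2)%R)%C.

Definition beta m (k : R) (lo hi : 'I_m + 'I_m -> R) (z : Cn R m) : R :=
  \prod_i bump k (lo i) (hi i) (coordinate i z).

End planar_functions.

Section test_functions.
Context {R : realType} {m : nat}.
Variables (r k kb : R) (a : plane R) (lo hi : 'I_m + 'I_m -> R).
Hypotheses (r0 : 0 < r) (kb0 : 0 <= kb).
Implicit Types z : Cn R m.+1.

Local Notation i0 := (inl ord0 : 'I_m.+1 + 'I_m.+1).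
Local Notation j0 := (inr ord0 : 'I_m.+1 + 'I_m.+1).
Local Notation e1 := (Cst 1).
Local Notation opp e := (Mul (Cst (-1)) e).

(** The terms [eX], [eY] and [eT] are the real part, the imaginary part and the squared modulus of
    [k (a - z1)]; [eKr] and [eKi] are the two parts of [kker]. *)
Definition scaled (c : R) i : @expr R m.+1 := Mul (Cst k) (Add (Cst c) (opp (Coord i))).
Definition eX := scaled a.1 i0.
Definition eY := scaled a.2 j0.
Definition eT := Add (Mul eX eX) (Mul eY eY).
Definition eDen := Add (Flat 1 eT) (Flat 1 (Add e1 (opp eT))).
Definition eP := Mul (Flat 'X eT) (Inv eDen).
Definition eKr := Mul (Cst k) (Mul eX eP).
Definition eKi := opp (Mul (Cst k) (Mul eY eP)).

Definition theta_expr i : @expr R m.+1 := Flat 1 (Add e1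
  (opp (Mul (Mul (Cst r^-1) (Coord i)) (Mul (Cst r^-1) (Coord i))))).
Definition eChi := Mul (Cst (theta (0 : R) ^+ 2)^-1) (Mul (theta_expr i0) (theta_expr j0)).

Definition bump_expr (l h : R) i : @expr R m.+1 :=
  let H := Mul (Cst kb) (Mul (Flat 1 (Add (Coord i) (Cst (- l))))
                             (Flat 1 (Add (Cst h) (opp (Coord i))))) in
  Mul H (Inv (Add e1 H)).

Definition beta_expr (s : seq ('I_m + 'I_m)) : @expr R m.+1 :=
  foldr (fun i e => Mul (bump_expr (lo i) (hi i) (lift_index i)) e) (Cst 1) s.
Definition eBeta := beta_expr (index_enum _).

Let ev_opp e z : ev (opp e) z = - ev e z.
Proof. by rewrite /= mulN1r. Qed.

Lemma ev_scaled c i z : ev (scaled c i) z = k * (c - coordinate i z).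
Proof. by rewrite /= mulN1r. Qed.

Let ev_den z : ev eDen z = den (ev eT z).
Proof. by rewrite -[LHS]/(flat 1 (ev eT z) + flat 1 (1 + -1 * ev eT z)) mulN1r. Qed.

Let ev_eP z : ev eP z = pq (ev eT z).
Proof. by rewrite -[LHS]/(flat 'X (ev eT z) * (ev eDen z)^-1) ev_den. Qed.

Let wf_eP : wf eP.
Proof.
do ![split=> //] => z; rewrite -[X in X != 0]/(ev eDen z) ev_den.
by rewrite gt_eqF// den_gt0.
Qed.

Let ev_der_eP i z : ev (der i eP) z = dpq (ev eT z) * ev (der i eT) z.
Proof.
rewrite -[LHS]/(flat 'X (ev eT z) * (-1 * ((ev eDen z)^-1 * (ev eDen z)^-1 *
  ev (der i eDen) z)) + (ev eDen z)^-1 * (flat (flat_deriv 'X) (ev eT z) *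
  ev (der i eT) z)).
have -> : ev (der i eDen) z =
    (flat 'X^2 (ev eT z) - flat 'X^2 (1 - ev eT z)) * ev (der i eT) z.
  rewrite -[LHS]/(flat (flat_deriv 1) (ev eT z) * ev (der i eT) z +
    flat (flat_deriv 1) (1 + -1 * ev eT z) *
    (0 + (-1 * ev (der i eT) z + ev eT z * 0))).
  by rewrite flat_deriv1 mulN1r; ring.
by rewrite ev_den /dpq; ring.
Qed.

Let der_scaled c i j z : ev (der i (scaled c j)) z = - (k * (i == j)%:R).
Proof. by rewrite /=; ring. Qed.

Let der_eT i z : ev (der i eT) z =
  - (2 * k * (ev eX z * (i == i0)%:R + ev eY z * (i == j0)%:R)).
Proof.
rewrite -[LHS]/((ev eX z * ev (der i eX) z + ev eX z * ev (der i eX) z) +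
  (ev eY z * ev (der i eY) z + ev eY z * ev (der i eY) z)).
by rewrite !der_scaled; ring.
Qed.

Let der_theta i j z : ev (der i (theta_expr j)) z =
  (i == j)%:R * (r^-1 * dtheta (r^-1 * coordinate j z)).
Proof.
rewrite /theta_expr [LHS]/= flat_deriv1 mulN1r /dtheta.
by move: (flat _ _) => f; ring.
Qed.

Let ev_theta j z : ev (theta_expr j) z = theta (r^-1 * coordinate j z).
Proof. by rewrite /theta_expr [LHS]/= mulN1r. Qed.

Let ev_bump l h i z : ev (bump_expr l h i) z = bump kb l h (coordinate i z).
Proof. by rewrite /bump_expr [LHS]/= mulN1r. Qed.

Let wf_bump l h i : wf (bump_expr l h i).
Proof.
do ![split=> //] => z; rewrite [X in X != 0]/= mulN1r.
by rewrite gt_eqF// bump_den_gt0.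
Qed.

Let der_bump l h i j z : i != j -> ev (der i (bump_expr l h j)) z = 0.
Proof. by move=> ij; rewrite /bump_expr /= (negbTE ij) mulr0n; ring. Qed.

Let ev_beta z : ev eBeta z = \prod_i bump kb (lo i) (hi i) (coordinate (lift_index i) z).
Proof.
rewrite /eBeta; elim: (index_enum _) => [|i s IH]; first by rewrite big_nil.
by rewrite big_cons -IH -ev_bump.
Qed.

Let wf_beta : wf eBeta.
Proof. by rewrite /eBeta; elim: (index_enum _) => //= i s IH; split => //; exact: wf_bump. Qed.

Let der_beta i z : (i == i0) || (i == j0) -> ev (der i eBeta) z = 0.
Proof.
move=> ij; rewrite /eBeta; elim: (index_enum _) => [//|l s IH].
rewrite -[LHS]/(ev (bump_expr (lo l) (hi l) (lift_index l)) z * ev (der i (beta_expr s)) z +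
  ev (beta_expr s) z * ev (der i (bump_expr (lo l) (hi l) (lift_index l))) z).
rewrite IH der_bump ?mulr0 ?addr0//.
by case: l => l; case/orP: ij => /eqP -> //=; rewrite -?[inl _ == inl _]/(_ == _)
  -?[inr _ == inr _]/(_ == _) neq_lift.
Qed.

Definition test_re : @expr R m.+1 := Mul (Mul eChi eBeta) eKr.
Definition test_im : @expr R m.+1 := Mul (Mul eChi eBeta) eKi.

Lemma wf_test_re : wf test_re.
Proof. by do ![split=> //]. Qed.

Lemma wf_test_im : wf test_im.
Proof. by do ![split=> //]. Qed.

Definition test z : R[i] := (ev test_re z +i* ev test_im z)%C.

Lemma test_slice (p : plane R * Cn R m) : test (slice p) =
  (chi r p.1.1 p.1.2 * beta kb lo hi p.2)%:C%C *
  kker k (a.1 - (p.1.1 : R)) (a.2 - (p.1.2 : R)).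
Proof.
set z := slice p.
have hchi : ev eChi z = chi r p.1.1 p.1.2.
  rewrite -[LHS]/(_ * (ev (theta_expr i0) z * ev (theta_expr j0) z)) !ev_theta.
  by rewrite coordinate_slice0l coordinate_slice0r.
have hbeta : ev eBeta z = beta kb lo hi p.2.
  by rewrite ev_beta; apply: eq_bigr => i _; rewrite coordinate_sliceS.
rewrite /test -[ev test_re z]/(ev eChi z * ev eBeta z * (k * (ev eX z * ev eP z))).
rewrite -[ev test_im z]/(ev eChi z * ev eBeta z * (-1 * (k * (ev eY z * ev eP z)))).
rewrite hchi hbeta ev_eP -[ev eT z]/(ev eX z * ev eX z + ev eY z * ev eY z).
rewrite !ev_scaled coordinate_slice0l coordinate_slice0r /kker /=.
by apply/eqP; rewrite eq_complex /=; apply/andP; split; apply/eqP; ring.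
Qed.

(** The product rule: [beta] does not involve [z1], and the kernel depends on [w = a - z1], whence
    the minus sign. With [t = |k w|^2] one has [kker = k^2 conj(w) pq(t)], whose derivative in
    [bar w] is [k^2 (pq t + t pq' t)], that is [mker]. *)
Lemma dbar_test_slice (p : plane R * Cn R m) : dbar ord0 test (slice p) =
  (beta kb lo hi p.2)%:C%C *
  (dchi r p.1.1 p.1.2 * kker k (a.1 - (p.1.1 : R)) (a.2 - (p.1.2 : R)) -
   (chi r p.1.1 p.1.2 * mker k (a.1 - (p.1.1 : R)) (a.2 - (p.1.2 : R)))%:C%C).
Proof.
set z := slice p.
have hchi : ev eChi z = chi r p.1.1 p.1.2.
  rewrite -[LHS]/(_ * (ev (theta_expr i0) z * ev (theta_expr j0) z)) !ev_theta.
  by rewrite coordinate_slice0l coordinate_slice0r.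
have hbeta : ev eBeta z = beta kb lo hi p.2.
  by rewrite ev_beta; apply: eq_bigr => i _; rewrite coordinate_sliceS.
have part i : (i == i0) || (i == j0) ->
    Cpartial i test z = (ev (der i test_re) z +i* ev (der i test_im) z)%C.
  move=> _; rewrite /Cpartial /=.
  rewrite -[fun x => ev test_re x]/(ev test_re) -[fun x => ev test_im x]/(ev test_im).
  by rewrite (partial_ev i wf_test_re) (partial_ev i wf_test_im).
rewrite /dbar !part ?eqxx ?orbT//.
have dre i : (i == i0) || (i == j0) -> ev (der i test_re) z =
    ev eBeta z * (ev eChi z * (k * (ev eX z * ev (der i eP) z + ev eP z * ev (der i eX) z)) +
      ev eKr z * ev (der i eChi) z).
  move=> ij; rewrite -[LHS]/(ev eChi z * ev eBeta z *
    (k * (ev eX z * ev (der i eP) z + ev eP z * ev (der i eX) z) + ev (Mul eX eP) z * 0) +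
    ev eKr z * (ev eChi z * ev (der i eBeta) z + ev eBeta z * ev (der i eChi) z)).
  by rewrite der_beta//; ring.
have dim i : (i == i0) || (i == j0) -> ev (der i test_im) z =
    - (ev eBeta z * (ev eChi z * (k * (ev eY z * ev (der i eP) z + ev eP z * ev (der i eY) z)) +
      k * (ev eY z * ev eP z) * ev (der i eChi) z)).
  move=> ij; rewrite -[LHS]/(ev eChi z * ev eBeta z *
    (-1 * (k * (ev eY z * ev (der i eP) z + ev eP z * ev (der i eY) z) + ev (Mul eY eP) z * 0)
      + k * (ev eY z * ev eP z) * 0) +
    -1 * (k * (ev eY z * ev eP z)) * (ev eChi z * ev (der i eBeta) z + ev eBeta z * ev (der i eChi) z)).
  by rewrite der_beta//; ring.
have dch i : ev (der i eChi) z = (theta 0 ^+ 2)^-1 *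
    (theta (r^-1 * p.1.1) * ((i == j0)%:R * (r^-1 * dtheta (r^-1 * p.1.2))) +
     theta (r^-1 * p.1.2) * ((i == i0)%:R * (r^-1 * dtheta (r^-1 * p.1.1)))).
  rewrite -[LHS]/((theta 0 ^+ 2)^-1 * (ev (theta_expr i0) z * ev (der i (theta_expr j0)) z +
    ev (theta_expr j0) z * ev (der i (theta_expr i0)) z) +
    ev (Mul (theta_expr i0) (theta_expr j0)) z * 0).
  rewrite !ev_theta !der_theta coordinate_slice0l coordinate_slice0r.
  by rewrite mulr0 addr0.
rewrite !dre ?dim ?eqxx ?orbT// !dch !ev_der_eP !der_eT !der_scaled hbeta hchi.
rewrite -[ev eKr z]/(k * (ev eX z * ev eP z)) ev_eP.
have E1 : ev eX z = k * (a.1 - (p.1.1 : R)) by rewrite ev_scaled coordinate_slice0l.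
have E2 : ev eY z = k * (a.2 - (p.1.2 : R)) by rewrite ev_scaled coordinate_slice0r.
have ET : ev eT z = ev eX z * ev eX z + ev eY z * ev eY z by [].
have Eij : (i0 == j0) = false by [].
have Eji : (j0 == i0) = false by [].
rewrite !Eij !Eji !eqxx !mulr1n !mulr0n.
rewrite /dchi /kker /mker -mqE -E1 -E2 -ET; move: ET.
move: (ev eT z) (pq (ev eT z)) (dpq (ev eT z)) (ev eX z) (ev eY z) => t q dq X Y ET.
move: (dtheta _) (dtheta _) (theta (r^-1 * _)) (theta (r^-1 * _)) (chi _ _ _) (beta _ _ _ _) => *.
(* The shape that the inverse of the complex number 2 takes after simplification. *)
have h2 : (1 + 1) / ((1 + 1) ^+ 2 + 0 ^+ 2) = 2^-1 :> R by field.
rewrite ET; move: (theta 0 ^- 2) (r^-1) => t0 ri.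
apply/eqP; rewrite eq_complex; apply/andP; split; apply/eqP; simpc => /=; rewrite ?h2.
- by field.
- by field.
Qed.

End test_functions.

(** * Size, support and limits of the profiles *)

Section profile_bounds.
Context {R : realType}.
Implicit Types (t x y k r : R).

(** One of [t] and [1 - t] is at least 1/2, and [flat 1] is at least [exp(-2)] there. *)
Lemma den_ge t : expR (- 2) <= den t.
Proof.
have h (s : R) : 2^-1 <= s -> expR (- 2) <= flat 1 s.
  move=> s2; have s0 : 0 < s by apply: lt_le_trans s2; rewrite invr_gt0.
  by rewrite flat_gt0// hornerC mul1r ler_expR lerN2 -[leRHS]invrK lef_pV2 ?posrE.
have [t2|t2] := leP 2^-1 t.
  by apply: le_trans (h _ t2) _; rewrite lerDl flat1_ge0.
have : 2^-1 <= 1 - t by lra.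
by move=> /h /le_trans; apply; rewrite lerDr flat1_ge0.
Qed.

Lemma pq_ge0 t : 0 <= pq t.
Proof.
have [t0|t0] := ltP 0 t; last by rewrite /pq flat_le0// mul0r.
rewrite divr_ge0 ?(ltW (den_gt0 t))// flat_gt0// hornerX.
by rewrite mulr_ge0 ?expR_ge0// invr_ge0 ltW.
Qed.

Lemma pq_bounded : exists2 C : R, 0 <= C & forall t, pq t <= C.
Proof.
have [C C0 HC] := @flat_bounded R 'X; exists (C / expR (- 2)).
  by rewrite divr_ge0 ?expR_ge0.
move=> t; apply: ler_pM; rewrite ?invr_ge0 ?(ltW (den_gt0 t))//.
- have [t0|t0] := ltP 0 t; last by rewrite flat_le0.
  by rewrite flat_gt0// hornerX mulr_ge0 ?expR_ge0// invr_ge0 ltW.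
- by apply: le_trans (HC t); exact: ler_norm.
- by rewrite lef_pV2 ?posrE ?den_gt0 ?expR_gt0// den_ge.
Qed.

Lemma mq_bounded : exists2 C : R, 0 <= C & forall t, mq t <= C.
Proof.
have [C C0 HC] := @flat_bounded R 'X^2; have [D D0 HD] := @flat_bounded R 1.
exists ((C * D + D * C) / expR (- 2) ^+ 2).
  by rewrite divr_ge0 ?exprn_ge0 ?expR_ge0// addr_ge0// mulr_ge0.
have h2 s : flat 'X^2 s <= C by apply: le_trans (HC s); exact: ler_norm.
have h1 s : flat 1 s <= D by apply: le_trans (HD s); exact: ler_norm.
move=> t; apply: ler_pM.
- by rewrite addr_ge0// mulr_ge0 ?flatX2_ge0 ?flat1_ge0.
- by rewrite invr_ge0 exprn_ge0// ltW// den_gt0.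
- by apply: lerD; apply: ler_pM; rewrite ?flatX2_ge0 ?flat1_ge0.
- rewrite lef_pV2 ?posrE ?exprn_gt0 ?den_gt0 ?expR_gt0//.
  by rewrite lerXn2r ?nnegrE ?den_ge ?expR_ge0// ltW// den_gt0.
Qed.

(** With [w = x + i y] and [t = |k w|^2], the regularized kernel is the smooth step [t * pq t] times
    [1/w]. Hence it is dominated by [1/|w|] and equals [1/w] once [|k w| >= 1]. At [w = 0] both
    sides are 0 by the convention on inverses. *)
Lemma kkerE k x y : k != 0 -> kker k x y =
  (pq (k * x * (k * x) + k * y * (k * y)) *
    (k * x * (k * x) + k * y * (k * y)))%:C%C * (x +i* y)%C^-1.
Proof.
move=> k0; rewrite /kker; set t := _ + _.
have [xy0|xy0] := eqVneq (x ^+ 2 + y ^+ 2) 0.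
  have x0 : x = 0.
    by apply/eqP; move/eqP: xy0; rewrite paddr_eq0 ?sqr_ge0// sqrf_eq0 => /andP[].
  have y0 : y = 0.
    by apply/eqP; move/eqP: xy0; rewrite paddr_eq0 ?sqr_ge0// !sqrf_eq0 => /andP[].
  rewrite /t x0 y0 !mulr0 !mul0r addr0 !mulr0 oppr0.
  by rewrite mul0r.
have tE : t = k ^+ 2 * (x ^+ 2 + y ^+ 2) by rewrite /t; ring.
move: (pq t) => q; rewrite tE.
apply/eqP; rewrite eq_complex; apply/andP; split; apply/eqP; simpc => /=.
- by field.
- by field.
Qed.

Lemma normc_kker_le k x y : k != 0 -> normc (kker k x y) <= normc (x +i* y)%C^-1.
Proof.
move=> k0; rewrite kkerE// normcM normc_real ler_piMl ?normc_ge0//.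
by have /andP[h1 h2] := pq_mul_le1 (k * x * (k * x) + k * y * (k * y)); rewrite ger0_norm.
Qed.

Lemma kker_eq_inv k x y : 1 <= k * x * (k * x) + k * y * (k * y) ->
  kker k x y = (x +i* y)%C^-1.
Proof.
move=> t1; have k0 : k != 0.
  by apply: contraTneq t1 => ->; rewrite !mul0r addr0 -ltNge ltr01.
by rewrite kkerE// pq_ge1// mulVf ?mul1r// gt_eqF// (lt_le_trans ltr01).
Qed.

(** For [|s| <= 1] the bound on [pq] suffices; otherwise [|s| <= s^2], so that [|s| pq] is at most
    the smooth step, hence at most 1. *)
Lemma kker_bounded k : exists2 C : R, 0 <= C & forall x y, normc (kker k x y) <= C.
Proof.
have [C C0 HC] := pq_bounded.
have C1 : 0 <= C + 1 by rewrite addr_ge0.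
have key (s s' : R) : `|s * pq (s * s + s' * s')| <= C + 1.
  rewrite normrM (ger0_norm (pq_ge0 _)).
  have [s1|s1] := leP `|s| 1.
    by apply: (@le_trans _ _ C); [rewrite -[leRHS]mul1r ler_pM ?pq_ge0|rewrite lerDl].
  apply: (@le_trans _ _ 1); last by rewrite lerDr.
  have /andP[_] := pq_mul_le1 (s * s + s' * s'); apply: le_trans.
  rewrite mulrC ler_wpM2l ?pq_ge0// -expr2 -(real_normK (num_real s)).
  rewrite ler_wpDr -?expr2 ?sqr_ge0//.
  by rewrite expr2 ler_peMl// ltW.
exists (`|k| * (C + 1) + `|k| * (C + 1)); first by rewrite addr_ge0// mulr_ge0.
move=> x y; apply: le_trans (normc_le_ReIm _) _; rewrite /kker /= normrN !(normrM k).
apply: lerD; first by apply: ler_wpM2l => //; exact: key.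
by apply: ler_wpM2l => //; rewrite [k * x * (k * x) + _]addrC; exact: key.
Qed.

Lemma mker_ge0 k x y : 0 <= mker k x y.
Proof. by rewrite mulr_ge0 ?sqr_ge0// mq_ge0. Qed.

Lemma mker_bounded k : exists2 C : R, 0 <= C & forall x y, mker k x y <= C.
Proof.
have [C C0 HC] := mq_bounded; exists (k ^+ 2 * C); first by rewrite mulr_ge0 ?sqr_ge0.
by move=> x y; rewrite ler_wpM2l ?sqr_ge0.
Qed.

Lemma mker_supp k x y : 1 <= k * x * (k * x) + k * y * (k * y) -> mker k x y = 0.
Proof. by move=> t1; rewrite /mker mq_ge1// mulr0. Qed.

Lemma chi_ge0 r x y : 0 <= chi r x y.
Proof. by rewrite mulr_ge0 ?invr_ge0 ?sqr_ge0// mulr_ge0// theta_ge0. Qed.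

Lemma chi_bounded : exists2 C : R, 0 <= C & forall r x y, chi r x y <= C.
Proof.
have [C C0 HC] := @theta_bounded R; exists ((theta 0 ^+ 2)^-1 * (C * C)).
  by rewrite mulr_ge0 ?invr_ge0 ?sqr_ge0// mulr_ge0.
move=> r x y; rewrite ler_wpM2l ?invr_ge0 ?sqr_ge0// ler_pM ?theta_ge0//.
  by apply: le_trans (HC _); exact: ler_norm.
by apply: le_trans (HC _); exact: ler_norm.
Qed.

Lemma dchi_bounded : exists2 C : R, 0 <= C &
  forall r x y, 0 < r -> normc (dchi r x y) <= C / r.
Proof.
have [C C0 HC] := @theta_bounded R; have [D D0 HD] := @dtheta_bounded R.
set t0 := (theta (0 : R) ^+ 2)^-1.
have t00 : 0 <= t0 by rewrite invr_ge0 sqr_ge0.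
exists (t0 * (D * C) + t0 * (D * C)); first by rewrite addr_ge0// mulr_ge0// mulr_ge0.
have half (z : R) : 0 <= z -> z / 2 <= z by lra.
move=> r x y rp; apply: le_trans (normc_le_ReIm _) _; rewrite /dchi /= -/t0.
have e1 : `|dtheta (r^-1 * x)| * `|theta (r^-1 * y)| <= D * C by rewrite ler_pM.
have e2 : `|dtheta (r^-1 * y)| * `|theta (r^-1 * x)| <= D * C by rewrite ler_pM.
rewrite !normrM (ger0_norm t00) (gtr0_norm (_ : 0 < r^-1)) ?invr_gt0//.
rewrite [`|2^-1|]gtr0_norm ?invr_gt0// mulrDl; apply: lerD.
  apply: le_trans (half _ _) _; first by rewrite !mulr_ge0// invr_ge0 ltW.
  have -> : t0 * (r^-1 * `|dtheta (r^-1 * x)| * `|theta (r^-1 * y)|) =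
    t0 * (`|dtheta (r^-1 * x)| * `|theta (r^-1 * y)|) * r^-1 by ring.
  by rewrite ler_wpM2r ?invr_ge0 ?(ltW rp)// ler_wpM2l.
apply: le_trans (half _ _) _; first by rewrite !mulr_ge0// invr_ge0 ltW.
have -> : t0 * (`|theta (r^-1 * x)| * (r^-1 * `|dtheta (r^-1 * y)|)) =
  t0 * (`|dtheta (r^-1 * y)| * `|theta (r^-1 * x)|) * r^-1 by ring.
by rewrite ler_wpM2r ?invr_ge0 ?(ltW rp)// ler_wpM2l.
Qed.

Lemma chi_supp r x y : 0 < r -> (r <= `|x|) || (r <= `|y|) -> chi r x y = 0.
Proof.
have h (z : R) : 0 < r -> r <= `|z| -> theta (r^-1 * z) = 0.
  move=> r0 rz; rewrite theta_supp// normrM gtr0_norm ?invr_gt0//.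
  by rewrite ler_pdivlMl// mulr1.
by move=> r0 /orP[] /(h _ r0) h0; rewrite /chi h0 ?mul0r ?mulr0.
Qed.

Lemma dchi_supp r x y : 0 < r -> (r <= `|x|) || (r <= `|y|) -> dchi r x y = 0.
Proof.
have h (z : R) : 0 < r -> r <= `|z| -> theta (r^-1 * z) = 0 /\ dtheta (r^-1 * z) = 0.
  by move=> r0 rz; split; [rewrite theta_supp//|rewrite dtheta_supp//];
    rewrite normrM gtr0_norm ?invr_gt0// ler_pdivlMl// mulr1.
by move=> r0 /orP[] /(h _ r0) [h0 h1]; rewrite /dchi h0 h1 ?mulr0 ?mul0r ?mulr0 ?mul0r.
Qed.

Lemma chi_cvg x y : (fun j : nat => chi j.+1%:R x y) @ \oo --> (1 : R).
Proof.
have ht (z : R) : (fun j : nat => theta (j.+1%:R^-1 * z)) @ \oo --> theta 0.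
  have hz : (fun j : nat => j.+1%:R^-1 * z) @ \oo --> (0 : R).
    by rewrite -(mul0r z); apply: cvgMl; exact: cvg_harmonic.
  by apply: continuous_cvg => //; exact: continuous_theta.
have : (fun j : nat => chi j.+1%:R x y) @ \oo -->
    (theta (0 : R) ^+ 2)^-1 * (theta 0 * theta 0).
  by apply: cvgMr; apply: cvgM.
by rewrite -expr2 mulVf// expf_neq0// gt_eqF// theta0_gt0.
Qed.

End profile_bounds.

Section profile_measurable.
Context d (T : measurableType d) (R : realType).
Implicit Types f g : T -> R.

Lemma measurable_cont (h : R -> R) f : continuous h -> measurable_fun setT f ->
  measurable_fun setT (fun x => h (f x)).
Proof. by move=> ch mf; apply: measurableT_comp => //; exact: continuous_measurable_fun. Qed.

Let msq k f g : measurable_fun setT f -> measurable_fun setT g ->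
  measurable_fun setT (fun x => k * f x * (k * f x) + k * g x * (k * g x)).
Proof.
move=> mf mg; have mk h : measurable_fun setT h -> measurable_fun setT (fun x : T => k * h x).
  by move=> mh; apply: measurable_funM => //; exact: measurable_cst.
by apply: measurable_funD; apply: measurable_funM; exact: mk.
Qed.

Lemma cmeas_kker k f g : measurable_fun setT f -> measurable_fun setT g ->
  cmeas (fun x => kker k (f x) (g x)).
Proof.
move=> mf mg; have mt := msq k mf mg.
have mq := measurable_cont (@continuous_pq R) mt.
have mc : measurable_fun setT (fun x : T => k) by exact: measurable_cst.
have mk h : measurable_fun setT h -> measurable_fun setT (fun x : T => k * h x).
  by move=> mh; exact: measurable_funM.
split; rewrite /kker /=.
  by apply: (mk); apply: measurable_funM => //; exact: mk.
by apply: measurable_funN; apply: (mk); apply: measurable_funM => //; exact: mk.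
Qed.

Lemma measurable_mker k f g : measurable_fun setT f -> measurable_fun setT g ->
  measurable_fun setT (fun x => mker k (f x) (g x)).
Proof.
move=> mf mg; apply: measurable_funM; first exact: measurable_cst.
exact: (measurable_cont (@continuous_mq R) (msq k mf mg)).
Qed.

Let mth r f : measurable_fun setT f -> measurable_fun setT (fun x => theta (r * f x)).
Proof.
move=> mf; apply: (measurable_cont (@continuous_theta R)).
by apply: measurable_funM => //; exact: measurable_cst.
Qed.

Let mdth r f : measurable_fun setT f -> measurable_fun setT (fun x => dtheta (r * f x)).
Proof.
move=> mf; rewrite /dtheta.
have mr : measurable_fun setT (fun x => r * f x).
  by apply: measurable_funM => //; exact: measurable_cst.
apply: measurable_funN; apply: measurable_funM.
  by apply: measurable_funM => //; exact: measurable_cst.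
apply: (measurable_cont (@continuous_flat R _)); apply: measurable_funB.
  exact: measurable_cst.
exact: measurable_funM.
Qed.

Lemma measurable_chi r f g : measurable_fun setT f -> measurable_fun setT g ->
  measurable_fun setT (fun x => chi r (f x) (g x)).
Proof.
move=> mf mg; apply: measurable_funM; first exact: measurable_cst.
by apply: measurable_funM; exact: mth.
Qed.

Lemma cmeas_dchi r f g : measurable_fun setT f -> measurable_fun setT g ->
  cmeas (fun x => dchi r (f x) (g x)).
Proof.
have mc c : measurable_fun setT (fun x : T => c : R) by exact: measurable_cst.
move=> mf mg; split; rewrite /dchi /=.
  apply: measurable_funM => //; apply: measurable_funM => //.
  by apply: measurable_funM; [apply: measurable_funM => //; exact: mdth|exact: mth].
apply: measurable_funM => //; apply: measurable_funM => //.
by apply: measurable_funM; [exact: mth|apply: measurable_funM => //; exact: mdth].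
Qed.

Lemma measurable_bump k a b f : 0 <= k -> measurable_fun setT f ->
  measurable_fun setT (fun x => bump k a b (f x)).
Proof.
move=> k0 mf; apply: measurable_cont mf => t.
have cb : {for t, continuous (fun t => k * (flat 1 (t - a) * flat 1 (b - t)))}.
  apply: cvgM; first exact: cvg_cst.
  apply: cvgM.
    apply: (@continuous_comp _ _ _ (fun t => t - a) (flat 1)).
      by apply: cvgB; [exact: cvg_id|exact: cvg_cst].
    exact: continuous_flat.
  apply: (@continuous_comp _ _ _ (fun t => b - t) (flat 1)).
    by apply: cvgB; [exact: cvg_cst|exact: cvg_id].
  exact: continuous_flat.
rewrite /bump /=; apply: cvgM => //.
apply: cvgV; first by rewrite gt_eqF// bump_den_gt0.
by apply: cvgD => //; exact: cvg_cst.
Qed.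

End profile_measurable.

(** * Closed cubes and local integrability *)

Section closed_cubes.
Context {R : realType} {n : nat}.

Definition ccube (M : R) : set (Cn R n.+1) :=
  [set z | forall i, `|coordinate i z| <= M].

Lemma ccube_setX M : ccube M =
  [set v : 'rV[R]_n.+1 | forall i, `[- M, M]%classic (v ord0 i)] `*`
  [set v : 'rV[R]_n.+1 | forall i, `[- M, M]%classic (v ord0 i)].
Proof.
apply/seteqP; split => z /=.
  by move=> h; split => i; rewrite in_itv /= -ler_norml; [exact: h (inl i)|exact: h (inr i)].
by move=> [h1 h2] [i|i] /=; [have := h1 i|have := h2 i]; rewrite in_itv /= -ler_norml.
Qed.

Lemma compact_ccube M : compact (ccube M).
Proof.
rewrite ccube_setX; apply: compact_setX;
  apply: (@rV_compact _ _ (fun=> `[- M, M]%classic)) => _; exact: segment_compact.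
Qed.

Lemma measurable_ccube M : measurable (ccube M).
Proof.
have -> : ccube M = \bigcap_(i in [set: 'I_n.+1 + 'I_n.+1])
    (coordinate i @^-1` `[- M, M]%classic).
  apply/seteqP; split => z /= h i; first by move=> _; rewrite /= in_itv /= -ler_norml; exact: h.
  by have := h i I; rewrite /= in_itv /= -ler_norml.
apply: fin_bigcap_measurable => // i _; rewrite -[X in measurable X]setTI.
exact: measurable_coordinate.
Qed.

Lemma ccube_lty M : (lebesgue_Cn R n.+1 (ccube M) < +oo)%E.
Proof.
apply: le_lt_trans (lebesgue_box_lty (fun=> - (M + 1)) (fun=> M + 1)).
apply: le_measure; rewrite ?inE; [exact: measurable_ccube|exact: measurable_box|].
by move=> z h i; have := h i; rewrite -ltr_norml => /le_lt_trans; apply; rewrite ltrDl.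
Qed.

(** By [|u| <= 1 + |u|^2] on a set of finite measure. *)
Lemma in_L2loc_cintble (u : Cn R n.+1 -> R[i]) M : in_L2loc u ->
  cintble (lebesgue_Cn R n.+1) (fun z => (\1_(ccube M) z)%:C%C * u z).
Proof.
move=> [mu uloc]; have mu' : cmeas u := mu.
have mI : measurable_fun setT (\1_(ccube M) : Cn R n.+1 -> R).
  by apply: measurable_indic; exact: measurable_ccube.
have mn := measurable_normc mu'.
apply: (@cintble_le _ _ _ _ _ (fun z => \1_(ccube M) z + \1_(ccube M) z * cmod u z ^+ 2)).
- by apply: cmeasM => //; exact: cmeas_real.
- apply/integrableP; split.
    apply/measurable_EFinP; apply: measurable_funD => //; apply: measurable_funM => //.
    exact: measurable_funX.
  apply: (@le_lt_trans _ _ (\int[lebesgue_Cn R n.+1]_z ((\1_(ccube M) z : R)%:E +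
      (\1_(ccube M) z * cmod u z ^+ 2)%:E))%E).
    rewrite le_eqVlt; apply/orP; left; apply/eqP; apply: eq_integral => z _ /=.
    by rewrite ger0_norm// addr_ge0// mulr_ge0// sqr_ge0.
  rewrite ge0_integralD//; last 3 first.
  + by apply/measurable_EFinP.
  + by move=> z _; rewrite lee_fin mulr_ge0// sqr_ge0.
  + apply/measurable_EFinP; apply: measurable_funM => //; exact: measurable_funX.
  apply: lte_add_pinfty.
    rewrite integral_indic//; last exact: measurable_ccube.
    by rewrite setIT; exact: ccube_lty.
  have := uloc _ (@compact_ccube M).
  apply: le_lt_trans; rewrite le_eqVlt; apply/orP; left; apply/eqP.
  rewrite [RHS]integral_mkcond; apply: eq_integral => z _; rewrite patchE indicE.
  by case: ifP => _; rewrite ?mul1r ?mul0r.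
- move=> z; rewrite normcM normc_real ger0_norm//.
  have c0 : 0 <= \1_(ccube M) z :> R by [].
  rewrite -/(cmod u z) -[X in _ <= X + _]mulr1 -mulrDr ler_wpM2l//.
  by have := sqr_ge0 (cmod u z - 1); have := sqr_ge0 (cmod u z); move: (cmod u z) => t; nra.
Qed.

End closed_cubes.

Section test_function_slices.
Context {R : realType} {m : nat}.
Variables (r k kb : R) (a : plane R) (lo hi : 'I_m + 'I_m -> R).
Hypotheses (r0 : 0 < r) (kb0 : 0 <= kb).
Implicit Types p : plane R * Cn R m.
Notation n := m.+1.
Local Notation phi := (test r k kb a lo hi : Cn R n -> R[i]).

Lemma beta_ge0 z : 0 <= beta kb lo hi z.
Proof. by apply: prodr_ge0 => i _; exact: bump_ge0. Qed.

Lemma beta_le1 z : beta kb lo hi z <= 1.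
Proof. by apply: prodr_ile1 => i _; rewrite bump_ge0//= bump_le1. Qed.

Lemma beta_supp z : ~ box lo hi z -> beta kb lo hi z = 0.
Proof.
move=> nb; have [i /negP hi_] : exists i, ~ (lo i < coordinate i z < hi i).
  by apply/existsNP => h; apply: nb => i; exact: h.
by rewrite /beta (bigD1 i)//= bump_supp ?mul0r.
Qed.

Lemma measurable_beta : measurable_fun setT (beta kb lo hi : Cn R m -> R).
Proof.
rewrite /beta; elim: (index_enum _) => [|i s IH].
  by under eq_fun do rewrite big_nil; exact: measurable_cst.
under eq_fun do rewrite big_cons; apply: measurable_funM => //.
by apply: measurable_bump => //; exact: measurable_coordinate.
Qed.

(** A sum serves as a common bound instead of a maximum, which also covers [m = 0], where there are
    no indices. *)
Definition support_radius : R := r + \sum_i (`|lo i| + `|hi i|).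

Lemma box_radius z : box lo hi z -> forall i, `|coordinate i z| <= support_radius.
Proof.
move=> bz i; have /andP[h1 h2] := bz i.
have h : `|coordinate i z| <= `|lo i| + `|hi i|.
  rewrite ler_norml; apply/andP; split.
    by apply: le_trans (ltW h1); have := ler_norm (- lo i); rewrite normrN;
      have := normr_ge0 (hi i); lra.
  by apply: le_trans (ltW h2) _; have := ler_norm (hi i); have := normr_ge0 (lo i); lra.
apply: le_trans h _; rewrite /support_radius (bigD1 i)//= addrCA lerDl.
by rewrite addr_ge0 ?(ltW r0)// sumr_ge0// => j _; rewrite addr_ge0.
Qed.

Lemma slice_radius p : `|p.1.1 : R| < r -> `|p.1.2 : R| < r -> box lo hi p.2 ->
  ccube support_radius (slice p).
Proof.
move=> h1 h2 h3.
have rr : r <= support_radius.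
  by rewrite lerDl sumr_ge0// => j _; rewrite addr_ge0.
move=> [i|i].
  have [j ->|->] := unliftP ord0 i; last by rewrite coordinate_slice0l (le_trans (ltW h1)).
  by rewrite (coordinate_sliceS _ (inl j)) box_radius.
have [j ->|->] := unliftP ord0 i; last by rewrite coordinate_slice0r (le_trans (ltW h2)).
by rewrite (coordinate_sliceS _ (inr j)) box_radius.
Qed.

Lemma notin_support p : ~ ccube support_radius (slice p) ->
  (r <= `|p.1.1 : R|) || (r <= `|p.1.2 : R|) \/ beta kb lo hi p.2 = 0.
Proof.
move=> nc; have [h1|h1] := leP r `|p.1.1 : R|; first by left; apply/orP; left.
have [h2|h2] := leP r `|p.1.2 : R|; first by left; apply/orP; right.
by right; apply: beta_supp => h3; apply: nc; exact: slice_radius.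
Qed.

Lemma test_supp z : ~ ccube support_radius z -> phi z = 0.
Proof.
rewrite -(unsliceK z) => /notin_support; rewrite test_slice//.
by move=> [/(chi_supp r0) ->|->]; rewrite ?mulr0 ?mul0r.
Qed.

Lemma test_is_test_function : test_function phi.
Proof.
split.
- by have := smooth_ev (wf_test_re r k a lo hi kb0).
- by have := smooth_ev (wf_test_im r k a lo hi kb0).
- apply: (subclosed_compact _ (@compact_ccube _ _ support_radius)).
    exact: closed_closure.
  have cl : closed (ccube support_radius : set (Cn R n)).
    by apply: compact_closed; [exact: norm_hausdorff|exact: (@compact_ccube _ _ support_radius)].
  rewrite ((closure_id _).1 cl); apply: closureS => z /= /eqP nz.
  by apply: contrapT => /test_supp.
Qed.

End test_function_slices.

(** * Removing the cut-off *)

Section slice_integrals.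
Context {R : realType} {m : nat}.
Notation nu := (@slice_measure R m).
Notation T := (plane R * Cn R m)%type.
Implicit Types (p : T) (a : plane R) (lo hi : 'I_m + 'I_m -> R).

Lemma measurable_p11 : measurable_fun setT (fun p : T => p.1.1 : R).
Proof. exact: (measurableT_comp measurable_fst measurable_fst). Qed.

Lemma measurable_p12 : measurable_fun setT (fun p : T => p.1.2 : R).
Proof. exact: (measurableT_comp measurable_snd measurable_fst). Qed.

Lemma measurable_sub_p11 (c : R) : measurable_fun setT (fun p : T => c - (p.1.1 : R)).
Proof.
by apply: measurable_funB; [exact: measurable_cst|exact: measurable_p11].
Qed.

Lemma measurable_sub_p12 (c : R) : measurable_fun setT (fun p : T => c - (p.1.2 : R)).
Proof.
by apply: measurable_funB; [exact: measurable_cst|exact: measurable_p12].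
Qed.

(** The profiles as functions of a sliced point: [kk] and [mm] are centred at the pole [a], while
    [cc] and [dcc] are centred at the origin. *)
Definition kk (k : R) a p : R[i] := kker k ((a.1 : R) - (p.1.1 : R)) ((a.2 : R) - (p.1.2 : R)).
Definition mm (k : R) a p : R := mker k ((a.1 : R) - (p.1.1 : R)) ((a.2 : R) - (p.1.2 : R)).
Definition cc (r : R) p : R := chi r p.1.1 p.1.2.
Definition dcc (r : R) p : R[i] := dchi r p.1.1 p.1.2.

Lemma cmeas_kk k a : cmeas (kk k a).
Proof. by apply: cmeas_kker; [exact: measurable_sub_p11|exact: measurable_sub_p12]. Qed.

Lemma measurable_mm k a : measurable_fun setT (mm k a).
Proof. by apply: measurable_mker; [exact: measurable_sub_p11|exact: measurable_sub_p12]. Qed.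

Lemma measurable_cc r : measurable_fun setT (cc r).
Proof. by apply: measurable_chi; [exact: measurable_p11|exact: measurable_p12]. Qed.

Lemma cmeas_dcc r : cmeas (dcc r).
Proof. by apply: cmeas_dchi; [exact: measurable_p11|exact: measurable_p12]. Qed.

Lemma measurable_bb kb lo hi : 0 <= kb ->
  measurable_fun setT (fun p : T => beta kb lo hi p.2).
Proof.
by move=> kb0; exact: (measurableT_comp (measurable_beta lo hi kb0) measurable_snd).
Qed.

Definition cut (M : R) p : R := \1_(ccube M) (slice p).

(** [U] is known to be integrable on cubes only, so each integrand must carry a bounded factor that
    vanishes off a cube. *)
Lemma cintble_local (U B : T -> R[i]) (M C : R) :
  cintble nu (fun p => (cut M p)%:C%C * U p) -> cmeas B ->
  (forall p, normc (B p) <= C) -> (forall p, ~ ccube M (slice p) -> B p = 0) ->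
  cintble nu (fun p => U p * B p).
Proof.
move=> Ui mB BC B0.
have -> : (fun p => U p * B p) = fun p => B p * ((cut M p)%:C%C * U p).
  apply/funext => p; rewrite /cut indicE.
  have [cp|cp] := pselect (ccube M (slice p)); first by rewrite mem_set// mul1r mulrC.
  by rewrite B0// mulr0 mul0r.
exact: (cintbleMl mB BC Ui).
Qed.

(** At [s = 1/2] the bound on the mass of [1/|w|] over a square of radius [r] is linear in [r],
    which exactly balances the gradient O(1/r) of the cut-off. *)
Lemma pole_mass_half (r : R) : 0 < r -> pole_mass 2^-1 r ^+ 2 = 16 * r.
Proof.
move=> r0; rewrite /pole_mass; have -> : 1 - 2^-1 = 2^-1 :> R by field.
by rewrite invrK powR12_sqrt ?(ltW r0)// !exprMn sqr_sqrtr ?(ltW r0)//; ring.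
Qed.

(** The square of radius [r] about the origin lies in the square of radius [r + |a.1| + |a.2|] about
    the pole, where the linear bound on the kernel mass applies. *)
Lemma integral_kk_square k a (r : R) (B : set (Cn R m)) : k != 0 -> 0 < r ->
  measurable B -> (Cn_measure m B < +oo)%E ->
  (\int[nu]_p (\1_B p.2 * (\1_(square (0%R, 0%R) r) p.1 * normc (kk k a p)))%:E <=
   (16 * (r + (`|a.1 : R| + `|a.2 : R|)) * fine (Cn_measure m B))%:E)%E.
Proof.
move=> k0 r0 mB Boo; set na := `|_| + `|_|.
have na0 : 0 <= na by rewrite addr_ge0.
have rna : 0 < r + na by rewrite ltr_wpDr.
pose f (z : plane R) : R := \1_(square a (r + na)) z *
  normc (complex_of z - complex_of a)^-1 `^ (2 * 2^-1).
have f0 z : 0 <= f z by rewrite mulr_ge0 ?powR_ge0.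
have mf : measurable_fun setT f.
  apply: measurable_funM; first by apply: measurable_indic; exact: measurable_square.
  apply: (measurableT_comp (measurable_powR _)); apply: measurable_normc.
  exact: cmeas_kernel_at.
have mI : measurable_fun setT (\1_B : Cn R m -> R) by exact: measurable_indic.
have mI2 : measurable_fun setT (fun p : T => \1_B p.2 : R).
  exact: (measurableT_comp mI measurable_snd).
have mf1 : measurable_fun setT (fun p : T => f p.1).
  exact: (measurableT_comp mf measurable_fst).
apply: (@le_trans _ _ (\int[nu]_p (\1_B p.2 * f p.1)%:E)%E).
  apply: ge0_le_integral => //.
  - by move=> p _; rewrite lee_fin !mulr_ge0 ?normc_ge0.
  - apply/measurable_EFinP; apply: measurable_funM => //; apply: measurable_funM.
      apply: (measurableT_comp _ measurable_fst).
      by apply: measurable_indic; exact: measurable_square.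
    by apply: measurable_normc; exact: cmeas_kk.
  - by apply/measurable_EFinP; exact: measurable_funM.
  - move=> p _; rewrite lee_fin ler_wpM2l//.
    rewrite /f indicE; have [sp|sp] := pselect (square (0, 0) r p.1); last first.
      by rewrite memNset// mul0r f0.
    rewrite mem_set// mul1r indicE mem_set; last first.
      case: sp; rewrite /= !in_itv /= !sub0r !add0r -!ler_norml => h1 h2.
      rewrite /square /= !in_itv /= -!ler_distl; split.
        apply: le_trans (ler_normB _ _) _; rewrite lerD//.
        by rewrite /na lerDl.
      apply: le_trans (ler_normB _ _) _; rewrite lerD//.
      by rewrite /na lerDr.
    rewrite mul1r divff ?pnatr_eq0// powRr1 ?normc_ge0//.
    apply: le_trans (normc_kker_le _ _ k0) _.
    by rewrite !normcV -[complex_of _ - _]opprB normcN.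
rewrite [leLHS](fubini_tonelli1 (fun p : T => (\1_B p.2 * f p.1)%:E)); last 2 first.
- by apply/measurable_EFinP; exact: measurable_funM.
- by move=> p; rewrite lee_fin mulr_ge0.
rewrite /fubini_F /=.
have Bfin : Cn_measure m B \is a fin_num by rewrite ge0_fin_numE// measure_ge0.
have E z : (\int[Cn_measure m]_y (\1_B y * f z)%:E = (f z)%:E * Cn_measure m B)%E.
  under eq_integral do rewrite mulrC EFinM.
  rewrite ge0_integralZl//; last 2 first.
  - exact/measurable_EFinP.
  - by rewrite lee_fin.
  by rewrite integral_indic// setIT.
under eq_integral do rewrite E.
rewrite ge0_integralZr//; last 2 first.
- exact/measurable_EFinP.
- by move=> z _; rewrite lee_fin.
rewrite EFinM fineK// lee_wpmul2r//.
rewrite -pole_mass_half//; apply: integral_kernel_square => //; lra.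
Qed.

End slice_integrals.

Section cutoff_limit.
Context {R : realType} {m : nat}.
Notation nu := (@slice_measure R m).
Notation T := (plane R * Cn R m)%type.
Implicit Types p : T.

Definition pole_norm (a : plane R) : R := `|a.1 : R| + `|a.2 : R|.

Lemma mm_supp (k : R) a p : 0 < k ->
  (pole_norm a + k^-1 <= `|p.1.1 : R|) || (pole_norm a + k^-1 <= `|p.1.2 : R|) ->
  mm k a p = 0.
Proof.
have h (c x n : R) : 0 < k -> `|c| <= n -> n + k^-1 <= `|x| -> 1 <= k * (c - x) * (k * (c - x)).
  move=> k0 cn nx; have : k^-1 <= `|c - x|.
    rewrite -normrN opprB; apply: le_trans (lerB_dist _ _); lra.
  move=> h1; have {}h1 : 1 <= k * `|c - x|.
    by rewrite -(mulfV (lt0r_neq0 k0)) ler_pM2l.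
  by rewrite -expr2 -(real_normK (num_real _)) normrM gtr0_norm// exprn_ege1.
move=> k0 /orP[] hx; rewrite /mm mker_supp//.
  by rewrite ler_wpDr -?expr2 ?sqr_ge0// expr2; apply: h hx => //; rewrite lerDl.
by rewrite ler_wpDl -?expr2 ?sqr_ge0// expr2; apply: h hx => //; rewrite lerDr.
Qed.

(** [U] and [g] stand for [u] and [V_1 u] in slice coordinates; [weak] is the equation tested with
    cut-off radius [r]. *)
Variables (U g : T -> R[i]) (a : plane R) (k kb : R) (lo hi : 'I_m + 'I_m -> R).
Hypotheses (k0 : 0 < k) (kb0 : 0 <= kb).
Hypothesis UL : forall M, cintble nu (fun p => (cut M p)%:C%C * U p).
Hypothesis Uoo : forall del : R, 0 < del -> exists M,
  {ae nu, forall p, ~ ccube M (slice p) -> normc (U p) <= del}.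
Hypothesis gi : cintble nu g.
Let b p : R := beta kb lo hi p.2.
Hypothesis weak : forall r : R, 0 < r ->
  cint nu (fun p => U p * ((b p)%:C%C * (dcc r p * kk k a p - (cc r p * mm k a p)%:C%C))) =
  - cint nu (fun p => g p * ((cc r p * b p)%:C%C * kk k a p)).

Let b_ge0 p : 0 <= b p. Proof. exact: beta_ge0. Qed.
Let b_le1 p : b p <= 1. Proof. exact: beta_le1. Qed.
Let mb : measurable_fun setT b. Proof. exact: measurable_bb. Qed.
Let kn0 : k != 0. Proof. by rewrite gt_eqF. Qed.

Let C1 : R := sval (cid2 (@dchi_bounded R)).
Let C10 : 0 <= C1. Proof. by rewrite /C1; case: cid2. Qed.
Let C1P r p : 0 < r -> normc (dcc r p) <= C1 / r.
Proof. by rewrite /C1; case: cid2 => C /= _ h r0; exact: h. Qed.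
Let C2 : R := sval (cid2 (kker_bounded k)).
Let C20 : 0 <= C2. Proof. by rewrite /C2; case: cid2. Qed.
Let C2P p : normc (kk k a p) <= C2.
Proof. by rewrite /C2; case: cid2 => C /= _ h; exact: h. Qed.
Let C3 : R := sval (cid2 (@chi_bounded R)).
Let C30 : 0 <= C3. Proof. by rewrite /C3; case: cid2. Qed.
Let C3P r p : cc r p <= C3.
Proof. by rewrite /C3; case: cid2 => C /= _ h; exact: h. Qed.
Let C4 : R := sval (cid2 (mker_bounded k)).
Let C40 : 0 <= C4. Proof. by rewrite /C4; case: cid2. Qed.
Let C4P p : mm k a p <= C4.
Proof. by rewrite /C4; case: cid2 => C /= _ h; exact: h. Qed.
Let mm0 p : 0 <= mm k a p. Proof. exact: mker_ge0. Qed.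
Let cc0 r p : 0 <= cc r p. Proof. exact: chi_ge0. Qed.

Let bmm p : R[i] := (b p * mm k a p)%:C%C.
Let mbmm : cmeas bmm.
Proof. by apply: cmeas_real; apply: measurable_funM => //; exact: measurable_mm. Qed.

Let bmm_le p : normc (bmm p) <= C4.
Proof.
rewrite normc_real ger0_norm; last exact: mulr_ge0 (b_ge0 p) (mm0 p).
rewrite -[leRHS]mul1r; apply: ler_pM; [exact: b_ge0|exact: mm0|exact: b_le1|exact: C4P].
Qed.

Let bmm_supp p : ~ ccube (support_radius (pole_norm a + k^-1) lo hi) (slice p) -> bmm p = 0.
Proof.
have r0 : 0 < pole_norm a + k^-1 by rewrite ltr_wpDl ?invr_gt0// addr_ge0.
rewrite /bmm => /(notin_support kb r0)[/(mm_supp k0) ->|]; rewrite ?mulr0//.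
by rewrite /b => ->; rewrite mul0r.
Qed.

Let Ubmm_i : cintble nu (fun p => U p * bmm p).
Proof. exact: (cintble_local (UL _) mbmm bmm_le bmm_supp). Qed.

Let Ucbmm_i r : cintble nu (fun p => U p * ((cc r p)%:C%C * bmm p)).
Proof.
have -> : (fun p => U p * ((cc r p)%:C%C * bmm p)) = fun p => (cc r p)%:C%C * (U p * bmm p).
  by apply/funext => p; rewrite mulrCA.
apply: (@cintbleMl _ _ _ _ _ C3) => //; first by apply: cmeas_real; exact: measurable_cc.
by move=> p; rewrite normc_real ger0_norm.
Qed.

Let bdk r p : R[i] := (b p)%:C%C * (dcc r p * kk k a p).

Let mbdk r : cmeas (bdk r).
Proof.
apply: cmeasM; first exact: cmeas_real.
by apply: cmeasM; [exact: cmeas_dcc|exact: cmeas_kk].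
Qed.

Let bdk_le r p : 0 < r -> normc (bdk r p) <= C1 / r * C2.
Proof.
move=> r0; rewrite normcM normc_real ger0_norm// normcM -[leRHS]mul1r.
apply: ler_pM => //; first by rewrite mulr_ge0 ?normc_ge0.
by apply: ler_pM; rewrite ?normc_ge0// C1P.
Qed.

Let bdk_supp r p : 0 < r -> ~ ccube (support_radius r lo hi) (slice p) -> bdk r p = 0.
Proof.
move=> r0 /(notin_support kb r0)[/(dchi_supp r0) h|h]; rewrite /bdk.
  by rewrite /dcc h mul0r mulr0.
by rewrite /b h mul0r.
Qed.

Let Ubdk_i r : 0 < r -> cintble nu (fun p => U p * bdk r p).
Proof.
move=> r0; apply: (cintble_local (UL _) (mbdk r)) => p.
  exact: bdk_le.
exact: bdk_supp.
Qed.

Let gcbk r p : R[i] := g p * ((cc r p * b p)%:C%C * kk k a p).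
Let gbk p : R[i] := g p * ((b p)%:C%C * kk k a p).

Let weak_split r : 0 < r ->
  cint nu (fun p => U p * ((cc r p)%:C%C * bmm p)) =
  cint nu (fun p => U p * bdk r p) + cint nu (gcbk r).
Proof.
move=> r0; have h : cint nu (fun p => U p * bdk r p) -
    cint nu (fun p => U p * ((cc r p)%:C%C * bmm p)) = - cint nu (gcbk r).
  rewrite -cint_sub; [|exact: Ubdk_i|exact: Ucbmm_i].
  rewrite /gcbk -weak//; congr cint; apply/funext => p.
  by rewrite /bdk /bmm !rmorphM /=; ring.
by rewrite -[cint nu (gcbk r)]opprK -h opprB addrC subrK.
Qed.

Let gbk_i : cintble nu gbk.
Proof.
have -> : gbk = fun p => ((b p)%:C%C * kk k a p) * g p.
  by apply/funext => p; rewrite /gbk mulrC.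
apply: (@cintbleMl _ _ _ _ _ C2) => //.
  by apply: cmeasM; [exact: cmeas_real|exact: cmeas_kk].
move=> p; rewrite normcM normc_real ger0_norm// -[leRHS]mul1r.
by rewrite ler_pM ?normc_ge0.
Qed.

Let cut_cvg p : (fun j : nat => normc ((cc j.+1%:R p)%:C%C - 1)) @ \oo --> (0 : R).
Proof.
have : (fun j : nat => `|cc j.+1%:R p - 1|) @ \oo --> `|(1 : R) - 1|.
  by apply: cvg_norm; apply: cvgB; [exact: chi_cvg|exact: cvg_cst].
rewrite subrr normr0 (_ : (fun j : nat => normc _) = fun j : nat => `|cc j.+1%:R p - 1|)//.
by apply/funext => j; rewrite -normc_real rmorphB.
Qed.

Let dominated_cut (f : T -> R[i]) : cintble nu f ->
  (fun j : nat => normc (cint nu (fun p => (cc j.+1%:R p)%:C%C * f p) - cint nu f)) @ \oo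
    --> (0 : R).
Proof.
move=> fi.
have [] // := @cint_dominated _ _ _ nu (fun j p => (cc j.+1%:R p)%:C%C * f p) f
  (fun p => C3 * normc (f p)).
- by move=> j; apply: cmeasM; [apply: cmeas_real; exact: measurable_cc|exact: fi.1].
- exact: fi.1.
- apply: aeW => p.
  have -> : (fun j : nat => normc ((cc j.+1%:R p)%:C%C * f p - f p)) =
      fun j : nat => normc ((cc j.+1%:R p)%:C%C - 1) * normc (f p).
    by apply/funext => j; rewrite -normcM mulrBl mul1r.
  by rewrite -(mul0r (normc (f p))); apply: cvgMl.
- exact: integrable_scale (cintble_norm fi).
- apply: aeW => p j; rewrite normcM normc_real ger0_norm//.
  by rewrite ler_wpM2r ?normc_ge0.
Qed.

Let boxm : measurable (box lo hi : set (Cn R m)). Proof. exact: measurable_box. Qed.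
Let boxoo : (Cn_measure m (box lo hi) < +oo)%E. Proof. exact: lebesgue_box_lty. Qed.
Let Bv := fine (Cn_measure m (box lo hi)).
Let Bv0 : 0 <= Bv. Proof. by rewrite fine_ge0// measure_ge0. Qed.

Let na := pole_norm a.
Let na0 : 0 <= na. Proof. by rewrite addr_ge0. Qed.

(** Split at the cube of radius [M]. Inside, the integrand is at most [C1 C2 / r] times [|U|], which
    tends to 0 with 1/r. Outside, [|U| <= del], and the gradient bound [C1 / r] meets the kernel
    mass [16 (r + na) Bv]; as [r >= 1], their product stays below [C1 * 16 (1 + na) Bv]. *)
Let bdk_bound (del M : R) (j : nat) : 0 < del ->
  {ae nu, forall p, ~ ccube M (slice p) -> normc (U p) <= del} ->
  (\int[nu]_p (normc (U p * bdk j.+1%:R p))%:E <=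
   ((C1 * C2 * fine (\int[nu]_p (normc ((cut M p)%:C%C * U p))%:E)%E) / j.+1%:R +
    del * C1 * (16 * (1 + na) * Bv))%:E)%E.
Proof.
move=> del0 Udel; set r : R := j.+1%:R; have r0 : 0 < r by rewrite ltr0n.
pose A1 p := C1 / r * C2 * normc ((cut M p)%:C%C * U p).
pose A2 p := del * (C1 / r) *
  (\1_(box lo hi) p.2 * (\1_(square (0, 0) r) p.1 * normc (kk k a p))).
have C1r : 0 <= C1 / r by rewrite divr_ge0// ltW.
have A10 p : 0 <= A1 p by rewrite mulr_ge0 ?normc_ge0// mulr_ge0.
have A20 p : 0 <= A2 p.
  by rewrite mulr_ge0 ?(mulr_ge0 (ltW del0))// mulr_ge0// mulr_ge0 ?normc_ge0.
have mA1' : measurable_fun setT (fun p => normc ((cut M p)%:C%C * U p)).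
  exact: measurable_normc (UL M).1.
have mA1 : measurable_fun setT A1 by apply: measurable_funM => //; exact: measurable_cst.
have mA2' : measurable_fun setT (fun p : T =>
    \1_(box lo hi) p.2 * (\1_(square (0 : R, 0 : R) r) p.1 * normc (kk k a p)) : R).
  apply: measurable_funM.
    by apply: (measurableT_comp _ measurable_snd); exact: measurable_indic.
  apply: measurable_funM; last by apply: measurable_normc; exact: cmeas_kk.
  apply: (measurableT_comp _ measurable_fst).
  by apply: measurable_indic; exact: measurable_square.
have mA2 : measurable_fun setT A2 by apply: measurable_funM => //; exact: measurable_cst.
apply: (@le_trans _ _ (\int[nu]_p ((A1 p)%:E + (A2 p)%:E))%E).
  apply: ae_ge0_le_integral => //.
  - by move=> p _; rewrite lee_fin normc_ge0.
  - by apply/measurable_EFinP; apply: measurable_normc; exact: (Ubdk_i r0).1.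
  - by move=> p _; rewrite -EFinD lee_fin addr_ge0.
  - by apply: emeasurable_funD; exact/measurable_EFinP.
  - apply: filterS Udel => p Udp _; rewrite -EFinD lee_fin normcM.
    have [cp|cp] := pselect (ccube M (slice p)).
      apply: (@le_trans _ _ (A1 p)); last by rewrite lerDl.
      by rewrite /A1 /cut indicE mem_set// mul1r mulrC ler_wpM2r ?normc_ge0// bdk_le.
    apply: (@le_trans _ _ (A2 p)); last by rewrite lerDr.
    have [b0|b0] := eqVneq (bdk r p) 0; first by rewrite b0 normc0 mulr0.
    have box2 : box lo hi p.2.
      apply: contrapT => nb; move/eqP: b0; apply; rewrite /bdk.
      by rewrite /b (beta_supp kb nb) mul0r.
    have sq1 : square (0, 0) r p.1.
      have dn0 : ~~ ((r <= `|p.1.1 : R|) || (r <= `|p.1.2 : R|)).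
        apply/negP => /(dchi_supp r0) h; move/eqP: b0; apply.
        by rewrite /bdk /dcc h mul0r mulr0.
      move: dn0; rewrite negb_or -!ltNge => /andP[h1 h2].
      by split; rewrite /= in_itv /= sub0r add0r -ler_norml ltW.
    rewrite /A2 !indicE !mem_set// !mul1r -mulrA.
    apply: ler_pM; rewrite ?normc_ge0//; first exact: Udp.
    rewrite /bdk normcM normc_real ger0_norm// normcM -[leRHS]mul1r.
    apply: ler_pM => //; first by rewrite mulr_ge0 ?normc_ge0.
    by rewrite ler_wpM2r ?normc_ge0// C1P.
rewrite ge0_integralD//; last 4 first.
- by move=> p _; rewrite lee_fin.
- exact/measurable_EFinP.
- by move=> p _; rewrite lee_fin.
- exact/measurable_EFinP.
rewrite EFinD; apply: leeD.
  rewrite /A1; under eq_integral do rewrite EFinM.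
  rewrite ge0_integralZl//; last 3 first.
  - exact/measurable_EFinP.
  - by move=> p _; rewrite lee_fin normc_ge0.
  - by rewrite lee_fin mulr_ge0.
  have fin1 : (\int[nu]_p (normc ((cut M p)%:C%C * U p))%:E)%E \is a fin_num.
    rewrite ge0_fin_numE; first exact: (UL M).2.
    by apply: integral_ge0 => p _; rewrite lee_fin normc_ge0.
  rewrite -[X in (_ * X)%E](fineK fin1) -EFinM lee_fin.
  by rewrite le_eqVlt; apply/orP; left; apply/eqP; ring.
rewrite /A2; under eq_integral do rewrite EFinM.
rewrite ge0_integralZl//; last 3 first.
- exact/measurable_EFinP.
- by move=> p _; rewrite lee_fin mulr_ge0// mulr_ge0 ?normc_ge0.
- by rewrite lee_fin mulr_ge0// ltW.
apply: le_trans (lee_wpmul2l _ (integral_kk_square a kn0 r0 boxm boxoo)) _.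
  by rewrite lee_fin mulr_ge0// ltW.
rewrite -EFinM lee_fin -/na -/Bv -!mulrA ler_wpM2l ?(ltW del0)// ler_wpM2l//.
have -> : r^-1 * (16 * ((r + na) * Bv)) = 16 * (((r + na) / r) * Bv) by ring.
rewrite ler_wpM2l// ler_wpM2r// ler_pdivrMr// mulrDl mul1r lerD2l.
by rewrite ler_peMr// ler1n.
Qed.

(* On the support of the cut-off error its gradient is O(1/r), the kernel has
   mass O(r), and u is small outside a fixed cube. *)
Let bdk_cvg : (fun j : nat => normc (cint nu (fun p => U p * bdk j.+1%:R p))) @ \oo
    --> (0 : R).
Proof.
set K2 := C1 * (16 * (1 + na) * Bv).
have K20 : 0 <= K2 by rewrite !mulr_ge0// addr_ge0.
apply/cvgrPdist_le => e e0.
(* The 4 covers the factor 2 of [normc_cint_le] and the two summands of [bdk_bound]; the added 1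
   keeps the denominator positive when [K2 = 0]. *)
pose del := e / (4 * (K2 + 1)).
have K21 : 0 < 4 * (K2 + 1) by rewrite mulr_gt0// ltr_wpDl.
have del0 : 0 < del by rewrite divr_gt0.
have [M UM] := Uoo del0.
set K1 := C1 * C2 * fine (\int[nu]_p (normc ((cut M p)%:C%C * U p))%:E)%E.
have K10 : 0 <= K1.
  rewrite !mulr_ge0// fine_ge0//; apply: integral_ge0 => p _.
  by rewrite lee_fin normc_ge0.
near=> j; rewrite sub0r normrN ger0_norm ?normc_ge0//.
have j0 : 0 < j.+1%:R :> R by rewrite ltr0n.
rewrite -lee_fin; apply: le_trans (normc_cint_le (Ubdk_i j0)) _.
apply: le_trans (lee_wpmul2l _ (bdk_bound j del0 UM)) _ => //.
rewrite -EFinM lee_fin -/K1 -mulrA -/K2.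
have h1 : K1 / j.+1%:R <= e / 4.
  rewrite ler_pdivrMr//.
  have : K1 / (e / 4) <= j%:R by near: j; exact: nbhs_infty_ger.
  rewrite ler_pdivrMr ?divr_gt0// => /le_trans; apply.
  by rewrite mulrC ler_wpM2l ?divr_ge0 ?(ltW e0)// ler_nat.
have h2 : del * K2 <= e / 4.
  rewrite /del mulrAC ler_pdivrMr//.
  have -> : (e / 4) * (4 * (K2 + 1)) = e * K2 + e by field.
  by rewrite lerDl ltW.
have -> : e = 2 * (e / 4 + e / 4) by field.
by rewrite ler_wpM2l// lerD.
Unshelve. all: by end_near. Qed.

(** Let [r = j + 1] tend to infinity in [weak_split]: the terms with [mm] and with [g] converge by
    domination, and the gradient term vanishes by [bdk_cvg]. *)
Lemma cutoff_limit :
  cint nu (fun p => U p * (beta kb lo hi p.2 * mm k a p)%:C%C) =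
  cint nu (fun p => g p * ((beta kb lo hi p.2)%:C%C * kk k a p)).
Proof.
have c1 := dominated_cut Ubmm_i; have c2 := dominated_cut gbk_i.
apply/eqP; rewrite -subr_eq0 -normc0_eq0; apply/eqP.
set A := cint nu _; set B := cint nu _.
have cB : (fun j : nat =>
    normc (cint nu (fun p => (cc j.+1%:R p)%:C%C * (U p * bmm p)) - A) +
    normc (cint nu (fun p => U p * bdk j.+1%:R p)) +
    normc (cint nu (fun p => (cc j.+1%:R p)%:C%C * gbk p) - B)) @ \oo --> (0 + 0 + 0 : R).
  by apply: cvgD => //; apply: cvgD.
apply/eqP; rewrite eq_le normc_ge0 andbT.
rewrite !addr0 in cB; apply: (ler_cvg_to (cvg_cst _) cB); apply: nearW => j.
have j0 : 0 < j.+1%:R :> R by rewrite ltr0n.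
have := weak_split j0.
have -> : (fun p => U p * ((cc j.+1%:R p)%:C%C * bmm p)) =
    fun p => (cc j.+1%:R p)%:C%C * (U p * bmm p) by apply/funext => p; rewrite mulrCA.
have -> : gcbk j.+1%:R = fun p => (cc j.+1%:R p)%:C%C * gbk p.
  by apply/funext => p; rewrite /gcbk /gbk rmorphM /=; ring.
set X := cint nu _; set Y := cint nu _; set V := cint nu _ => XYV.
have -> : A - B = - (X - A) + Y + (V - B) by rewrite XYV; ring.
apply: le_trans (le_normcD _ _) _; rewrite lerD2r.
by apply: le_trans (le_normcD _ _) _; rewrite normcN.
Qed.

End cutoff_limit.

Section weighted_limits.
Context d (T : measurableType d) (R : realType) (mu : {measure set T -> \bar R}).

Lemma cint_weight_cvg (s : nat -> T -> R) (s' : T -> R) (f : T -> R[i]) :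
  (forall j, measurable_fun setT (s j)) -> measurable_fun setT s' ->
  (forall j x, 0 <= s j x <= 1) -> (forall x, (fun j => s j x) @ \oo --> s' x) ->
  cintble mu f ->
  (fun j => normc (cint mu (fun x => (s j x)%:C%C * f x) -
                   cint mu (fun x => (s' x)%:C%C * f x))) @ \oo --> (0 : R).
Proof.
move=> ms ms' s01 ss' fi.
have [] // := @cint_dominated _ _ _ mu (fun j x => (s j x)%:C%C * f x)
  (fun x => (s' x)%:C%C * f x) (fun x => normc (f x)).
- by move=> j; apply: cmeasM; [exact: cmeas_real|exact: fi.1].
- by apply: cmeasM; [exact: cmeas_real|exact: fi.1].
- apply: aeW => x.
  have -> : (fun j : nat => normc ((s j x)%:C%C * f x - (s' x)%:C%C * f x)) =
      fun j : nat => `|s j x - s' x| * normc (f x).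
    by apply/funext => j; rewrite -normc_real -normcM rmorphB mulrBl.
  rewrite -(mul0r (normc (f x))); apply: cvgMl.
  rewrite -(normr0 R) -(subrr (s' x)); apply: cvg_norm.
  by apply: cvgB; [exact: ss'|exact: cvg_cst].
- exact: cintble_norm fi.
- apply: aeW => x j; have /andP[s0 s1] := s01 j x.
  by rewrite normcM normc_real ger0_norm// ler_piMl ?normc_ge0.
Qed.

(** Uniqueness of limits in the form needed when convergence in [R[i]] is expressed by the
    modulus. *)
Lemma normc_cvg_unique (X Y : nat -> R[i]) (x y : R[i]) : X = Y ->
  (fun j => normc (X j - x)) @ \oo --> (0 : R) ->
  (fun j => normc (Y j - y)) @ \oo --> (0 : R) -> x = y.
Proof.
move=> <- Xx Xy; apply/eqP; rewrite -subr_eq0 -normc0_eq0 eq_le normc_ge0 andbT.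
have h : (fun j => normc (X j - x) + normc (X j - y)) @ \oo --> (0 + 0 : R) by exact: cvgD.
rewrite addr0 in h.
apply: (ler_cvg_to (cvg_cst _) h); apply: nearW => j /=.
have -> : x - y = - (X j - x) + (X j - y) by ring.
by apply: le_trans (le_normcD _ _) _; rewrite normcN.
Qed.

End weighted_limits.

(** * From the weak equation to an identity on boxes in z' *)

Section box_identity.
Context {R : realType} {m : nat}.
Notation nu := (@slice_measure R m).
Notation mu := (lebesgue_Cn R m.+1).
Notation T := (plane R * Cn R m)%type.
Implicit Types p : T.

Variables (u v : Cn R m.+1 -> R[i]).
Hypothesis hu : in_L2loc u.
Hypothesis vi : cintble mu v.
Hypothesis uv : weak_dbar ord0 u v.
Hypothesis uoo : forall del : R, 0 < del -> exists M,
  {ae mu, forall z, ~ ccube M z -> normc (u z) <= del}.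
Let U p := u (slice p).
Let g p := v (slice p).

Let gi : cintble nu g.
Proof. by have /cintble_slice := vi. Qed.

Lemma cintble_cut_slice M : cintble nu (fun p => (cut M p)%:C%C * U p).
Proof. by have /cintble_slice := in_L2loc_cintble M hu. Qed.

Lemma weak_slice (r k kb : R) a (lo hi : 'I_m + 'I_m -> R) : 0 < r -> 0 <= kb ->
  cint nu (fun p => U p * ((beta kb lo hi p.2)%:C%C *
    (dcc r p * kk k a p - (cc r p * mm k a p)%:C%C))) =
  - cint nu (fun p => g p * ((cc r p * beta kb lo hi p.2)%:C%C * kk k a p)).
Proof.
move=> r0 kb0; have h := uv (test_is_test_function k a lo hi r0 kb0).
set B := fun p => (beta kb lo hi p.2)%:C%C *
  (dcc r p * kk k a p - (cc r p * mm k a p)%:C%C).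
have [C1 C10 hC1] := @dchi_bounded R; have [C2 C20 hC2] := kker_bounded k.
have [C3 C30 hC3] := @chi_bounded R; have [C4 C40 hC4] := mker_bounded k.
have mb : measurable_fun setT (fun p : T => beta kb lo hi p.2) by exact: measurable_bb.
have b01 p : 0 <= beta kb lo hi p.2 <= 1 by rewrite beta_ge0//= beta_le1.
have cm01 p : 0 <= cc r p * mm k a p <= C3 * C4.
  apply/andP; split; first by apply: mulr_ge0; [exact: chi_ge0|exact: mker_ge0].
  by apply: ler_pM; [exact: chi_ge0|exact: mker_ge0|exact: hC3|exact: hC4].
have Bi : cintble nu (fun p => U p * B p).
  apply: (@cintble_local _ _ _ _ (support_radius r lo hi) (C1 / r * C2 + C3 * C4)).
  - exact: cintble_cut_slice.
  - apply: cmeasM; first exact: cmeas_real.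
    apply: cmeasB; first by apply: cmeasM; [exact: cmeas_dcc|exact: cmeas_kk].
    by apply: cmeas_real; apply: measurable_funM; [exact: measurable_cc|exact: measurable_mm].
  - move=> p; have /andP[b0 b1] := b01 p; have /andP[c0 c1] := cm01 p.
    rewrite /B normcM normc_real ger0_norm//.
    apply: (@le_trans _ _ (normc (dcc r p * kk k a p - (cc r p * mm k a p)%:C%C))).
      by rewrite ler_piMl ?normc_ge0.
    apply: le_trans (le_normcD _ _) _; rewrite normcN normc_real ger0_norm// lerD//.
    by rewrite normcM; apply: ler_pM; rewrite ?normc_ge0 ?hC1 ?hC2.
  - move=> p /(notin_support kb r0)[hr|hb]; last by rewrite /B hb mul0r.
    by rewrite /B /dcc /cc (dchi_supp r0 hr) (chi_supp r0 hr) !mul0r subrr mulr0.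
have E1 : (fun z => u z * dbar ord0 (test r k kb a lo hi) z) \o @slice R m =
    fun p => U p * B p by apply/funext => p; rewrite /= dbar_test_slice.
have E2 : (fun z => v z * test r k kb a lo hi z) \o @slice R m =
    fun p => g p * ((cc r p * beta kb lo hi p.2)%:C%C * kk k a p).
  by apply/funext => p; rewrite /= test_slice.
have I1 : cintble mu (fun z => u z * dbar ord0 (test r k kb a lo hi) z).
  by apply/cintble_slice; rewrite E1.
have I2 : cintble mu (fun z => v z * test r k kb a lo hi z).
  apply/cintble_slice; rewrite E2.
  have -> : (fun p => g p * ((cc r p * beta kb lo hi p.2)%:C%C * kk k a p)) =
    fun p => ((cc r p * beta kb lo hi p.2)%:C%C * kk k a p) * g p.
    by apply/funext => p; rewrite mulrC.
  apply: (@cintbleMl _ _ _ _ _ (C3 * C2)) => //.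
    apply: cmeasM; last exact: cmeas_kk.
    by apply: cmeas_real; apply: measurable_funM => //; exact: measurable_cc.
  move=> p; have /andP[b0 b1] := b01 p.
  have c0 : 0 <= cc r p by exact: chi_ge0.
  rewrite normcM normc_real ger0_norm; last exact: mulr_ge0.
  apply: ler_pM; [exact: mulr_ge0|exact: normc_ge0| |exact: hC2].
  by rewrite -[leRHS]mulr1; apply: ler_pM => //; exact: hC3.
by have := cint_slice I1; have := cint_slice I2; rewrite E1 E2 => <- <-.
Qed.

Lemma beta_cvg (lo hi : 'I_m + 'I_m -> R) z :
  (fun j : nat => beta j%:R lo hi z) @ \oo --> (\1_(box lo hi) z : R).
Proof.
have -> : \1_(box lo hi) z = \prod_i (lo i < coordinate i z < hi i)%R%:R :> R.
  rewrite indicE; have [bz|nb] := pselect (box lo hi z).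
    by rewrite mem_set// big1// => i _; rewrite (bz i).
  rewrite memNset//; have [i /negbTE hi_] : exists i, ~~ (lo i < coordinate i z < hi i).
    by apply/not_existsP => h; apply: nb => i; apply: contrapT => /negP; exact: h.
  by rewrite (bigD1 i)//= hi_ mul0r.
rewrite /beta; elim: (index_enum _) => [|i s IH].
  by rewrite big_nil; under eq_fun do rewrite big_nil; exact: cvg_cst.
rewrite big_cons; under eq_fun do rewrite big_cons.
by apply: cvgM => //; exact: bump_cvg.
Qed.

(** Passage to the limit in the sharpness [j] of [beta]: the identity of [cutoff_limit] holds for
    every [j], and [beta] converges to the indicator of the open box with values in [[0, 1]]. *)
Lemma box_mollified_identity (k : R) a (lo hi : 'I_m + 'I_m -> R) : 0 < k ->
  cint nu (fun p => (\1_(box lo hi) p.2)%:C%C * ((mm k a p)%:C%C * U p)) =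
  cint nu (fun p => (\1_(box lo hi) p.2)%:C%C * (kk k a p * g p)).
Proof.
move=> k0.
have Uoo del : 0 < del -> exists M,
    {ae nu, forall p, ~ ccube M (slice p) -> normc (U p) <= del}.
  by move=> /uoo[M /ae_slice h]; exists M.
have mI : measurable_fun setT (fun p : T => \1_(box lo hi) p.2 : R).
  apply: (measurableT_comp _ measurable_snd).
  by apply: measurable_indic; exact: measurable_box.
have [C2 C20 hC2] := kker_bounded k; have [C4 C40 hC4] := mker_bounded k.
have mmp p : 0 <= mm k a p by exact: mker_ge0.
(* [mm k a p * U p] need not be integrable, as [z'] is unrestricted. The extra indicator of the box
   makes it so, and it is harmless because [beta] vanishes off the box and an indicator equals its
   square. *)
have Ui : cintble nu (fun p => U p * (\1_(box lo hi) p.2 * mm k a p)%:C%C).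
  have r0 : 0 < pole_norm a + k^-1 by rewrite ltr_wpDl ?invr_gt0// addr_ge0.
  apply: (cintble_local (M := support_radius (pole_norm a + k^-1) lo hi) (C := C4)).
  - exact: cintble_cut_slice.
  - by apply: cmeas_real; apply: measurable_funM => //; exact: measurable_mm.
  - move=> p; rewrite normc_real ger0_norm; last exact: mulr_ge0.
    rewrite -[leRHS]mul1r; apply: ler_pM => //; exact: hC4.
  - move=> p np.
    have [h1|h1] := leP (pole_norm a + k^-1) `|p.1.1 : R|.
      by rewrite (mm_supp (a:=a) k0) ?h1// mulr0.
    have [h2|h2] := leP (pole_norm a + k^-1) `|p.1.2 : R|.
      by rewrite (mm_supp (a:=a) k0) ?h2 ?orbT// mulr0.
    rewrite indicE memNset ?mul0r// => h3; apply: np.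
    exact: slice_radius.
have gki : cintble nu (fun p => kk k a p * g p).
  by apply: (@cintbleMl _ _ _ _ _ C2) => //; [exact: cmeas_kk|move=> p; exact: hC2].
have b01 (j : nat) p : 0 <= beta j%:R lo hi p.2 <= 1 by rewrite beta_ge0//= beta_le1.
have mb (j : nat) : measurable_fun setT (fun p : T => beta j%:R lo hi p.2).
  exact: measurable_bb.
have bc p : (fun j : nat => beta j%:R lo hi p.2) @ \oo --> (\1_(box lo hi) p.2 : R).
  exact: beta_cvg.
have c1 := cint_weight_cvg mb mI b01 bc Ui.
have c2 := cint_weight_cvg mb mI b01 bc gki.
have E1 : (fun p => (\1_(box lo hi) p.2)%:C%C * (U p * (\1_(box lo hi) p.2 * mm k a p)%:C%C))
    = fun p => (\1_(box lo hi) p.2)%:C%C * ((mm k a p)%:C%C * U p).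
  apply/funext => p; rewrite indicE; case: (_ \in _); rewrite ?mul0r// ?mul1r.
  by rewrite mulrC.
rewrite E1 in c1; apply: (normc_cvg_unique _ c1 c2); apply/funext => j.
have := cutoff_limit k0 (ler0n _ j) cintble_cut_slice Uoo gi
  (fun r r0 => weak_slice k a lo hi r0 (ler0n _ j)).
rewrite /= => h; congr (_ = _) : h; congr cint; apply/funext => p; last first.
  by rewrite mulrC mulrA.
have [bp|bp] := pselect (box lo hi p.2).
  by rewrite indicE mem_set// mul1r rmorphM /= mulrCA.
by rewrite beta_supp// !mul0r mulr0.
Qed.

End box_identity.

(** * Removing the regularization *)

Section mollifier_mass.
Context {R : realType}.
Notation mu := (@plane_measure R).
Notation leb := (@lebesgue_measure R).
Implicit Types (a z : plane R) (k : R).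

Lemma measurable_mker_at k z :
  measurable_fun setT (fun a : plane R => mker k ((a.1 : R) - (z.1 : R)) ((a.2 : R) - (z.2 : R))).
Proof.
by apply: measurable_mker; apply: measurable_funB => //; exact: measurable_cst.
Qed.

Lemma mker_rescale k x y : k != 0 -> mker k (k^-1 * x) (k^-1 * y) = k ^+ 2 * mker 1 x y.
Proof. by move=> k0; rewrite /mker !(mulVKf k0) !mul1r expr1n mul1r. Qed.

Lemma ge0_integral_affine_plane (s : R) z (f : plane R -> \bar R) : 0 < s ->
  measurable_fun setT f -> (forall a, 0 <= f a)%E ->
  (\int[mu]_a f a =
   (s ^+ 2)%:E * \int[mu]_a f (affine s (z.1 : R) a.1, affine s (z.2 : R) a.2))%E.
Proof.
move=> s0 mf f0; pose h (a : plane R) := (affine s (z.1 : R) a.1, affine s (z.2 : R) a.2).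
have mh : measurable_fun setT h.
  apply/measurable_fun_pair; [apply: (measurableT_comp _ measurable_fst)|
    apply: (measurableT_comp _ measurable_snd)]; exact: measurable_affine.
have mfh : measurable_fun setT (f \o h) by exact: measurableT_comp.
rewrite [LHS](fubini_tonelli1 f)// [X in (_ * X)%E](fubini_tonelli1 (f \o h))//; last first.
  by move=> a; exact: f0.
have mG := @measurable_fun_fubini_tonelli_F _ _ _ _ _ leb f mf f0.
have m2 x : measurable_fun setT (fun y => f (x, y)).
  exact: (measurableT_comp mf (pair1_measurable x)).
rewrite /fubini_F (ge0_integral_affine (z.1 : R) s0); last 2 first.
- exact: mG.
- by move=> x; exact: integral_ge0.
have E (x : measurableTypeR R) : (\int[leb]_y f (affine s (z.1 : R) x, y) =
    s%:E * \int[leb]_y (f \o h) (x, y))%E.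
  by rewrite (ge0_integral_affine (z.2 : R) s0).
rewrite -[fun x => _]/(fun x => \int[leb]_y f (affine s (z.1 : R) x, y))%E.
under eq_integral do rewrite E.
rewrite ge0_integralZl//; last 3 first.
- apply: (@measurable_fun_fubini_tonelli_F _ _ _ _ _ leb (f \o h)) => //.
  by move=> a; exact: f0.
- by move=> x _; apply: integral_ge0 => y _; exact: f0.
- by rewrite lee_fin ltW.
by rewrite muleA -EFinM -expr2.
Qed.

Lemma integral_mker_translate k z : 0 < k ->
  (\int[mu]_a (mker k ((a.1 : R) - (z.1 : R)) ((a.2 : R) - (z.2 : R)))%:E =
   \int[mu]_a (mker 1 (a.1 : R) (a.2 : R))%:E)%E.
Proof.
move=> k0; have k1 : 0 < k^-1 by rewrite invr_gt0.
rewrite (ge0_integral_affine_plane z k1); last 2 first.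
- by apply/measurable_EFinP; exact: measurable_mker_at.
- by move=> a; rewrite lee_fin mker_ge0.
rewrite -ge0_integralZl//; last 3 first.
- apply/measurable_EFinP; apply: measurable_mker.
    apply: measurable_funB; last exact: measurable_cst.
    exact: (measurableT_comp (measurable_affine _ _) measurable_fst).
  apply: measurable_funB; last exact: measurable_cst.
  exact: (measurableT_comp (measurable_affine _ _) measurable_snd).
- by move=> a _; rewrite lee_fin mker_ge0.
- by rewrite lee_fin sqr_ge0.
apply: eq_integral => a _; rewrite -EFinM /affine /=; congr EFin.
rewrite !(addrC _ (k^-1 * _)) !addrK mker_rescale ?gt_eqF//.
by rewrite mulrA -exprMn mulVf ?gt_eqF// expr1n mul1r.
Qed.

(** The constant of the Cauchy-Pompeiu formula. In polar coordinates it is pi times the total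
    increase of the smooth step, so its value is pi. *)
Definition mass : R := \int[mu]_a mker 1 (a.1 : R) (a.2 : R).

Lemma integral_mker_lty : (\int[mu]_a (mker 1 (a.1 : R) (a.2 : R))%:E < +oo)%E.
Proof.
have [C C0 hC] := @mker_bounded R 1; pose z0 : plane R := (0, 0).
apply: (@le_lt_trans _ _ (\int[mu]_a (C * \1_(square z0 1) a)%:E)%E).
  apply: ge0_le_integral => //.
  - by move=> a _; rewrite lee_fin mker_ge0.
  - by apply/measurable_EFinP; exact: measurable_mker.
  - apply/measurable_EFinP; apply: measurable_funM; first exact: measurable_cst.
    by apply: measurable_indic; exact: measurable_square.
  - move=> a _; rewrite lee_fin.
    have [sa|sa] := pselect (square z0 1 a).
      by rewrite indicE mem_set// mulr1.
    rewrite mker_supp; first by rewrite mulr_ge0.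
    rewrite !mul1r; apply/negP => /negP; rewrite -ltNge => lt1; apply: sa.
    have h (x y : R) : x * x + y * y < 1 -> -1 <= x <= 1.
      by move=> xy; apply/andP; split; nra.
    rewrite /square /= !in_itv /= !sub0r !add0r (h _ _ lt1); split => //.
    by apply: (h _ (a.1 : R)); rewrite addrC.
under eq_integral do rewrite EFinM.
rewrite ge0_integralZl//; last first.
  by apply/measurable_EFinP; apply: measurable_indic; exact: measurable_square.
rewrite integral_indic//; last exact: measurable_square.
rewrite setIT; apply: lte_mul_pinfty; rewrite ?lee_fin//.
by have := square_fin_num z0 1; rewrite ge0_fin_numE ?measure_ge0.
Qed.

Lemma massE : (mass%:E = \int[mu]_a (mker 1 (a.1 : R) (a.2 : R))%:E)%E.
Proof.
rewrite /mass /Rintegral fineK// ge0_fin_numE; first exact: integral_mker_lty.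
by apply: integral_ge0 => a _; rewrite lee_fin mker_ge0.
Qed.

Lemma mass_gt0 : 0 < mass.
Proof.
have ge0 : 0 <= mass.
  by rewrite -lee_fin massE; apply: integral_ge0 => a _; rewrite lee_fin mker_ge0.
rewrite lt_neqAle ge0 andbT eq_sym; apply/eqP => m0.
have I0 : (\int[mu]_a `|(mker 1 (a.1 : R) (a.2 : R))%:E| = 0)%E.
  rewrite -[RHS]/(0%:E) -m0 massE; apply: eq_integral => a _.
  by rewrite gee0_abs// lee_fin mker_ge0.
have mm1 : measurable_fun setT (fun a : plane R => (mker 1 (a.1 : R) (a.2 : R))%:E).
  by apply/measurable_EFinP; exact: measurable_mker.
have [N [mN N0 sN]] := (ae_eq_integral_abs mu measurableT mm1).1 I0.
(* On this square [0 < x^2 + y^2 < 1], where [mq] is positive, and the square has positive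
   measure. *)
pose Q : set (plane R) := `]0, 2^-1[%classic `*` `]0, 2^-1[%classic.
have mQ : measurable Q by apply: measurableX; exact: measurable_itv.
have QN : Q `<=` N.
  move=> a [/=]; rewrite !in_itv /= => /andP[a1 a1'] /andP[a2 a2']; apply: sN => /= h.
  have : 0 < mker 1 (a.1 : R) (a.2 : R).
    rewrite /mker !mul1r expr1n mul1r; apply: mq_gt0; first by rewrite addr_gt0// mulr_gt0.
    by move: a1 a1' a2 a2'; move: (a.1 : R) (a.2 : R) => x y *; nra.
  by case: (h I) => ->; rewrite ltxx.
have : (mu Q <= 0)%E by rewrite -N0 le_measure// inE.
pose J : set R := `]0, 2^-1[%classic.
have -> : mu Q = (leb J * leb J)%E by apply: product_measure1E; exact: measurable_itv.
rewrite lebesgue_measure_itv /= lte_fin invr_gt0 ltr0n /= -EFinB subr0 -EFinM lee_fin.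
by rewrite leNgt mulr_gt0// invr_gt0.
Qed.

Lemma cint_real d (T : measurableType d) (m : {measure set T -> \bar R}) (f : T -> R) :
  cint m (fun x => (f x)%:C%C) = (\int[m]_x f x)%:C%C.
Proof. by congr (_ +i* _)%C; rewrite /Rintegral /= integral0_eq. Qed.

Lemma cint_mker k z : 0 < k ->
  cint mu (fun a => (mker k ((a.1 : R) - (z.1 : R)) ((a.2 : R) - (z.2 : R)))%:C%C) = mass%:C%C.
Proof. by move=> k0; rewrite cint_real /Rintegral integral_mker_translate// -massE. Qed.

End mollifier_mass.

Section rectangle_limits.
Context {R : realType}.
Notation mu := (@plane_measure R).
Notation Z := (@complex_of R).
Implicit Types (a z l h : plane R) (k : R) (A : set (plane R)).

Definition rectangle l h : set (plane R) :=
  `](l.1 : R), (h.1 : R)[%classic `*` `](l.2 : R), (h.2 : R)[%classic.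

Lemma measurable_rectangle l h : measurable (rectangle l h).
Proof. by apply: measurableX; exact: measurable_itv. Qed.

Lemma rectangle_lty l h : (mu (rectangle l h) < +oo)%E.
Proof.
have hI (a b : R) : (@lebesgue_measure R `]a, b[%classic) \is a fin_num.
  by rewrite lebesgue_measure_itv /=; case: ifP => // _; rewrite -EFinB.
rewrite -ge0_fin_numE; last exact: measure_ge0.
rewrite -[X in X \is a _]/((lebesgue_measure \x lebesgue_measure)%E _).
rewrite product_measure1E; [|exact: measurable_itv..].
exact: fin_numM (hI _ _) (hI _ _).
Qed.

(* Off the four lines bounding the rectangle, the support of the mollifier
   centred at z is eventually on one side of each line. *)
Lemma indic_mker_near l h z :
  (z.1 : R) != l.1 /\ (z.2 : R) != l.2 -> (z.1 : R) != h.1 /\ (z.2 : R) != h.2 ->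
  \forall j \near \oo, forall a,
    \1_(rectangle l h) a * mker j.+1%:R ((a.1 : R) - (z.1 : R)) ((a.2 : R) - (z.2 : R)) =
    \1_(rectangle l h) z * mker j.+1%:R ((a.1 : R) - (z.1 : R)) ((a.2 : R) - (z.2 : R)).
Proof.
move=> [l1 l2] [h1 h2].
pose del := Num.min (Num.min `|(z.1 : R) - l.1| `|(z.2 : R) - l.2|)
  (Num.min `|(z.1 : R) - h.1| `|(z.2 : R) - h.2|).
have del0 : 0 < del by rewrite !lt_min !normr_gt0 !subr_eq0 l1 l2 h1 h2.
near=> j => a; set k : R := j.+1%:R.
have k0 : 0 < k by rewrite ltr0n.
have kdel : del^-1 <= k.
  have : del^-1 <= j%:R by near: j; exact: nbhs_infty_ger.
  by move=> /le_trans; apply; rewrite ler_nat.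
set x := _ - (z.1 : R); set y := _ - (z.2 : R).
have [t1|t1] := leP 1 (k * x * (k * x) + k * y * (k * y)).
  by rewrite mker_supp// !mulr0.
have side (c s t : R) : del <= `|s - c| -> k * (t - s) * (k * (t - s)) < 1 ->
    ((c < t) = (c < s)) * ((t < c) = (s < c)).
  move=> dc ts; have : `|t - s| < `|s - c|.
    apply: lt_le_trans dc; rewrite -[ltRHS]invrK.
    apply: (@lt_le_trans _ _ k^-1); last by rewrite lef_pV2 ?posrE ?invr_gt0.
    rewrite -[ltRHS]mul1r ltr_pdivlMr// mulrC -(ger0_norm (ltW k0)) -normrM.
    by rewrite -(ltr_pXn2r (_ : 0 < 2)%N) ?nnegrE// expr1n real_normK ?num_real// expr2.
  case: (ltrgt0P (s - c)) => sc; rewrite ltr_norml => /andP[u1 u2];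
  split; apply/idP/idP => ?; lra.
have [d1 d2 d3 d4] : [/\ del <= `|(z.1 : R) - l.1|, del <= `|(z.2 : R) - l.2|,
    del <= `|(z.1 : R) - h.1| & del <= `|(z.2 : R) - h.2|].
  by rewrite /del !ge_min !lexx !orbT.
have tx : k * x * (k * x) < 1 by nra.
have ty : k * y * (k * y) < 1 by nra.
rewrite !indicE /rectangle !in_setX !mem_setE !in_itv /=.
by rewrite (side _ _ _ d1 tx) (side _ _ _ d2 ty) (side _ _ _ d3 tx) (side _ _ _ d4 ty).
Unshelve. all: by end_near. Qed.

Lemma cintble_mker k z : 0 < k ->
  cintble mu (fun a => (mker k ((a.1 : R) - (z.1 : R)) ((a.2 : R) - (z.2 : R)))%:C%C).
Proof.
move=> k0; split; first by apply: cmeas_real; exact: measurable_mker_at.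
under eq_integral do rewrite normc_real (ger0_norm (mker_ge0 _ _ _)).
by rewrite integral_mker_translate// integral_mker_lty.
Qed.

(** The identity is to be integrated over the poles [a] in [A], after which [z] is the parameter. As
    [k] grows, [mollified] tends to [mass] times the indicator of [A] for a rectangle, and
    [smoothed] tends to [potential]. *)
Definition mollified A k z : R[i] := cint mu (fun a =>
  (\1_A a * mker k ((a.1 : R) - (z.1 : R)) ((a.2 : R) - (z.2 : R)))%:C%C).

Definition smoothed A k z : R[i] := cint mu (fun a =>
  (\1_A a)%:C%C * kker k ((a.1 : R) - (z.1 : R)) ((a.2 : R) - (z.2 : R))).

Definition potential A z : R[i] := cint mu (fun a => (\1_A a)%:C%C / (Z a - Z z)).

Lemma mollified_near l h : {ae mu, forall z, \forall j \near \oo,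
  mollified (rectangle l h) j.+1%:R z = (\1_(rectangle l h) z * mass)%:C%C}.
Proof.
apply: filterS2 (plane_measure_lines l) (plane_measure_lines h) => z lz hz.
apply: filterS (indic_mker_near lz hz) => j E; rewrite /mollified.
have -> : (fun a : plane R => (\1_(rectangle l h) a *
    mker j.+1%:R ((a.1 : R) - (z.1 : R)) ((a.2 : R) - (z.2 : R)))%:C%C) =
  (fun a => (\1_(rectangle l h) z)%:C%C *
    (mker j.+1%:R ((a.1 : R) - (z.1 : R)) ((a.2 : R) - (z.2 : R)))%:C%C).
  by apply/funext => a; rewrite E rmorphM.
rewrite cint_scale; last exact: cintble_mker.
by rewrite cint_mker// rmorphM.
Qed.

Lemma integral_indic_mker_le A k z : measurable A -> 0 < k ->
  (\int[mu]_a (normc (\1_A a *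
     mker k ((a.1 : R) - (z.1 : R)) ((a.2 : R) - (z.2 : R)))%:C%C)%:E <= mass%:E)%E.
Proof.
move=> mA k0; rewrite massE -(integral_mker_translate z k0).
have mf : measurable_fun setT (fun a : plane R =>
    \1_A a * mker k ((a.1 : R) - (z.1 : R)) ((a.2 : R) - (z.2 : R))).
  by apply: measurable_funM; [exact: measurable_indic|exact: measurable_mker_at].
apply: ge0_le_integral => //.
- by move=> a _; rewrite lee_fin normc_ge0.
- by apply/measurable_EFinP; apply: measurable_normc; exact: cmeas_real.
- by apply/measurable_EFinP; exact: measurable_mker_at.
- move=> a _; have mk0 := mker_ge0 k ((a.1 : R) - (z.1 : R)) ((a.2 : R) - (z.2 : R)).
  by rewrite lee_fin normc_real ger0_norm; [rewrite ler_piMl|exact: mulr_ge0].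
Qed.

Lemma cintble_indic_mker A k z : measurable A -> 0 < k ->
  cintble mu (fun a : plane R => (\1_A a *
    mker k ((a.1 : R) - (z.1 : R)) ((a.2 : R) - (z.2 : R)))%:C%C).
Proof.
move=> mA k0; split.
  apply: cmeas_real; apply: measurable_funM; [exact: measurable_indic|].
  exact: measurable_mker_at.
by apply: le_lt_trans (integral_indic_mker_le z mA k0) _; rewrite ltry.
Qed.

Lemma normc_mollified_le A k z : measurable A -> 0 < k ->
  normc (mollified A k z) <= 2 * mass.
Proof.
move=> mA k0; rewrite -lee_fin.
apply: le_trans (normc_cint_le (cintble_indic_mker z mA k0)) _.
by rewrite EFinM lee_wpmul2l// integral_indic_mker_le.
Qed.

Definition potential_bound A : R := kernel_mass 2^-1 + fine (mu A).

Lemma integral_potential_bound A z : measurable A -> (mu A < +oo)%E ->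
  (\int[mu]_a (normc ((\1_A a)%:C%C / (Z a - Z z)))%:E <= (potential_bound A)%:E)%E.
Proof.
move=> mA Aoo; apply: le_trans (integral_kernel_le z mA) _.
by rewrite EFinD fineK// ge0_fin_numE// measure_ge0.
Qed.

Lemma potential_bound_ge0 A : 0 <= potential_bound A.
Proof. by rewrite addr_ge0 ?kernel_mass_ge0// fine_ge0// measure_ge0. Qed.

Lemma cintble_potential_indic A z : measurable A -> (mu A < +oo)%E ->
  cintble mu (fun a => (\1_A a)%:C%C / (Z a - Z z)).
Proof.
move=> mA Aoo; split; last first.
  by apply: le_lt_trans (integral_potential_bound z mA Aoo) _; rewrite ltry.
by apply: cmeasM (cmeas_kernel_at z); apply: cmeas_real; exact: measurable_indic.
Qed.

Lemma normc_indic_kker_le A k z a : k != 0 ->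
  normc ((\1_A a)%:C%C * kker k ((a.1 : R) - (z.1 : R)) ((a.2 : R) - (z.2 : R))) <=
  normc ((\1_A a)%:C%C / (Z a - Z z)).
Proof.
move=> k0; rewrite !normcM ler_wpM2l ?normc_ge0//.
by rewrite complex_ofB; exact: normc_kker_le.
Qed.

Lemma cmeas_indic_kker A k z : measurable A -> cmeas (fun a : plane R =>
  (\1_A a)%:C%C * kker k ((a.1 : R) - (z.1 : R)) ((a.2 : R) - (z.2 : R))).
Proof.
move=> mA; apply: cmeasM; first by apply: cmeas_real; exact: measurable_indic.
by apply: cmeas_kker; apply: measurable_funB => //; exact: measurable_cst.
Qed.

(** For [a] off the pole the regularized kernel equals the Cauchy kernel as soon as
    [k |a - z| >= 1], and it is always dominated by it. *)
Lemma smoothed_cvg A z : measurable A -> (mu A < +oo)%E ->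
  (fun j => normc (smoothed A j.+1%:R z - potential A z)) @ \oo --> (0 : R).
Proof.
move=> mA Aoo; have pi := cintble_potential_indic z mA Aoo.
have [] // := @cint_dominated _ _ _ mu (fun (j : nat) a =>
    (\1_A a)%:C%C * kker j.+1%:R ((a.1 : R) - (z.1 : R)) ((a.2 : R) - (z.2 : R)))
  (fun a => (\1_A a)%:C%C / (Z a - Z z)) (fun a => normc ((\1_A a)%:C%C / (Z a - Z z))).
- by move=> j; exact: cmeas_indic_kker.
- exact: pi.1.
- apply: filterS (complex_of_diag0 z) => a az.
  apply: cvg_near_cst; near=> j.
  rewrite complex_ofB kker_eq_inv ?subrr ?normc0//.
  set x := (a.1 : R) - _; set y := (a.2 : R) - _.
  have xy : 0 < x * x + y * y.
    rewrite lt_neqAle addr_ge0 -?expr2 ?sqr_ge0// andbT eq_sym; apply/eqP => /eqP.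
    rewrite paddr_eq0 ?sqr_ge0// !sqrf_eq0 !subr_eq0 => /andP[/eqP e1 /eqP e2].
    by move/eqP: az; apply; rewrite /complex_of e1 e2.
  have : (x * x + y * y)^-1 <= j%:R by near: j; exact: nbhs_infty_ger.
  rewrite -[_ <= j%:R](ler_pM2r xy) mulVf ?gt_eqF// => /le_trans; apply.
  have -> : j.+1%:R * x * (j.+1%:R * x) + j.+1%:R * y * (j.+1%:R * y) =
    (j.+1%:R * j.+1%:R) * (x * x + y * y) :> R by ring.
  by rewrite ler_pM2r// -natrM ler_nat (leq_trans (leqnSn j))// leq_pmulr.
- exact: cintble_norm pi.
- by apply: aeW => a j; apply: normc_indic_kker_le; rewrite pnatr_eq0.
Unshelve. all: by end_near. Qed.

Lemma integral_indic_kker_le A k z : measurable A -> (mu A < +oo)%E -> k != 0 ->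
  (\int[mu]_a (normc ((\1_A a)%:C%C *
     kker k ((a.1 : R) - (z.1 : R)) ((a.2 : R) - (z.2 : R))))%:E <= (potential_bound A)%:E)%E.
Proof.
move=> mA Aoo k0; apply: le_trans (integral_potential_bound z mA Aoo).
apply: ge0_le_integral => //.
- by move=> a _; rewrite lee_fin normc_ge0.
- by apply/measurable_EFinP; apply: measurable_normc; exact: cmeas_indic_kker.
- apply/measurable_EFinP; apply: measurable_normc.
  exact: (cintble_potential_indic z mA Aoo).1.
- by move=> a _; rewrite lee_fin normc_indic_kker_le.
Qed.

Lemma cintble_indic_kker A k z : measurable A -> (mu A < +oo)%E -> k != 0 ->
  cintble mu (fun a : plane R =>
    (\1_A a)%:C%C * kker k ((a.1 : R) - (z.1 : R)) ((a.2 : R) - (z.2 : R))).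
Proof.
move=> mA Aoo k0; split; first exact: cmeas_indic_kker.
by apply: le_lt_trans (integral_indic_kker_le z mA Aoo k0) _; rewrite ltry.
Qed.

Lemma normc_smoothed_le A k z : measurable A -> (mu A < +oo)%E -> k != 0 ->
  normc (smoothed A k z) <= 2 * potential_bound A.
Proof.
move=> mA Aoo k0; have fi := cintble_indic_kker z mA Aoo k0.
rewrite -lee_fin; apply: le_trans (normc_cint_le fi) _.
by rewrite EFinM lee_wpmul2l//; exact: integral_indic_kker_le.
Qed.

End rectangle_limits.

Section product_facts.
Context d1 d2 (T1 : measurableType d1) (T2 : measurableType d2) (R : realType).
Variable m1 : {sigma_finite_measure set T1 -> \bar R}.
Variable m2 : {sigma_finite_measure set T2 -> \bar R}.

Lemma ae_fst (P : T1 -> Prop) : {ae m1, forall x, P x} ->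
  {ae sfprod m1 m2, forall z, P z.1}.
Proof.
move=> [N [mN N0 sN]]; exists (N `*` setT); split.
- exact: measurableX.
- transitivity (m1 N * m2 setT)%E; last by rewrite N0 mul0e.
  exact: product_measure1E.
- by move=> z /= nP; split => //; exact: sN.
Qed.

End product_facts.

(** Stated for a factor 0 or 1, where it holds for every [f]; it is applied to sections whose
    integrability has not been established. *)
Lemma cint_scale01 d (T : measurableType d) (R : realType) (mu : {measure set T -> \bar R})
    (b : bool) (f : T -> R[i]) :
  cint mu (fun x => (b%:R : R)%:C%C * f x) = (b%:R : R)%:C%C * cint mu f.
Proof.
case: b; first by rewrite mul1r; congr cint; apply/funext => x; rewrite mul1r.
rewrite mul0r; have -> : (fun x => (false%:R : R)%:C%C * f x) = fun x => (0 : R)%:C%C.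
  by apply/funext => x; rewrite mul0r.
by rewrite cint_real /Rintegral integral0.
Qed.

Lemma cint_scaler d (T : measurableType d) (R : realType) (mu : {measure set T -> \bar R})
    (c : R[i]) (f : T -> R[i]) : cintble mu f ->
  cint mu (fun x => f x * c) = cint mu f * c.
Proof. by move=> fi; rewrite mulrC -cint_scale//; under eq_fun do rewrite mulrC. Qed.

(** * The Cauchy representation tested on a rectangle times a box *)

Section representation.
Context {R : realType} {m : nat}.
Notation nu := (@slice_measure R m).
Notation mu := (@plane_measure R).
Notation Z := (@complex_of R).
Notation T := (plane R * Cn R m)%type.
Implicit Types (p : T) (a z l h : plane R) (k : R) (lo hi : 'I_m + 'I_m -> R).

Variables U g : T -> R[i].
Hypothesis mU : cmeas U.
Hypothesis UL : forall M, cintble nu (fun p => (cut M p)%:C%C * U p).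
Hypothesis gi : cintble nu g.
Hypothesis mollified_identity : forall k a lo hi, 0 < k ->
  cint nu (fun p => (\1_(box lo hi) p.2)%:C%C * ((mm k a p)%:C%C * U p)) =
  cint nu (fun p => (\1_(box lo hi) p.2)%:C%C * (kk k a p * g p)).

Definition slice_cauchy p : R[i] := cauchy mu Z (fun z => g (z, p.2)) p.1.

Lemma cmeas_slice_cauchy : cmeas slice_cauchy.
Proof.
have h : cmeas (fun q : T * plane R => g (q.2, q.1.2) / (Z q.1.1 - Z q.2)).
  apply: cmeasM.
    apply: (cmeas_comp _ gi.1); apply/measurable_fun_pair => //.
    exact: (measurableT_comp measurable_snd measurable_fst).
  apply: cmeasV; apply: cmeasB; apply: (cmeas_comp _ cmeas_complex_of) => //.
  exact: (measurableT_comp measurable_fst measurable_fst).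
exact: (cmeas_cint1 mu h).
Qed.

Variables (l h : plane R) (lo hi : 'I_m + 'I_m -> R).
Let A := rectangle l h.
Let B := box lo hi.
Let mA : measurable A. Proof. exact: measurable_rectangle. Qed.
Let Aoo : (mu A < +oo)%E. Proof. exact: rectangle_lty. Qed.
Let iA a : R := \1_A a.
Let iB p : R := \1_B p.2.
Let miA : measurable_fun setT iA. Proof. exact: measurable_indic. Qed.
Let miB : measurable_fun setT iB.
Proof.
apply: (measurableT_comp _ measurable_snd); apply: measurable_indic.
exact: measurable_box.
Qed.
Let iA1 a : normc (iA a)%:C%C <= 1.
Proof. by rewrite normc_real ger0_norm// /iA indicE; case: (_ \in _). Qed.
Let iB1 p : normc (iB p)%:C%C <= 1.
Proof. by rewrite normc_real ger0_norm// /iB indicE; case: (_ \in _). Qed.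

Let iA0 a : ~ A a -> iA a = 0.
Proof. by move=> nA; rewrite /iA indicE memNset. Qed.
Let iB0 p : ~ B p.2 -> iB p = 0.
Proof. by move=> nB; rewrite /iB indicE memNset. Qed.

Let N : R := pole_norm l + pole_norm h.
Let N0 : 0 <= N. Proof. by rewrite !addr_ge0. Qed.
Let NN : N <= N + N + 1. Proof. by rewrite -addrA lerDl addr_ge0. Qed.
(** For a pole in [A] and [k >= 1] the mollifier lives where both coordinates of [z1] are at most
    [N + N + 1] in modulus. The radius is one larger because [slice_radius] asks for strict
    inequalities, and so truncating [U] there changes nothing. *)
Let M := support_radius (N + N + 2) lo hi.

Let A_pole a : A a -> `|a.1 : R| <= N /\ `|a.2 : R| <= N.
Proof.
case; rewrite /= !in_itv /= => /andP[l1 h1] /andP[l2 h2].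
have e x (y w s t : R) : y < x -> x < w -> 0 <= s -> 0 <= t ->
    `|x| <= `|y| + s + (`|w| + t).
  move=> yx xw s0 t0; rewrite ler_norml; have := ler_norm w; have := ler_norm (- y).
  by rewrite normrN; have := normr_ge0 w; have := normr_ge0 y => *; apply/andP; split; lra.
split; rewrite /N /pole_norm; first exact: e.
by rewrite (addrC `|l.1 : R|) (addrC `|h.1 : R|); exact: e.
Qed.

Let cut1 p : `|p.1.1 : R| <= N + N + 1 -> `|p.1.2 : R| <= N + N + 1 -> B p.2 -> cut M p = 1.
Proof.
move=> h1 h2 Bp; rewrite /cut indicE mem_set//; apply: slice_radius => //.
- by rewrite ltr_wpDl// addr_ge0.
- by apply: le_lt_trans h1 _; rewrite ltrD2l; lra.
- by apply: le_lt_trans h2 _; rewrite ltrD2l; lra.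
Qed.

Let HU p : R[i] := (iB p)%:C%C * ((cut M p)%:C%C * U p).
Let Hg p : R[i] := (iB p)%:C%C * g p.
Let HUi : cintble nu HU.
Proof. by apply: cintbleMl iB1 (UL M); exact: cmeas_real. Qed.
Let Hgi : cintble nu Hg.
Proof. by apply: cintbleMl iB1 gi; exact: cmeas_real. Qed.

Let mker_prod k (x : plane R * T) : R :=
  iA x.1 * mker k ((x.1.1 : R) - (x.2.1.1 : R)) ((x.1.2 : R) - (x.2.1.2 : R)).
Let kker_prod k (x : plane R * T) : R[i] :=
  (iA x.1)%:C%C * kker k ((x.1.1 : R) - (x.2.1.1 : R)) ((x.1.2 : R) - (x.2.1.2 : R)).
Let pole_prod (x : plane R * T) : R[i] := (iA x.1)%:C%C / (Z x.1 - Z x.2.1).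

Let mx1 : measurable_fun setT
  (fun x : plane R * T => (x.1.1 : R) - (x.2.1.1 : R)).
Proof.
apply: measurable_funB; first exact: (measurableT_comp measurable_fst measurable_fst).
exact: (measurableT_comp measurable_p11 measurable_snd).
Qed.
Let mx2 : measurable_fun setT
  (fun x : plane R * T => (x.1.2 : R) - (x.2.1.2 : R)).
Proof.
apply: measurable_funB; first exact: (measurableT_comp measurable_snd measurable_fst).
exact: (measurableT_comp measurable_p12 measurable_snd).
Qed.
Let miA1 : measurable_fun setT (fun x : plane R * T => iA x.1).
Proof. exact: (measurableT_comp miA measurable_fst). Qed.

Let mmker_prod k : cmeas (fun x => (mker_prod k x)%:C%C).
Proof. by apply: cmeas_real; apply: measurable_funM => //; exact: measurable_mker. Qed.
Let mkker_prod k : cmeas (kker_prod k).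
Proof. by apply: cmeasM; [exact: cmeas_real|exact: cmeas_kker]. Qed.
Let mpole_prod : cmeas pole_prod.
Proof.
apply: cmeasM; first exact: cmeas_real.
apply: cmeasV; apply: cmeasB; apply: (cmeas_comp _ cmeas_complex_of) => //.
exact: (measurableT_comp measurable_fst measurable_snd).
Qed.

Let mass0 : 0 <= mass :> R := ltW mass_gt0.

Let Fi k : 0 < k ->
  cintble (mu \x nu)%E (fun x => (mker_prod k x)%:C%C * HU x.2).
Proof.
move=> k0; apply: (cintble_schur mass0 (mmker_prod k) HUi) => p.
exact: (integral_indic_mker_le p.1 mA k0).
Qed.

Let Gi k : 0 < k -> cintble (mu \x nu)%E (fun x => kker_prod k x * Hg x.2).
Proof.
move=> k0; apply: (cintble_schur (potential_bound_ge0 A) (mkker_prod k) Hgi) => p.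
by apply: (integral_indic_kker_le p.1 mA Aoo); rewrite gt_eqF.
Qed.

Let Pi : cintble (mu \x nu)%E (fun x => pole_prod x * Hg x.2).
Proof.
apply: (cintble_schur (potential_bound_ge0 A) mpole_prod Hgi) => p.
exact: (integral_potential_bound p.1 mA Aoo).
Qed.

(** The mollified identity is integrated over the poles in [A] and the order of integration
    exchanged. Replacing [U] by its truncation, which gives absolute convergence, is invisible: for
    these poles the mollifier vanishes wherever the cut-off acts. *)
Let integrated_identity k : 1 <= k ->
  cint nu (fun p => mollified A k p.1 * HU p) = cint nu (fun p => smoothed A k p.1 * Hg p).
Proof.
move=> k1; have k0 : 0 < k by apply: lt_le_trans k1.
transitivity (cint (mu \x nu)%E (fun x => (mker_prod k x)%:C%C * HU x.2)).
  rewrite (cint_fubini2 (Fi k0)); congr cint; apply/funext => p /=.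
  exact/esym/(cint_scaler (HU p) (cintble_indic_mker p.1 mA k0)).
transitivity (cint (mu \x nu)%E (fun x => kker_prod k x * Hg x.2)); last first.
  rewrite (cint_fubini2 (Gi k0)); congr cint; apply/funext => p /=.
  exact: (cint_scaler (Hg p) (cintble_indic_kker p.1 mA Aoo (lt0r_neq0 k0))).
rewrite (cint_fubini1 (Fi k0)) (cint_fubini1 (Gi k0)); congr cint; apply/funext => a /=.
transitivity (cint nu (fun p => (iA a)%:C%C * ((iB p)%:C%C * ((mm k a p)%:C%C * U p)))).
  congr cint; apply/funext => p; rewrite /mker_prod /HU /= -/(mm k a p).
  have [Aa|Aa] := pselect (A a); last by rewrite iA0// !mul0r.
  have [Bp|Bp] := pselect (B p.2); last by rewrite iB0// !mul0r !mulr0.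
  rewrite rmorphM /=; have [mm0|mm0] := eqVneq (mm k a p) 0.
    by rewrite mm0 !(mulr0, mul0r).
  have [A1 A2] := A_pole Aa.
  have ki : k^-1 <= 1 by rewrite invf_le1.
  have far : ~~ ((pole_norm a + k^-1 <= `|p.1.1 : R|) || (pole_norm a + k^-1 <= `|p.1.2 : R|)).
    by apply/negP => /(mm_supp k0) mm0'; move: mm0; rewrite mm0' eqxx.
  move: far; rewrite negb_or -!ltNge => /andP[f1 f2].
  rewrite (@cut1 p)//; first by rewrite mul1r -mulrA [(iB p)%:C%C * _ in RHS]mulrCA.
    by apply: ltW; apply: lt_le_trans f1 _; rewrite /pole_norm lerD// lerD.
  by apply: ltW; apply: lt_le_trans f2 _; rewrite /pole_norm lerD// lerD.
transitivity (cint nu (fun p => (iA a)%:C%C * ((iB p)%:C%C * (kk k a p * g p)))); last first.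
  by congr cint; apply/funext => p; rewrite /kker_prod /Hg /kk /=; ring.
by rewrite /iA indicE !cint_scale01 mollified_identity.
Qed.

Let mollified_cvg : (fun j => normc (cint nu (fun p => mollified A j.+1%:R p.1 * HU p) -
    cint nu (fun p => (iA p.1 * mass)%:C%C * HU p))) @ \oo --> (0 : R).
Proof.
have [] // := @cint_dominated _ _ _ nu (fun (j : nat) p => mollified A j.+1%:R p.1 * HU p)
  (fun p => (iA p.1 * mass)%:C%C * HU p) (fun p => (2 * mass) * normc (HU p)).
- by move=> j; apply: cmeasM; [exact: (cmeas_cint2 mu (mmker_prod j.+1%:R))|exact: HUi.1].
- apply: cmeasM; last exact: HUi.1.
  apply: cmeas_real; apply: measurable_funM; last exact: measurable_cst.
  exact: (measurableT_comp miA measurable_fst).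
- apply: filterS (ae_fst (Cn_measure m) (mollified_near l h)) => p nearp.
  apply: cvg_near_cst; apply: filterS nearp => j ->.
  by rewrite subrr normc0.
- exact: integrable_scale (cintble_norm HUi).
- apply: aeW => p j; rewrite normcM ler_wpM2r ?normc_ge0//.
  by apply: normc_mollified_le => //; rewrite ltr0n.
Qed.

Let smoothed_int_cvg : (fun j => normc (cint nu (fun p => smoothed A j.+1%:R p.1 * Hg p) -
    cint nu (fun p => potential A p.1 * Hg p))) @ \oo --> (0 : R).
Proof.
have [] // := @cint_dominated _ _ _ nu (fun (j : nat) p => smoothed A j.+1%:R p.1 * Hg p)
  (fun p => potential A p.1 * Hg p) (fun p => (2 * potential_bound A) * normc (Hg p)).
- by move=> j; apply: cmeasM; [exact: (cmeas_cint2 mu (mkker_prod j.+1%:R))|exact: Hgi.1].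
- by apply: cmeasM; [exact: (cmeas_cint2 mu mpole_prod)|exact: Hgi.1].
- apply: aeW => p.
  have -> : (fun j : nat => normc (smoothed A j.+1%:R p.1 * Hg p - potential A p.1 * Hg p)) =
      fun j : nat => normc (smoothed A j.+1%:R p.1 - potential A p.1) * normc (Hg p).
    by apply/funext => j; rewrite -normcM mulrBl.
  rewrite -(mul0r (normc (Hg p))); apply: cvgMl.
  exact: smoothed_cvg.
- exact: integrable_scale (cintble_norm Hgi).
- apply: aeW => p j; rewrite normcM ler_wpM2r ?normc_ge0//.
  by apply: normc_smoothed_le => //; rewrite pnatr_eq0.
Qed.

Let limit_identity : cint nu (fun p => (iA p.1 * mass)%:C%C * HU p) =
  cint nu (fun p => potential A p.1 * Hg p).
Proof.
apply: (normc_cvg_unique _ mollified_cvg smoothed_int_cvg).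
by apply/funext => j; apply: integrated_identity; rewrite ler1n.
Qed.

(** The integrand of [pole_prod * Hg] with variables regrouped: the pole [a] joins [w] to form a
    point of the slice space, and the former first variable [z] comes last. Integrating [z] then
    gives [slice_cauchy] at [(a, w)]. *)
Let pole_swap (q : T * plane R) : R[i] :=
  ((iA q.1.1)%:C%C * (iB q.1)%:C%C) * (g (q.2, q.1.2) / (Z q.1.1 - Z q.2)).

Let mpole_swap : cmeas pole_swap.
Proof.
apply: cmeasM.
  by apply: cmeasM; apply: cmeas_real; [apply: (measurableT_comp miA)|
    exact: (measurableT_comp miB measurable_fst)];
    exact: (measurableT_comp measurable_fst measurable_fst).
apply: cmeasM.
  apply: (cmeas_comp _ gi.1); apply/measurable_fun_pair => //.
  exact: (measurableT_comp measurable_snd measurable_fst).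
apply: cmeasV; apply: cmeasB; apply: (cmeas_comp _ cmeas_complex_of) => //.
exact: (measurableT_comp measurable_fst measurable_fst).
Qed.

Let pole_swapE a z (w : Cn R m) :
  pole_swap ((a, w), z) = pole_prod (a, (z, w)) * Hg (z, w).
Proof. by rewrite /pole_swap /pole_prod /Hg /iB /=; ring. Qed.

Let pole_swap_i : cintble (nu \x mu)%E pole_swap.
Proof.
apply: cintble_prod1 => //.
pose F (q : T) : \bar R := (\int[mu]_z (normc (pole_swap (q, z)))%:E)%E.
have mF : measurable_fun setT F := measurable_integral_normc1 mu mpole_swap.
have F0 q : (0 <= F q)%E.
  by apply: integral_ge0 => z _; rewrite lee_fin normc_ge0.
have -> : (\int[nu]_q F q = \int[mu]_a \int[Cn_measure m]_w F (a, w))%E.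
  exact: (fubini_tonelli1 F mF F0).
have mP : measurable_fun setT (fun x => (normc (pole_prod x * Hg x.2))%:E).
  by apply/measurable_EFinP; apply: measurable_normc; exact: Pi.1.
have := Pi.2; rewrite (fubini_tonelli1 _ mP); last first.
  by move=> x; rewrite lee_fin normc_ge0.
congr (_ < _)%E; apply: eq_integral => a _; rewrite /fubini_F.
have mPa : measurable_fun setT (fun p => (normc (pole_prod (a, p) * Hg p))%:E).
  exact: (measurableT_comp mP (pair1_measurable a)).
rewrite [LHS](fubini_tonelli2 _ mPa); last by move=> x; rewrite lee_fin normc_ge0.
rewrite /fubini_G; apply: eq_integral => w _; rewrite /F.
by apply: eq_integral => z _; rewrite pole_swapE.
Qed.

Let localized p : R[i] := ((iA p.1)%:C%C * (iB p)%:C%C) * slice_cauchy p.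

Let localizedE p : cint mu (fun z => pole_swap (p, z)) = localized p.
Proof.
rewrite /localized /slice_cauchy /cauchy /pole_swap /= /iA /iB !indicE.
rewrite -mulrA -!cint_scale01; congr cint; apply/funext => z.
by rewrite !mulrA.
Qed.

Lemma cintble_localized_cauchy : cintble nu (fun p =>
  ((\1_(rectangle l h) p.1)%:C%C * (\1_(box lo hi) p.2)%:C%C) * slice_cauchy p).
Proof.
have -> : (fun p => ((\1_(rectangle l h) p.1)%:C%C * (\1_(box lo hi) p.2)%:C%C) *
    slice_cauchy p) = fun p => cint mu (fun z => pole_swap (p, z)).
  by apply/funext => p; rewrite localizedE.
exact: (cintble_cint1 pole_swap_i).
Qed.

Lemma cintble_localized_u : cintble nu (fun p =>
  ((\1_(rectangle l h) p.1)%:C%C * (\1_(box lo hi) p.2)%:C%C) * U p).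
Proof.
have -> : (fun p => ((\1_(rectangle l h) p.1)%:C%C * (\1_(box lo hi) p.2)%:C%C) * U p) =
    fun p => (iA p.1)%:C%C * HU p.
  apply/funext => p; rewrite -/(iA p.1) -/(iB p) /HU.
  have [Ap|Ap] := pselect (A p.1); last by rewrite iA0// !mul0r.
  have [Bp|Bp] := pselect (B p.2); last by rewrite iB0// !(mul0r, mulr0).
  have [A1 A2] := A_pole Ap.
  by rewrite (cut1 (le_trans A1 NN) (le_trans A2 NN) Bp) mul1r mulrA.
apply: cintbleMl HUi => [|p]; last exact: iA1.
by apply: cmeas_real; exact: (measurableT_comp miA measurable_fst).
Qed.

Lemma cint_localized : mass%:C%C * cint nu (fun p =>
  ((\1_(rectangle l h) p.1)%:C%C * (\1_(box lo hi) p.2)%:C%C) * U p) =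
  cint nu (fun p => ((\1_(rectangle l h) p.1)%:C%C * (\1_(box lo hi) p.2)%:C%C) *
    slice_cauchy p).
Proof.
rewrite -cint_scale; last exact: cintble_localized_u.
transitivity (cint nu (fun p => (iA p.1 * mass)%:C%C * HU p)).
  congr cint; apply/funext => p; rewrite -/(iA p.1) -/(iB p) /HU.
  have [Ap|Ap] := pselect (A p.1); last by rewrite iA0// !mul0r mulr0.
  have [Bp|Bp] := pselect (B p.2); last by rewrite iB0// !(mul0r, mulr0).
  have [A1 A2] := A_pole Ap.
  by rewrite (cut1 (le_trans A1 NN) (le_trans A2 NN) Bp) rmorphM /=; ring.
rewrite limit_identity.
transitivity (cint (mu \x nu)%E (fun x => pole_prod x * Hg x.2)).
  rewrite (cint_fubini2 Pi); congr cint; apply/funext => p /=.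
  exact/esym/(cint_scaler (Hg p) (cintble_potential_indic p.1 mA Aoo)).
rewrite (cint_fubini1 Pi).
transitivity (cint nu (fun p => cint mu (fun z => pole_swap (p, z)))); last first.
  by congr cint; apply/funext => p; exact: localizedE.
rewrite [RHS](cint_fubini1 (cintble_cint1 pole_swap_i)).
apply: ae_eq_cint.
- exact: (cmeas_cint1 nu Pi.1).
- exact: (cmeas_cint1 (Cn_measure m) (cintble_cint1 pole_swap_i).1).
- apply: filterS (ae_cintble1 Pi) => a Pa.
  rewrite (cint_fubini2 Pa); congr cint; apply/funext => w.
  by congr cint; apply/funext => z; rewrite pole_swapE.
Qed.

End representation.

(** A box of C^(m+1) is a rectangle times a box of C^m, so [cint_localized] says that the difference
    of both sides integrates to 0 over every box. *)
Lemma slice_cauchy_representation (R : realType) (m : nat) (U g : plane R * Cn R m -> R[i]) :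
  cmeas U ->
  (forall M, cintble (slice_measure m) (fun p => (cut M p)%:C%C * U p)) ->
  cintble (slice_measure m) g ->
  (forall k a lo hi, 0 < k ->
    cint (slice_measure m) (fun p => (\1_(box lo hi) p.2)%:C%C * ((mm k a p)%:C%C * U p)) =
    cint (slice_measure m) (fun p => (\1_(box lo hi) p.2)%:C%C * (kk k a p * g p))) ->
  {ae slice_measure m, forall p, mass%:C%C * U p = slice_cauchy g p}.
Proof.
move=> mU UL gi id.
pose D p := mass%:C%C * U p - slice_cauchy g p.
have mD : cmeas D.
  by apply: cmeasB; [apply: cmeasM => //; exact: cmeas_cst|exact: cmeas_slice_cauchy].
have DE z : D (unslice (slice z)) = D z by rewrite sliceK.
pose ab (c : 'I_m.+1 + 'I_m.+1 -> R) : plane R := (c (inl ord0), c (inr ord0)).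
have boxE a b : (fun z => (\1_(box a b) z)%:C%C * (D \o @unslice R m) z) \o @slice R m =
    fun p => mass%:C%C * (((\1_(rectangle (ab a) (ab b)) p.1)%:C%C *
        (\1_(box (a \o @lift_index m) (b \o @lift_index m)) p.2)%:C%C) * U p) -
      ((\1_(rectangle (ab a) (ab b)) p.1)%:C%C *
        (\1_(box (a \o @lift_index m) (b \o @lift_index m)) p.2)%:C%C) * slice_cauchy g p.
  apply/funext => p /=; rewrite DE /D.
  have -> : \1_(box a b) (slice p) = \1_(rectangle (ab a) (ab b)) p.1 *
      \1_(box (a \o @lift_index m) (b \o @lift_index m)) p.2 :> R.
    rewrite -[LHS]/(\1_(@slice R m @^-1` box a b) p) preimage_slice_box.
    by rewrite !indicE in_setX -natrM mulnb.
  by rewrite rmorphM /=; ring.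
have Di a b : cintble (lebesgue_Cn R m.+1)
    (fun z => (\1_(box a b) z)%:C%C * (D \o @unslice R m) z).
  apply/cintble_slice; rewrite boxE; apply: cintbleB.
    by apply: cintbleZ; exact: cintble_localized_u.
  exact: cintble_localized_cauchy.
have D0 : {ae lebesgue_Cn R m.+1, forall z, (D \o @unslice R m) z = 0}.
  apply: ae_ceq0_of_boxes => //.
    apply/cmeas_slice; have -> : (D \o @unslice R m) \o @slice R m = D by apply/funext => p /=.
    exact: mD.
  move=> a b; rewrite cint_slice// boxE cint_sub; last 2 first.
  - by apply: cintbleZ; exact: cintble_localized_u.
  - exact: cintble_localized_cauchy.
  rewrite cint_scale; last exact: cintble_localized_u.
  by rewrite (cint_localized UL gi id) subrr.
have := (ae_slice _).2 D0; apply: filterS => p /= /eqP.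
by rewrite DE /D subr_eq0 => /eqP.
Qed.

(** * Reduction to slices *)

Section null_sections.
Context d1 d2 (T1 : measurableType d1) (T2 : measurableType d2) (R : realType).
Variable m1 : {sigma_finite_measure set T1 -> \bar R}.
Variable m2 : {sigma_finite_measure set T2 -> \bar R}.

Lemma ge0_ae_eq0 d (T : measurableType d) (mu : {measure set T -> \bar R}) (f : T -> \bar R) :
  measurable_fun setT f -> (forall x, 0 <= f x)%E -> (\int[mu]_x f x = 0)%E ->
  {ae mu, forall x, f x = 0%E}.
Proof.
move=> mf f0 I0; have : (\int[mu]_x `|f x| = 0)%E.
  by rewrite -[RHS]I0; apply: eq_integral => x _; rewrite gee0_abs.
by move/(ae_eq_integral_abs mu measurableT mf); apply: filterS => x; exact.
Qed.

Lemma tonelli_eq0 (f : T1 * T2 -> \bar R) : measurable_fun setT f ->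
  (forall z, 0 <= f z)%E -> (\int[sfprod m1 m2]_z f z = 0)%E ->
  {ae m2, forall y, {ae m1, forall x, f (x, y) = 0%E}}.
Proof.
move=> mf f0; rewrite [LHS](fubini_tonelli2 f mf f0) => I0.
have mG := @measurable_fun_fubini_tonelli_G _ _ _ _ _ m1 f mf f0.
have G0 y : (0 <= fubini_G m1 f y)%E by exact: integral_ge0.
apply: filterS (ge0_ae_eq0 mG G0 I0) => y; apply: ge0_ae_eq0 => //.
exact: (measurableT_comp mf (pair2_measurable y)).
Qed.

Lemma ae_sections (P : T1 * T2 -> Prop) : {ae sfprod m1 m2, forall z, P z} ->
  {ae m2, forall y, {ae m1, forall x, P (x, y)}}.
Proof.
move=> [N [mN N0 sN]].
have mI : measurable_fun setT (fun z => (\1_N z : R)%:E).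
  by apply/measurable_EFinP; exact: measurable_indic.
have I0 : (\int[sfprod m1 m2]_z (\1_N z : R)%:E = 0)%E.
  by rewrite integral_indic// setIT.
have := tonelli_eq0 mI (fun z => _) I0.
move=> /(_ (fun z => ltac:(by rewrite lee_fin))).
apply: filterS => y; apply: filterS => x h; apply: contrapT => nP; move: h.
by rewrite indicE mem_set; [move=> [] /eqP; rewrite oner_eq0|exact: sN].
Qed.

(** Stated for a measurable function rather than a predicate: a set with negligible sections need
    not be negligible unless it is measurable. *)
Lemma ae_of_sections (f : T1 * T2 -> R[i]) : cmeas f ->
  {ae m2, forall y, {ae m1, forall x, f (x, y) = 0}} ->
  {ae sfprod m1 m2, forall z, f z = 0}.
Proof.
move=> mf f0; have mn : measurable_fun setT (fun z => (normc (f z))%:E).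
  by apply/measurable_EFinP; exact: measurable_normc.
have n0 z : (0 <= (normc (f z))%:E)%E by rewrite lee_fin normc_ge0.
have I0 : (\int[sfprod m1 m2]_z (normc (f z))%:E = 0)%E.
  rewrite [LHS](fubini_tonelli2 _ mn n0).
  have mG := @measurable_fun_fubini_tonelli_G _ _ _ _ _ m1 _ mn n0.
  rewrite -(integral0 m2 setT); apply: ae_eq_integral => //.
  apply: filterS f0 => y fy _; rewrite /fubini_G -(integral0 m1 setT).
  apply: ae_eq_integral => //; first exact: (measurableT_comp mn (pair2_measurable y)).
  by apply: filterS fy => x fx _; rewrite fx normc0.
apply: filterS (ge0_ae_eq0 mn n0 I0) => z [] /eqP.
by rewrite normc0_eq0 => /eqP.
Qed.

End null_sections.

(** * Supports, decay and exponents in terms of cubes *)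

Section supports.
Context {R : realType} {n : nat}.
Notation mu := (lebesgue_Cn R n.+1).

Lemma norm_coordinate_le i (z : Cn R n.+1) : `|coordinate i z| <= `|z|.
Proof.
have h (v : 'rV[R]_n.+1) j : `|v ord0 j| <= `|v|.
  by rewrite [leRHS]mx_normrE; exact: (le_bigmax _ (fun ij => `|v ij.1 ij.2|) (ord0, j)).
rewrite prod_normE le_max; case: i => j /=; apply/orP; [left|right]; exact: h.
Qed.

Lemma nbhs_ccube (M : R) (z : Cn R n.+1) : `|z| < M -> nbhs z (ccube M).
Proof.
move=> zM; have : nbhs z [set x : Cn R n.+1 | `|x| < M].
  have c : {for z, continuous (fun x : Cn R n.+1 => `|x|)} by exact: norm_continuous.
  by apply: (c [set t | t < M]); exact: lt_nbhsl.
by apply: filterS => x /= xM i; exact: le_trans (norm_coordinate_le i x) (ltW xM).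
Qed.

(* Were the bad part of the compact set not negligible, the complements of
   negligible parts of it would form a proper filter on the compact set. *)
Lemma compact_ae (K : set (Cn R n.+1)) (P : Cn R n.+1 -> Prop) : compact K ->
  (forall z, K z -> exists2 U, nbhs z U & {ae mu, forall x, U x -> P x}) ->
  {ae mu, forall x, K x -> P x}.
Proof.
move=> cK loc; pose F : set_system (Cn R n.+1) :=
  [set X | {ae mu, forall x, K x -> ~ P x -> X x}].
have FF : Filter F.
  split; rewrite /F /=; first by apply: aeW.
    move=> X Y /= FX FY; apply: (filterS2 _ _ FX FY) => x hX hY Kx nP.
    by split; [exact: hX|exact: hY].
  move=> X Y XY /= FX; apply: filterS FX => x hX Kx nP; apply: XY; exact: hX.
apply: contrapT => nae; have PF : ProperFilter F.
  split => //; rewrite /F /= => F0; apply: nae; apply: filterS F0 => x h Kx.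
  by apply: contrapT; exact: h.
have FK : F K by apply: aeW.
have [z [Kz clz]] := cK F PF FK.
have [U Uz hU] := loc z Kz.
have FU : F (~` U).
  rewrite /F /=; by apply: filterS hU => x hx _ nP Ux; apply: nP; exact: hx.
by have [x [nU Ux]] := clz _ _ FU Uz.
Qed.

(** Off its support [V] vanishes almost everywhere only locally. On each compact cube [compact_ae]
    makes this a single null set, and countably many cubes exhaust the space. *)
Lemma form_support_ae (V : 'I_n.+1 -> Cn R n.+1 -> R[i]) : compact (form_support V) ->
  exists rho, {ae mu, forall z, ~ ccube rho z -> forall j, V j z = 0}.
Proof.
(* The compactness bound holds for every number above [M], for instance [Num.max M 0 + 1]; one more
   unit makes the inequality strict, so that the support lies in the interior of the cube. *)
move=> /compact_bounded[M [_ hM]]; pose rho := Num.max M 0 + 2; exists rho.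
have supp z : form_support V z -> `|z| < rho.
  move=> Vz; apply: (@le_lt_trans _ _ (Num.max M 0 + 1)).
    by apply: hM => //; rewrite ltr_pwDr// le_max lexx.
  by rewrite ltrD2l; lra.
have H (k : nat) : {ae mu, forall z, ccube k%:R z -> ~ ccube rho z -> forall j, V j z = 0}.
  apply: compact_ae; first exact: compact_ccube.
  move=> z _; have [Vz|Vz] := pselect (form_support V z).
    by exists (ccube rho); [exact: nbhs_ccube (supp z Vz)|apply: aeW].
  move: Vz; rewrite /form_support /setC /= => /contrapT[U Uz hU].
  by exists U => //; apply: filterS hU => x hx Ux _ j; exact: hx.
have : {ae mu, forall z k, ccube k%:R z -> ~ ccube rho z -> forall j, V j z = 0}.
  exact: ae_foralln.
apply: filterS => z hz; have [k kz] := in_cube z; apply: (hz k) => i.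
by have := kz i; rewrite -ltr_norml => /ltW.
Qed.

Lemma vanishing_ccube (u : Cn R n.+1 -> R[i]) : vanishes_at_infinity u ->
  forall del : R, 0 < del -> exists M,
    {ae mu, forall z, ~ ccube M z -> normc (u z) <= del}.
Proof.
move=> [w [uw _ w0]] del del0.
have nb : nbhs (0 : (R[i] : numFieldType)) [set x | normc x <= del].
  apply/nbhs_ballP; exists (del%:C%C); first by rewrite /= ltcR.
  move=> x; rewrite -ball_normE /= sub0r normrN => h; apply: ltW.
  by rewrite -ltcR.
have [M _ hM] := w0 _ nb; exists M.
apply: filterS uw => z uz nc; rewrite uz//; apply: hM => /=.
have [i /negP] : exists i, ~ (`|coordinate i z| <= M) by apply/existsNP.
by rewrite -ltNge => /lt_le_trans; apply; exact: norm_coordinate_le.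
Qed.

(** For finite [p] take [r = p]. For [p = +oo] the function is essentially bounded and vanishes off
    a cube of finite measure, hence has finite integrals of every positive power; 3 is one exponent
    above 2. *)
Lemma in_Lp_real_exponent (p : \bar R) (f : Cn R n.+1 -> R[i]) rho : (2%:E < p)%E ->
  in_Lp p f -> {ae mu, forall z, ~ ccube rho z -> f z = 0} ->
  exists2 r : R, 2 < r & (\int[mu]_z (normc (f z) `^ r)%:E < +oo)%E.
Proof.
move=> p2 [mf fp] f0; have mn := measurable_normc (mf : cmeas f).
case: p p2 fp => [r|_|]; [| |by []].
- rewrite lte_fin => r2 fp; exists r => //.
  have r0 : r != 0 by rewrite gt_eqF//; lra.
  have := poweR_Lnorm mu (EFin \o cmod f) r0.
  have -> : (\int[mu]_z (`|(EFin \o cmod f) z| `^ r))%E =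
      (\int[mu]_z (normc (f z) `^ r)%:E)%E.
    apply: eq_integral => z _ /=.
    by rewrite ger0_norm ?normc_ge0.
  by move=> <-; apply: poweR_lty.
- rewrite /finite_norm unlock => fp; exists 3; first lra.
  have [B fB] : exists B : R, {ae mu, forall z, normc (f z) <= B}.
    move: fp; case: ifP => [_|/negbT].
      have -> : abse \o (EFin \o cmod f) = EFin \o cmod f.
        by apply/funext => z /=; rewrite ger0_norm ?normc_ge0.
      exact: ess_supr_bounded.
    (* The degenerate branch in the definition of the norm: the whole space would have measure 0,
       and then any bound holds almost everywhere. *)
    rewrite -leNgt => mu0 _; exists 0; exists setT; split => //.
    by apply/eqP; rewrite eq_le mu0 measure_ge0.
  have B0 : 0 <= `|B| `^ 3 by exact: powR_ge0.
  have mp : measurable_fun setT (fun z => (normc (f z) `^ 3)%:E).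
    by apply/measurable_EFinP; apply: (measurableT_comp (measurable_powR _)).
  have mI : measurable_fun setT (\1_(ccube rho) : Cn R n.+1 -> R).
    by apply: measurable_indic; exact: measurable_ccube.
  apply: (@le_lt_trans _ _ (\int[mu]_z ((`|B| `^ 3)%:E * (\1_(ccube rho) z)%:E))%E).
    apply: ae_ge0_le_integral => //.
    - by move=> z _; rewrite lee_fin powR_ge0.
    - by apply: measurable_funeM; exact/measurable_EFinP.
    - apply: filterS2 fB f0 => z fz f0z _; rewrite -EFinM lee_fin indicE.
      have [cz|cz] := pselect (ccube rho z); last first.
        by rewrite f0z// normc0 powR0// memNset// mulr0.
      rewrite mem_set// mulr1; apply: ge0_ler_powR; rewrite ?nnegrE ?normc_ge0//.
      by apply: le_trans fz _; exact: ler_norm.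
  rewrite ge0_integralZl//; last by exact/measurable_EFinP.
  rewrite integral_indic//; last exact: measurable_ccube.
  by rewrite setIT; apply: lte_mul_pinfty => //; exact: ccube_lty.
Qed.

End supports.

Section compactly_supported_potential.
Context {R : realType} {m : nat}.
Notation mu := (lebesgue_Cn R m.+1).
Notation nu := (@slice_measure R m).

Variables (u W : Cn R m.+1 -> R[i]) (rho r : R).
Hypothesis hu : in_L2loc u.
Hypothesis r2 : 2 < r.
Hypothesis mW : cmeas W.
Hypothesis Wr : (\int[mu]_z (normc (W z) `^ r)%:E < +oo)%E.
Hypothesis W0 : {ae mu, forall z, ~ ccube rho z -> W z = 0}.

Let mI : measurable_fun setT (\1_(ccube rho) : Cn R m.+1 -> R).
Proof. by apply: measurable_indic; exact: measurable_ccube. Qed.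

Let iI : mu.-integrable setT (EFin \o (\1_(ccube rho) : Cn R m.+1 -> R)).
Proof.
apply/integrableP; split; first exact/measurable_EFinP.
have -> : (\int[mu]_z `|(EFin \o \1_(ccube rho)) z| = \int[mu]_z (\1_(ccube rho) z)%:E)%E.
  by apply: eq_integral => z _; rewrite gee0_abs ?lee_fin.
by rewrite integral_indic//; [rewrite setIT; exact: ccube_lty|exact: measurable_ccube].
Qed.

Let iWr : mu.-integrable setT (EFin \o (fun z => normc (W z) `^ r)).
Proof.
apply/integrableP; split.
  apply/measurable_EFinP; apply: (measurableT_comp (measurable_powR _)).
  exact: measurable_normc.
by under eq_integral do rewrite gee0_abs ?lee_fin ?powR_ge0//.
Qed.

Let iu : mu.-integrable setT (EFin \o (fun z => \1_(ccube rho) z * cmod u z ^+ 2)).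
Proof.
have mn := measurable_normc (hu.1 : cmeas u).
apply/integrableP; split.
  by apply/measurable_EFinP; apply: measurable_funM => //; exact: measurable_funX.
have := hu.2 _ (@compact_ccube _ _ rho).
apply: le_lt_trans; rewrite le_eqVlt; apply/orP; left; apply/eqP.
rewrite [RHS]integral_mkcond; apply: eq_integral => z _; rewrite patchE /= indicE.
by case: ifP => _; rewrite ?mul1r ?mul0r ?normr0// ger0_norm// sqr_ge0.
Qed.

Let sqr_le_powR (t : R) : 0 <= t -> t ^+ 2 <= 1 + t `^ r.
Proof.
move=> t0; have [t1|t1] := leP t 1.
  by apply: le_trans (exprn_ile1 _ t0 t1) _; rewrite lerDl powR_ge0.
rewrite -powR_mulrn//; apply: (@le_trans _ _ (t `^ r)); last by rewrite lerDr.
by apply: ler_powR; [exact: ltW|rewrite ltW].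
Qed.

(** On the cube [t <= 1 + t^2 <= 2 + t^r] with [t = |W|]; off the cube [W] vanishes. *)
Lemma cintble_form : cintble mu W.
Proof.
apply: (@cintble_ae_le _ _ _ _ _ (fun z => 2 * \1_(ccube rho) z + normc (W z) `^ r)) => //.
  exact: (integrableD measurableT (integrable_scale 2 iI) iWr).
apply: filterS W0 => z Wz; have w0 := normc_ge0 (W z).
have [cz|cz] := pselect (ccube rho z); last by rewrite Wz// normc0 addr_ge0 ?powR_ge0// mulr_ge0.
rewrite indicE mem_set// -[true%:R]/(1 : R); have := sqr_le_powR w0.
by have := sqr_ge0 (normc (W z) - 1); move: (normc (W z)) (_ `^ r) w0 => t s *; nra.
Qed.

(** On the cube [|W u| <= |W|^2 + |u|^2 <= 1 + |W|^r + |u|^2], so local square integrability of [u]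
    suffices. *)
Lemma cintble_form_mul : cintble mu (fun z => W z * u z).
Proof.
apply: (@cintble_ae_le _ _ _ _ _ (fun z => (\1_(ccube rho) z + normc (W z) `^ r) +
    \1_(ccube rho) z * cmod u z ^+ 2)).
- by apply: cmeasM => //; exact: hu.1.
- exact: (integrableD measurableT (integrableD measurableT iI iWr) iu).
apply: filterS W0 => z Wz; have w0 := normc_ge0 (W z); have u0 := normc_ge0 (u z).
have [cz|cz] := pselect (ccube rho z); last first.
  rewrite Wz// mul0r normc0; apply: addr_ge0; first by rewrite addr_ge0 ?powR_ge0.
  by rewrite mulr_ge0 ?sqr_ge0.
rewrite indicE mem_set// -[true%:R]/(1 : R) mul1r normcM /cmod; have := sqr_le_powR w0.
by move: (normc (W z)) (normc (u z)) (_ `^ r) w0 u0 => t s v *; nra.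
Qed.

Lemma dbar_uniqueness : weak_dbar ord0 u (fun z => W z * u z) ->
  (forall del : R, 0 < del -> exists M,
    {ae mu, forall z, ~ ccube M z -> normc (u z) <= del}) ->
  {ae mu, forall z, u z = 0}.
Proof.
move=> weq uoo; pose U p := u (@slice R m p); pose V p := W (@slice R m p).
have mU : cmeas U by have /cmeas_slice := hu.1.
have Vi : cintble nu V by have /cintble_slice := cintble_form.
have gi : cintble nu (fun p => V p * U p) by have /cintble_slice := cintble_form_mul.
have rep : {ae nu, forall p, mass%:C%C * U p = slice_cauchy (fun p => V p * U p) p}.
  apply: slice_cauchy_representation => //; first by move=> M; exact: cintble_cut_slice.
  move=> k a lo hi k0; exact: (box_mollified_identity hu cintble_form_mul weq uoo a lo hi k0).
have Vr : (\int[nu]_p (normc (V p) `^ r)%:E < +oo)%E.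
  move: Wr; rewrite ge0_integral_slice//; last by move=> z; rewrite lee_fin powR_ge0.
  apply/measurable_EFinP; apply: (measurableT_comp (measurable_powR _)).
  exact: measurable_normc.
have mVr : measurable_fun setT (fun p => (normc (V p) `^ r)%:E).
  apply/measurable_EFinP; apply: (measurableT_comp (measurable_powR _)).
  exact: measurable_normc Vi.1.
have sections : {ae Cn_measure m, forall w,
    (\int[plane_measure]_z (normc (V (z, w)) `^ r)%:E < +oo)%E}.
  have hi : cintble nu (fun p => (normc (V p) `^ r)%:C%C).
    split; first by apply: cmeas_real; exact/measurable_EFinP.
    by under eq_integral do rewrite normc_real ger0_norm ?powR_ge0//.
  apply: filterS (ae_cintble2 hi) => w [_].
  by under eq_integral do rewrite normc_real ger0_norm ?powR_ge0//.
apply/ae_slice; apply: ae_of_sections mU _.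
(* By Fubini almost every [w] satisfies all the conditions of [plane_uniqueness] at once, with
   [mass] as the constant [c]. *)
near=> w.
apply: (@plane_uniqueness _ r mass%:C%C (fun z => V (z, w)) (fun z => U (z, w)) r2).
- by rewrite -normc0_eq0 normc_real normr_eq0 gt_eqF// mass_gt0.
- exact: (cmeas_pair2 w Vi.1).
- by near: w.
- by near: w; exact: ae_cintble2 Vi.
- by near: w; exact: ae_cintble2 gi.
- by near: w; exact: ae_sections rep.
Unshelve. all: by end_near. Qed.

End compactly_supported_potential.

Theorem theorem1p4 (R : realType) (n : nat) (hn : (0 < n)%N)
    (u : Cn R n -> R[i]) (hu : in_L2loc u)
    (p : \bar R) (hp : (2%:E < p)%E)
    (V : 'I_n -> Cn R n -> R[i]) (hV : form_in_Lp p V)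
    (heq : dbar_equation u V)
    (hsupp : compact (form_support V))
    (hlim : vanishes_at_infinity u) :
  {ae lebesgue_Cn R n, forall z, u z = 0}.
Proof.
case: n hn u hu V hV heq hsupp hlim => // m _ u hu V hV heq hsupp hlim.
have [rho hrho] := form_support_ae hsupp.
have V0 : {ae lebesgue_Cn R m.+1, forall z, ~ ccube rho z -> V ord0 z = 0}.
  by apply: filterS hrho => z hz nz; exact: hz.
have [r r2 Vr] := in_Lp_real_exponent hp (hV ord0) V0.
exact: (dbar_uniqueness hu r2 (hV ord0).1 Vr V0 (heq ord0) (vanishing_ccube hlim)).
Qed.
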